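(* Let $\alpha,\beta>0$, let $n$ be a positive integer and $g_i\in H(\mathbb{D})$ for $i=1,\dots,n$. Suppose $N_i,k_i\in\mathbb{N}$ satisfy $0<t_i:=N_i-k_i<N_i$ for each $i$, and the numbers $t_1,\dots,t_n$ are pairwise different. For $g\in H(\mathbb{D})$ let $I_g^{N,k}f=I^N(f^{(k)}g)$. Then $\sum_{i=1}^n I_{g_i}^{N_i,k_i}:\mathcal{B}^{\alpha}\to\mathcal{B}^{\beta}$ is bounded (respectively compact) if and only if each $I_{g_i}^{N_i,k_i}:\mathcal{B}^{\alpha}\to\mathcal{B}^{\beta}$, $1\le i\le n$, is bounded (respectively compact).
   Context: $\mathbb{D}$ is the open unit disc in $\mathbb{C}$ and $H(\mathbb{D})$ the space of analytic functions on $\mathbb{D}$. For $\alpha>0$, $\mathcal{B}^{\alpha}$ is the Banach space of $f\in H(\mathbb{D})$ with $\|f\|_{\mathcal{B}^{\alpha}}=|f(0)|+\sup_{z\in\mathbb{D}}(1-|z|^2)^{\alpha}|f'(z)|<\infty$. $I$ is the integration operator $If(z)=\int_0^z f(\zeta)\,d\zeta$ and $I^N$ its $N$th iterate. An operator is bounded (compact) from $\mathcal{B}^\alpha$ to $\mathcal{B}^\beta$ if it maps $\mathcal{B}^\alpha$ into $\mathcal{B}^\beta$ and is bounded (compact) as a linear operator between these Banach spaces. *)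

(* Defs.v *)
From Stdlib Require Import Reals.
From Coquelicot Require Import Coquelicot.
Open Scope R_scope.

Definition inD (z : C) : Prop := Cmod z < 1.

(* f is analytic (holomorphic) on D: complex differentiable at every point of D.
   Functions are total C -> C; only their values on D matter. *)
Definition analytic_D (f : C -> C) : Prop := forall z, inD z -> ex_derive f z.

Definition cder (f : C -> C) : C -> C := C_derive f.
Definition cder_n (k : nat) (f : C -> C) : C -> C := Nat.iter k cder f.

(* Integration operator  I f (z) = \int_0^z f(w) dw  (along the segment [0,z]) *)
Definition Iop (f : C -> C) : C -> C :=
  fun z => RInt (V := C_R_CompleteNormedModule)
                (fun t : R => (f (RtoC t * z) * z)%C) 0 1.

Definition Iop_n (N : nat) (f : C -> C) : C -> C := Nat.iter N Iop f.

Definition IgNk (N k : nat) (g : C -> C) (f : C -> C) : C -> C :=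
  Iop_n N (fun z => (cder_n k f z * g z)%C).

Definition bloch_w (a : R) (f : C -> C) (z : C) : R :=
  Rpower (1 - (Cmod z)^2) a * Cmod (cder f z).

Definition in_bloch (a : R) (f : C -> C) : Prop :=
  analytic_D f /\ exists M : R, forall z, inD z -> bloch_w a f z <= M.

Definition bloch_norm (a : R) (f : C -> C) : R :=
  Cmod (f 0%C) + real (Lub_Rbar (fun r => exists z, inD z /\ r = bloch_w a f z)).

Definition fsub (f h : C -> C) : C -> C := fun z => (f z - h z)%C.

Definition bounded_op (a b : R) (T : (C -> C) -> (C -> C)) : Prop :=
  (forall f, in_bloch a f -> in_bloch b (T f)) /\
  exists K : R, forall f, in_bloch a f -> bloch_norm b (T f) <= K * bloch_norm a f.

(* T : B^a -> B^b compact: maps B^a into B^b and the image of the unit ball is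
   relatively compact in B^b (sequential formulation, B^b being a metric space). *)
Definition compact_op (a b : R) (T : (C -> C) -> (C -> C)) : Prop :=
  (forall f, in_bloch a f -> in_bloch b (T f)) /\
  forall fs : nat -> (C -> C),
    (forall m, in_bloch a (fs m) /\ bloch_norm a (fs m) <= 1) ->
    exists (phi : nat -> nat) (h : C -> C),
      (forall m, (phi m < phi (S m))%nat) /\ in_bloch b h /\
      is_lim_seq (fun m => bloch_norm b (fsub (T (fs (phi m))) h)) 0.

Fixpoint csum (n : nat) (F : nat -> C) : C :=
  match n with O => 0%C | S m => (csum m F + F m)%C end.

(* Main.v *)
(* For [T = I_g^(N,k)] and [t = N - k], the [N]-th derivative of [T f] is [g f^(k)], and
   [f |-> f^(k)] costs [k - 1] powers of [d(z) = 1 - |z|] on top of [f' = O(d^-alpha)] while each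
   integration gains one. Hence [T] is bounded (compact) as soon as [d^(beta - alpha + t) |g|] is
   bounded (tends to [0] at the circle); for compactness one uses Montel's theorem.
   Conversely, differentiate the sum [S f] up to a common order [NN >= N_i]. By Leibniz' rule this is
   [sum_j H_j f^(j)], where [H_(NN - t_i)] is [g_i] plus derivatives of those [g_j] with [t_j < t_i],
   because the [t_i] are distinct. The test functions [d(w)^(1-alpha) ((1-|w|^2) / (1 - conj w z))^M]
   have, at [z = w], a [j]-th derivative proportional to [M (M+1) ... (M+j-1)]; letting [M] vary
   separates the terms and bounds every [d^(beta - alpha + NN - j) |H_j|]. Induction on [t_i], with
   Cauchy's estimates for the derivatives, then gives the condition for each [g_i].
   Only complex differentiability is assumed, so Cauchy's theory is built from Goursat's bisection,
   applied to forms pulled back to the unit square. *)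
Require Import Defs.
From Stdlib Require Import Arith Reals Lra Lia Psatz ClassicalEpsilon.
From Coquelicot Require Import Coquelicot.
Open Scope R_scope.

(** * Complex differentiation *)


(** The proof works with top derivatives instead of norms. If all derivatives of [u] of order less
    than [N] vanish at 0, then the norm of [u] in B^b is comparable to the supremum of
    [d^(b + N - 1) |u^(N)|]: one direction is Cauchy's estimate, the other integrates along radii
    and needs [b > 0]. Functions [I^N F] have these zeros, so no constants of integration appear.
    The condition [0 < N - k < N] forces [1 <= k < N], so that [f^(k)] is a derivative of [f'],
    which is all that the weight of B^alpha controls. The obstacle in the converse is cancellation:
    a test function sees only the sum, and the summands become products only after different numbers
    of differentiations. The exponents make the induction close: [beta - alpha + NN - j] at
    [j = NN - t_i] is the exponent [beta - alpha + t_i] required of [g_i], and differentiating [g_j]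
    exactly [t_i - t_j] times raises its exponent to the same value. Only the behaviour near the
    circle is at stake, since analytic functions are bounded on smaller discs. *)

Lemma Cmod_minus_sym (a b : C) : Cmod (a - b) = Cmod (b - a).
Proof. rewrite <- Cmod_opp. f_equal. ring. Qed.

Lemma Cmod_triangle_minus (a b : C) : Cmod (a - b) <= Cmod a + Cmod b.
Proof. unfold Cminus. rewrite <- (Cmod_opp b). apply Cmod_triangle. Qed.

Lemma Cmod_triangle_rev (a b : C) : Cmod a - Cmod b <= Cmod (a - b).
Proof.
  replace a with ((a - b) + b)%C at 1 by ring.
  generalize (Cmod_triangle (a - b) b). lra.
Qed.

Lemma Cmod_triangle_3 (a b c : C) : Cmod (a - c) <= Cmod (a - b) + Cmod (b - c).
Proof. replace (a - c)%C with ((a - b) + (b - c))%C by ring. apply Cmod_triangle. Qed.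

Lemma fun_choice {X Y : Type} (P : X -> Y -> Prop) :
  (forall x, exists y, P x y) -> exists f, forall x, P x (f x).
Proof.
  intros H. exists (fun x => proj1_sig (constructive_indefinite_description _ (H x))).
  intros x. apply proj2_sig.
Qed.

Lemma Rlt_min_l (a b x : R) : x < Rmin a b -> x < a.
Proof. intros H. exact (Rlt_le_trans _ _ _ H (Rmin_l _ _)). Qed.

Lemma Rlt_min_r (a b x : R) : x < Rmin a b -> x < b.
Proof. intros H. exact (Rlt_le_trans _ _ _ H (Rmin_r _ _)). Qed.

Lemma Rmult_frac_le (x e : R) : 0 <= x -> 0 <= e -> x * (e / (x + 1)) <= e.
Proof.
  intros Hx He. apply Rmult_le_reg_r with (x + 1); [lra|].
  replace (x * (e / (x + 1)) * (x + 1)) with (x * e) by (field; lra). nra.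
Qed.

Lemma Rdiv_in_0_1 (x y : R) : 0 <= x < y -> 0 <= x / y < 1.
Proof.
  intros H. split; [apply Rmult_le_pos; [lra|left; apply Rinv_0_lt_compat; lra]|].
  apply Rmult_lt_reg_r with y; [lra|]. unfold Rdiv. rewrite Rmult_assoc, Rinv_l; lra.
Qed.

Lemma Cmod_small_0 (a : C) : (forall eps, 0 < eps -> Cmod a <= eps) -> a = 0%C.
Proof.
  intros H. apply Cmod_eq_0. apply Rle_antisym; [|apply Cmod_ge_0].
  apply Rnot_lt_le. intros H1. specialize (H (Cmod a / 2)). lra.
Qed.

Lemma Cminus_eq_0 (a b : C) : (a - b = 0 -> a = b)%C.
Proof. intros H. replace a with ((a - b) + b)%C by ring. rewrite H. ring. Qed.

(* Epsilon-delta forms of complex and of real differentiability: Coquelicot's [is_derive]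
   lives on two different structures over [C], depending on the field of scalars. *)
Definition cd (f : C -> C) (z l : C) : Prop :=
  forall eps, 0 < eps -> exists d, 0 < d /\
    forall h : C, Cmod h < d -> Cmod (f (z + h) - f z - l * h)%C <= eps * Cmod h.

Definition rd (f : R -> C) (t : R) (l : C) : Prop :=
  forall eps, 0 < eps -> exists d, 0 < d /\
    forall h : R, Rabs h < d -> Cmod (f (t + h)%R - f t - l * h)%C <= eps * Rabs h.

Definition cont_C (f : C -> C) (z : C) : Prop :=
  forall eps, 0 < eps -> exists d, 0 < d /\
    forall y : C, Cmod (y - z) < d -> Cmod (f y - f z) < eps.

Definition cont_R (f : R -> C) (t : R) : Prop :=
  forall eps, 0 < eps -> exists d, 0 < d /\
    forall y : R, Rabs (y - t) < d -> Cmod (f y - f t) < eps.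

Lemma cd_is_derive (f : C -> C) (z l : C) :
  cd f z l <-> @is_derive C_AbsRing C_NormedModule f z l.
Proof.
  split.
  - intros H. split.
    { apply is_linear_scal_l. }
    intros x Hx.
    (* The derivative is stated at every limit point of the filter; separation identifies that point
       with [z]. *)
    assert (Hxz : x = z).
    { symmetry. apply (is_filter_lim_locally_unique (K := C_AbsRing) (V := AbsRing_NormedModule C_AbsRing)). exact Hx. }
    subst x. clear Hx.
    intros eps. destruct (H eps (cond_pos eps)) as [d [Hd H1]].
    exists (mkposreal d Hd). intros y Hy.
    change (Cmod ((f y - f z) - (y - z) * l)%C <= eps * Cmod (y - z)%C).
    change (Cmod (y - z)%C < d) in Hy.
    specialize (H1 (y - z)%C Hy).
    change C in y.
    replace (z + (y - z))%C with y in H1 by ring.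
    replace (f y - f z - (y - z) * l)%C with (f y - f z - l * (y - z))%C by ring. exact H1.
  - intros [_ H] eps Heps.
    specialize (H z).
    assert (Hz : is_filter_lim (locally (T:=AbsRing_UniformSpace C_AbsRing) z) z) by (intros P HP; exact HP).
    specialize (H Hz (mkposreal eps Heps)).
    destruct H as [d Hd]. exists d. split; [apply cond_pos|].
    intros h Hh. specialize (Hd (z + h)%C).
    assert (Hb : @ball (AbsRing_UniformSpace C_AbsRing) z d (z + h)%C).
    { change (Cmod ((z + h) - z)%C < d). replace (z + h - z)%C with h by ring. exact Hh. }
    specialize (Hd Hb).
    change (Cmod ((f (z+h)%C - f z) - ((z+h) - z) * l)%C <= eps * Cmod ((z+h) - z)%C) in Hd.
    replace (z + h - z)%C with h in Hd by ring.
    replace (l * h)%C with (h * l)%C by ring. exact Hd.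
Qed.

Lemma cd_cder (f : C -> C) (z l : C) : cd f z l -> cder f z = l.
Proof. intros H. apply is_C_derive_unique. apply cd_is_derive. exact H. Qed.

Lemma analytic_cd (f : C -> C) (z : C) : analytic_D f -> inD z -> cd f z (cder f z).
Proof.
  intros H Hz. destruct (H z Hz) as [l Hl]. apply cd_is_derive in Hl.
  rewrite (cd_cder _ _ _ Hl). exact Hl.
Qed.

Lemma cd_analytic (f df : C -> C) : (forall z, inD z -> cd f z (df z)) -> analytic_D f.
Proof. intros H z Hz. exists (df z). apply cd_is_derive. auto. Qed.

Lemma rd_is_derive (f : R -> C) (t : R) (l : C) :
  rd f t l -> @is_derive R_AbsRing C_R_NormedModule f t l.
Proof.
  intros H. split.
  { apply is_linear_scal_l. }
  intros x Hx.
  assert (Hxz : x = t).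
  { symmetry. apply (is_filter_lim_locally_unique (K := R_AbsRing) (V := R_NormedModule)). exact Hx. }
  subst x. clear Hx.
  intros eps. destruct (H eps (cond_pos eps)) as [d [Hd H1]].
  exists (mkposreal d Hd). intros y Hy.
  apply Rle_trans with (Cmod ((f y - f t) - (((y - t) * fst l, (y - t) * snd l)%R:C))%C).
  { rewrite Cmod_norm. apply Rle_refl. }
  change R in y. change (norm (minus y t)) with (Rabs (y - t)).
  change (Rabs (y - t) < d) in Hy.
  specialize (H1 (y - t) Hy).
  replace (t + (y - t)) with y in H1 by ring.
  eapply Rle_trans; [|exact H1]. apply Req_le. f_equal. f_equal. f_equal.
  destruct l as [a b]; unfold Cmult, RtoC; simpl; f_equal; ring.
Qed.

Lemma cont_R_continuous (f : R -> C) (t : R) :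
  cont_R f t -> @continuous R_UniformSpace C_R_NormedModule f t.
Proof.
  intros H P [eps HP].
  destruct (H eps (cond_pos eps)) as [d [Hd H1]].
  exists (mkposreal d Hd). intros y Hy. apply HP.
  assert (Hy' : Rabs (y - t) < d) by exact Hy.
  specialize (H1 y Hy').
  assert (HM := Rmax_Cmod (f y - f t)%C).
  split.
  - change (Rabs (fst (f y) - fst (f t)) < eps).
    eapply Rle_lt_trans; [|exact H1]. eapply Rle_trans; [|exact HM].
    apply Rmax_l.
  - change (Rabs (snd (f y) - snd (f t)) < eps).
    eapply Rle_lt_trans; [|exact H1]. eapply Rle_trans; [|exact HM].
    apply Rmax_r.
Qed.

(** Common form of [cd] and [rd], with [nu] equal to [Cmod] or [Rabs]: continuity and the chain rule
    are then proved once for complex and real variables. *)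
Definition small_o {X : Type} (nu : X -> R) (inc lin : X -> C) : Prop :=
  forall eps, 0 < eps -> exists d, 0 < d /\ forall h, nu h < d -> Cmod (inc h - lin h)%C <= eps * nu h.

Lemma small_o_cont {X : Type} (nu : X -> R) (inc lin : X -> C) (m : R) :
  (forall h, 0 <= nu h) -> (forall h, Cmod (lin h) = m * nu h) -> 0 <= m -> small_o nu inc lin ->
  forall eps, 0 < eps -> exists d, 0 < d /\ forall h, nu h < d -> Cmod (inc h) < eps.
Proof.
  intros Hnu Hlin Hm H eps Heps. destruct (H 1 Rlt_0_1) as [d [Hd H1]].
  assert (Hq : 0 < eps / (m + 2)) by (apply Rdiv_lt_0_compat; lra).
  exists (Rmin d (eps / (m + 2))). split; [apply Rmin_pos; lra|]. intros h Hh.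
  specialize (H1 h (Rlt_min_l _ _ _ Hh)).
  assert (H2 := Rlt_min_r _ _ _ Hh).
  assert (H3 := Cmod_triangle_rev (inc h) (lin h)). rewrite Hlin in H3.
  apply (Rmult_lt_compat_l (m + 2)) in H2; [|lra].
  replace ((m + 2) * (eps / (m + 2))) with eps in H2 by (field; lra).
  specialize (Hnu h). lra.
Qed.

Lemma cd_cont (f : C -> C) (z l : C) : cd f z l -> cont_C f z.
Proof.
  intros H eps Heps.
  destruct (small_o_cont Cmod (fun h => f (z + h) - f z)%C (fun h => l * h)%C (Cmod l)
    Cmod_ge_0 (Cmod_mult l) (Cmod_ge_0 l) H eps Heps) as [d [Hd H1]].
  exists d. split; [exact Hd|]. intros y Hy. specialize (H1 _ Hy).
  replace (z + (y - z))%C with y in H1 by ring. exact H1.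
Qed.

Lemma rd_cont (f : R -> C) (t : R) (l : C) : rd f t l -> cont_R f t.
Proof.
  intros H eps Heps.
  destruct (small_o_cont Rabs (fun h => f (t + h)%R - f t)%C (fun h => l * RtoC h)%C (Cmod l)
    Rabs_pos) with (eps := eps) as [d [Hd H1]]; auto using Cmod_ge_0.
  { intros h. rewrite Cmod_mult, Cmod_R. reflexivity. }
  exists d. split; [exact Hd|]. intros y Hy. specialize (H1 _ Hy).
  replace (t + (y - t)) with y in H1 by ring. exact H1.
Qed.

Lemma cd_ext_loc (f g : C -> C) (z l : C) (d : R) :
  0 < d -> (forall y, Cmod (y - z) < d -> f y = g y) -> cd f z l -> cd g z l.
Proof.
  intros Hd He H eps Heps. destruct (H eps Heps) as [d1 [Hd1 H1]].
  exists (Rmin d d1). split; [apply Rmin_pos; lra|].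
  intros h Hh.
  rewrite <- !He.
  - apply H1. eapply Rlt_le_trans; [exact Hh|apply Rmin_r].
  - replace (z - z)%C with (RtoC 0) by ring. rewrite Cmod_0. lra.
  - replace (z + h - z)%C with h by ring. eapply Rlt_le_trans; [exact Hh|apply Rmin_l].
Qed.

Lemma cd_const (c z : C) : cd (fun _ => c) z 0%C.
Proof.
  intros eps Heps. exists 1. split; [lra|]. intros h _.
  replace (c - c - 0 * h)%C with (RtoC 0) by ring. rewrite Cmod_0.
  apply Rmult_le_pos; [lra|apply Cmod_ge_0].
Qed.

Lemma cd_id (z : C) : cd (fun x => x) z 1%C.
Proof.
  intros eps Heps. exists 1. split; [lra|]. intros h _.
  replace (z + h - z - 1 * h)%C with (RtoC 0) by ring. rewrite Cmod_0.
  apply Rmult_le_pos; [lra|apply Cmod_ge_0].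
Qed.

Lemma cd_plus (f g : C -> C) (z a b : C) :
  cd f z a -> cd g z b -> cd (fun x => f x + g x)%C z (a + b)%C.
Proof.
  intros Hf Hg eps Heps.
  destruct (Hf (eps / 2)) as [d1 [Hd1 H1]]; [lra|].
  destruct (Hg (eps / 2)) as [d2 [Hd2 H2]]; [lra|].
  exists (Rmin d1 d2). split; [apply Rmin_pos; lra|]. intros h Hh.
  specialize (H1 h (Rlt_min_l _ _ _ Hh)).
  specialize (H2 h (Rlt_min_r _ _ _ Hh)).
  replace (f (z + h) + g (z + h) - (f z + g z) - (a + b) * h)%C
    with ((f (z + h) - f z - a * h) + (g (z + h) - g z - b * h))%C by ring.
  eapply Rle_trans; [apply Cmod_triangle|]. lra.
Qed.

Lemma cd_scal (f : C -> C) (c z a : C) : cd f z a -> cd (fun x => c * f x)%C z (c * a)%C.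
Proof.
  intros Hf eps Heps. assert (Hc := Cmod_ge_0 c).
  assert (He : 0 < eps / (Cmod c + 1)) by (apply Rdiv_lt_0_compat; lra).
  destruct (Hf _ He) as [d [Hd H]].
  exists d. split; [exact Hd|]. intros h Hh. specialize (H h Hh).
  replace (c * f (z + h) - c * f z - c * a * h)%C with (c * (f (z + h) - f z - a * h))%C by ring.
  rewrite Cmod_mult.
  apply Rle_trans with ((Cmod c + 1) * (eps / (Cmod c + 1) * Cmod h)).
  - apply Rmult_le_compat; try lra. apply Cmod_ge_0.
  - apply Req_le. field. lra.
Qed.

Lemma cd_minus (f g : C -> C) (z a b : C) :
  cd f z a -> cd g z b -> cd (fun x => f x - g x)%C z (a - b)%C.
Proof.
  intros Hf Hg.
  assert (H : cd (fun x => f x + (- (1)) * g x)%C z (a + (- (1)) * b)%C)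
    by (apply cd_plus; [exact Hf|apply cd_scal; exact Hg]).
  replace (a - b)%C with (a + (- (1)) * b)%C by ring.
  apply (cd_ext_loc (fun x => f x + (- (1)) * g x)%C _ _ _ 1); [lra| |exact H].
  intros y _. ring.
Qed.

(** The error is that of [f] at the inner increment plus [a] times the inner error. The choice
    [e2 <= 1] keeps the increment below [(1 + m) * nu h], so that each part costs at most half of
    [eps * nu h]. *)
Lemma small_o_chain {X : Type} (nu : X -> R) (inc lin : X -> C) (m : R) (f : C -> C) (z a : C) :
  (forall h, 0 <= nu h) -> (forall h, Cmod (lin h) = m * nu h) -> 0 <= m ->
  cd f z a -> small_o nu inc lin ->
  small_o nu (fun h => f (z + inc h) - f z)%C (fun h => a * lin h)%C.
Proof.
  intros Hnu Hlin Hm Hf Hg eps Heps. assert (Ha := Cmod_ge_0 a).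
  set (e1 := eps / (2 * (m + 1))).
  assert (He1 : 0 < e1) by (apply Rdiv_lt_0_compat; lra).
  set (e2 := Rmin 1 (eps / (2 * (Cmod a + 1)))).
  assert (He2' : 0 < eps / (2 * (Cmod a + 1))) by (apply Rdiv_lt_0_compat; lra).
  assert (He2 : 0 < e2) by (apply Rmin_pos; lra).
  destruct (Hf e1 He1) as [d1 [Hd1 H1]]. destruct (Hg e2 He2) as [d2 [Hd2 H2]].
  destruct (small_o_cont nu inc lin m Hnu Hlin Hm Hg d1 Hd1) as [d3 [Hd3 H3]].
  exists (Rmin d2 d3). split; [apply Rmin_pos; lra|]. intros h Hh.
  specialize (H2 h (Rlt_min_l _ _ _ Hh)).
  specialize (H1 _ (H3 h (Rlt_min_r _ _ _ Hh))).
  replace (f (z + inc h) - f z - a * lin h)%C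
    with ((f (z + inc h) - f z - a * inc h) + a * (inc h - lin h))%C by ring.
  eapply Rle_trans; [apply Cmod_triangle|]. rewrite Cmod_mult.
  assert (Hn := Hnu h).
  assert (H5 : Cmod (inc h) <= (1 + m) * nu h).
  { generalize (Cmod_triangle_rev (inc h) (lin h)). rewrite Hlin.
    assert (e2 <= 1) by apply Rmin_l. nra. }
  assert (H6 : e2 <= eps / (2 * (Cmod a + 1))) by apply Rmin_r.
  assert (H7 : e1 * (1 + m) = eps / 2) by (unfold e1; field; lra).
  assert (H8 : (Cmod a + 1) * (eps / (2 * (Cmod a + 1))) = eps / 2) by (field; lra).
  assert (H9 : Cmod a * e2 <= eps / 2) by nra.
  apply Rle_trans with (e1 * ((1 + m) * nu h) + Cmod a * (e2 * nu h)).
  - apply Rplus_le_compat; [|apply Rmult_le_compat_l; lra].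
    eapply Rle_trans; [exact H1|]. apply Rmult_le_compat_l; lra.
  - nra.
Qed.

Lemma cd_comp_rd (f : C -> C) (g : R -> C) (t : R) (a b : C) :
  cd f (g t) a -> rd g t b -> rd (fun x => f (g x)) t (a * b)%C.
Proof.
  intros Hf Hg eps Heps.
  destruct (small_o_chain Rabs (fun h => g (t + h)%R - g t)%C (fun h => b * RtoC h)%C (Cmod b) f (g t) a
    Rabs_pos) with (eps := eps) as [d [Hd H]]; auto using Cmod_ge_0.
  { intros h. rewrite Cmod_mult, Cmod_R. reflexivity. }
  exists d. split; [exact Hd|]. intros h Hh. specialize (H h Hh). simpl in H.
  replace (g t + (g (t + h)%R - g t))%C with (g (t + h)%R) in H by ring.
  rewrite <- Cmult_assoc. exact H.
Qed.

Lemma cd_rd (f : C -> C) (z h l : C) (t : R) :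
  cd f (z + t * h)%C l -> rd (fun x => f (z + x * h)%C) t (l * h)%C.
Proof.
  intros H. apply (cd_comp_rd f (fun x => z + x * h)%C); [exact H|].
  intros eps Heps. exists 1. split; [lra|]. intros k _.
  rewrite RtoC_plus.
  replace (z + (t + k) * h - (z + t * h) - h * k)%C with (RtoC 0) by ring.
  rewrite Cmod_0. apply Rmult_le_pos; [lra|apply Rabs_pos].
Qed.

Lemma cd_comp (f g : C -> C) (z a b : C) :
  cd f (g z) a -> cd g z b -> cd (fun x => f (g x)) z (a * b)%C.
Proof.
  intros Hf Hg eps Heps.
  destruct (small_o_chain Cmod (fun h => g (z + h) - g z)%C (fun h => b * h)%C (Cmod b) f (g z) a
    Cmod_ge_0 (Cmod_mult b) (Cmod_ge_0 b) Hf Hg eps Heps) as [d [Hd H]].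
  exists d. split; [exact Hd|]. intros h Hh. specialize (H h Hh). simpl in H.
  replace (g z + (g (z + h) - g z))%C with (g (z + h)%C) in H by ring.
  rewrite <- Cmult_assoc. exact H.
Qed.

Lemma cd_sqr (z : C) : cd (fun x => x * x)%C z (2 * z)%C.
Proof.
  intros eps Heps. exists eps. split; [lra|]. intros h Hh.
  replace ((z + h) * (z + h) - z * z - 2 * z * h)%C with (h * h)%C by ring.
  rewrite Cmod_mult. apply Rmult_le_compat_r; [apply Cmod_ge_0|lra].
Qed.

(* Polarization: a product is a combination of squares. *)
Lemma cd_mult (f g : C -> C) (z a b : C) :
  cd f z a -> cd g z b -> cd (fun x => f x * g x)%C z (a * g z + f z * b)%C.
Proof.
  intros Hf Hg.
  assert (Hp := cd_comp _ _ _ _ _ (cd_sqr _) (cd_plus _ _ _ _ _ Hf Hg)).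
  assert (Hm := cd_comp _ _ _ _ _ (cd_sqr _) (cd_minus _ _ _ _ _ Hf Hg)).
  assert (H := cd_scal _ (/ 4)%C _ _ (cd_minus _ _ _ _ _ Hp Hm)).
  simpl in H.
  assert (H4 : RtoC 4 <> RtoC 0).
  { intros E. apply RtoC_inj in E. lra. }
  replace (a * g z + f z * b)%C with (/ 4 * (2 * (f z + g z) * (a + b) - 2 * (f z - g z) * (a - b)))%C
    by (field; exact H4).
  eapply cd_ext_loc; [exact Rlt_0_1| |exact H].
  intros y _. simpl. field.
Qed.

Lemma cd_inv (z : C) : (z <> 0)%C -> cd (fun x => / x)%C z (- / (z * z))%C.
Proof.
  intros Hz eps Heps.
  assert (Hm : 0 < Cmod z) by (apply Cmod_gt_0; exact Hz).
  set (m := Cmod z) in *.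
  assert (Hq : 0 < eps * (m * m * m) / 2) by (apply Rdiv_lt_0_compat; [|lra]; repeat apply Rmult_lt_0_compat; lra).
  (* The first bound keeps [|z + h| >= m / 2]. The remainder [h^2 / (z^2 (z + h))] is then at most
     [2 |h|^2 / m^3], and the second bound makes this at most [eps |h|]. *)
  exists (Rmin (m / 2) (eps * (m * m * m) / 2)). split; [apply Rmin_pos; lra|].
  intros h Hh.
  assert (Hh1 := Rlt_min_l _ _ _ Hh).
  assert (Hh2 := Rlt_min_r _ _ _ Hh).
  assert (Hzh : m / 2 <= Cmod (z + h)).
  { generalize (Cmod_triangle_rev z (- h)%C). rewrite Cmod_opp. fold m.
    replace (z - - h)%C with (z + h)%C by ring. lra. }
  assert (Hzh0 : (z + h <> 0)%C) by (apply Cmod_gt_0; lra).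
  replace (/ (z + h) - / z - - / (z * z) * h)%C with (h * h / ((z * z) * (z + h)))%C
    by (field; auto).
  rewrite Cmod_div by (repeat apply Cmult_neq_0; auto).
  rewrite !Cmod_mult. fold m.
  assert (Hh0 := Cmod_ge_0 h).
  set (q := Cmod (z + h)) in *.
  apply Rle_trans with (Cmod h * Cmod h / (m * m * (m / 2))).
  - apply Rmult_le_compat_l; [nra|]. apply Rinv_le_contravar; nra.
  - apply Rmult_le_reg_r with (m * m * (m / 2)); [nra|].
    unfold Rdiv at 1. rewrite Rmult_assoc, Rinv_l by nra. nra.
Qed.

(** * Integrals of complex functions and Goursat's theorem *)


Notation CRV := C_R_CompleteNormedModule.
Notation ex_CI := (ex_RInt (V := CRV)).

Definition CI (f : R -> C) (a b : R) : C := RInt (V := CRV) f a b.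

Lemma cont_R_ex_RInt (f : R -> C) (a b : R) :
  (forall t, cont_R f t) -> ex_CI f a b.
Proof. intros H. apply ex_RInt_continuous. intros t _. apply cont_R_continuous. apply H. Qed.

Lemma cont_R_ex_RInt_in (f : R -> C) (a b : R) :
  a <= b -> (forall t, a <= t <= b -> cont_R f t) -> ex_CI f a b.
Proof.
  intros Hab H. apply ex_RInt_continuous. intros t Ht.
  rewrite Rmin_left, Rmax_right in Ht by exact Hab.
  apply cont_R_continuous. apply H. exact Ht.
Qed.

Lemma CI_ftc (F f : R -> C) (a b : R) :
  a <= b -> (forall t, a <= t <= b -> rd F t (f t)) ->
  (forall t, a <= t <= b -> cont_R f t) -> CI f a b = (F b - F a)%C.
Proof.
  intros Hab HF Hc. unfold CI.
  apply (is_RInt_unique (V := CRV)).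
  apply (is_RInt_derive (V := CRV) F f a b); intros t Ht;
    rewrite Rmin_left, Rmax_right in Ht by exact Hab.
  - apply rd_is_derive, HF, Ht.
  - apply cont_R_continuous, Hc, Ht.
Qed.

Lemma CI_bound (f : R -> C) (a b M : R) :
  a <= b -> ex_CI f a b ->
  (forall t, a <= t <= b -> Cmod (f t) <= M) -> Cmod (CI f a b) <= (b - a) * M.
Proof.
  intros Hab Hex HM. rewrite Cmod_norm.
  apply (norm_RInt_le_const (V := C_R_NormedModule) f a b (CI f a b) M Hab).
  - intros t Ht. rewrite <- Cmod_norm. apply HM, Ht.
  - apply (RInt_correct (V := CRV)), Hex.
Qed.

Lemma CI_ext (f g : R -> C) (a b : R) :
  a <= b -> (forall t, a <= t <= b -> f t = g t) -> CI f a b = CI g a b.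
Proof.
  intros Hab H. apply (RInt_ext (V := CRV)).
  intros t Ht. rewrite Rmin_left, Rmax_right in Ht by exact Hab. apply H. lra.
Qed.

Lemma CI_plus (f g : R -> C) (a b : R) :
  ex_CI f a b -> ex_CI g a b ->
  CI (fun t => f t + g t)%C a b = (CI f a b + CI g a b)%C.
Proof. intros Hf Hg. exact (RInt_plus (V := CRV) f g a b Hf Hg). Qed.

Lemma CI_minus (f g : R -> C) (a b : R) :
  ex_CI f a b -> ex_CI g a b ->
  CI (fun t => f t - g t)%C a b = (CI f a b - CI g a b)%C.
Proof. intros Hf Hg. exact (RInt_minus (V := CRV) f g a b Hf Hg). Qed.

Lemma CI_chasles (f : R -> C) (a b c : R) :
  ex_CI f a b -> ex_CI f b c ->
  (CI f a b + CI f b c)%C = CI f a c.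
Proof. intros Hf Hg. exact (RInt_Chasles (V := CRV) f a b c Hf Hg). Qed.

(** The integral takes values in a real vector space, in which a complex factor is no scalar; hence
    the passage through real and imaginary parts. *)
Lemma CI_scal (f : R -> C) (c : C) (a b : R) :
  ex_CI f a b ->
  CI (fun t => c * f t)%C a b = (c * CI f a b)%C.
Proof.
  intros [l Hl].
  assert (H1 := is_RInt_fct_extend_fst (U := R_NormedModule) (V := R_NormedModule) f a b l Hl).
  assert (H2 := is_RInt_fct_extend_snd (U := R_NormedModule) (V := R_NormedModule) f a b l Hl).
  replace (CI f a b) with l
    by (symmetry; apply (is_RInt_unique (V := CRV)); exact Hl).
  apply (is_RInt_unique (V := CRV)).
  apply (is_RInt_fct_extend_pair (U := R_NormedModule) (V := R_NormedModule)); simpl.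
  - apply (is_RInt_minus (V := R_NormedModule)); apply (is_RInt_scal (V := R_NormedModule)); assumption.
  - apply (is_RInt_plus (V := R_NormedModule)); apply (is_RInt_scal (V := R_NormedModule)); assumption.
Qed.

Lemma cont_R_mult (f g : R -> C) (t : R) :
  cont_R f t -> cont_R g t -> cont_R (fun u => f u * g u)%C t.
Proof.
  intros Hf Hg eps Heps.
  assert (Ha := Cmod_ge_0 (f t)). assert (Hb := Cmod_ge_0 (g t)).
  set (e := Rmin 1 (eps / (Cmod (f t) + Cmod (g t) + 2))).
  assert (He' : 0 < eps / (Cmod (f t) + Cmod (g t) + 2)) by (apply Rdiv_lt_0_compat; lra).
  assert (He : 0 < e) by (apply Rmin_pos; lra).
  destruct (Hf e He) as [d1 [Hd1 H1]]. destruct (Hg e He) as [d2 [Hd2 H2]].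
  exists (Rmin d1 d2). split; [apply Rmin_pos; lra|]. intros y Hy.
  specialize (H1 y (Rlt_min_l _ _ _ Hy)).
  specialize (H2 y (Rlt_min_r _ _ _ Hy)).
  replace (f y * g y - f t * g t)%C
    with ((f y - f t) * (g y - g t) + (f t * (g y - g t) + (f y - f t) * g t))%C by ring.
  eapply Rle_lt_trans; [apply Cmod_triangle|].
  eapply Rle_lt_trans; [apply Rplus_le_compat_l, Cmod_triangle|].
  rewrite !Cmod_mult.
  assert (He1 : e <= 1) by apply Rmin_l.
  assert (He2 : (Cmod (f t) + Cmod (g t) + 2) * e <= eps).
  { apply Rle_trans with ((Cmod (f t) + Cmod (g t) + 2) * (eps / (Cmod (f t) + Cmod (g t) + 2))).
    - apply Rmult_le_compat_l; [lra|apply Rmin_r].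
    - apply Req_le. field. lra. }
  assert (P1 := Cmod_ge_0 (f y - f t)). assert (P2 := Cmod_ge_0 (g y - g t)).
  nra.
Qed.

Lemma cont_R_comp (f : C -> C) (g : R -> C) (t : R) :
  cont_C f (g t) -> cont_R g t -> cont_R (fun u => f (g u)) t.
Proof.
  intros Hf Hg eps Heps. destruct (Hf eps Heps) as [d [Hd H]].
  destruct (Hg d Hd) as [d' [Hd' H']]. exists d'. split; [exact Hd'|].
  intros y Hy. apply H, H', Hy.
Qed.

Lemma cont_R_const (c : C) (t : R) : cont_R (fun _ => c) t.
Proof.
  intros eps Heps. exists 1. split; [lra|]. intros y _.
  replace (c - c)%C with (RtoC 0) by ring. rewrite Cmod_0. exact Heps.
Qed.

(** * Bisection of the unit square and compactness of discs *)

Lemma nested_intervals (x s : nat -> R) :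
  (forall n, x n <= x (S n)) -> (forall n, x (S n) + s (S n) <= x n + s n) ->
  (forall n, 0 <= s n) -> exists a, forall n, x n <= a <= x n + s n.
Proof.
  intros H1 H2 Hs.
  assert (Hinc : forall n k, x n <= x (n + k)%nat).
  { intros n k. induction k; [rewrite Nat.add_0_r; lra|].
    rewrite Nat.add_succ_r. eapply Rle_trans; [exact IHk|apply H1]. }
  assert (Hdec : forall n k, x (n + k)%nat + s (n + k)%nat <= x n + s n).
  { intros n k. induction k; [rewrite Nat.add_0_r; lra|].
    rewrite Nat.add_succ_r. eapply Rle_trans; [apply H2|exact IHk]. }
  assert (Hub : forall n m, x m <= x n + s n).
  { intros n m. destruct (Nat.le_ge_cases n m) as [H|H].
    - replace m with (n + (m - n))%nat by lia. specialize (Hdec n (m - n)%nat).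
      specialize (Hs (n + (m - n))%nat). lra.
    - specialize (Hinc m (n - m)%nat). replace (m + (n - m))%nat with n in Hinc by lia.
      specialize (Hs n). lra. }
  destruct (completeness (fun r => exists n, r = x n)) as [a [Ha1 Ha2]].
  - exists (x 0%nat + s 0%nat). intros r [n ->]. apply Hub.
  - exists (x 0%nat), 0%nat. reflexivity.
  - exists a. intros n. split.
    + apply Ha1. exists n. reflexivity.
    + apply Ha2. intros r [m ->]. apply Hub.
Qed.

(** If [P] failed on the unit square, it would fail on some quarter at each stage, and the nested
    squares would shrink to a point near which [P] holds. Both the compactness of discs and
    Goursat's theorem are instances. *)
Lemma square_bisection (P : R -> R -> R -> Prop) :
  (forall x y s, 0 < s -> 0 <= x -> x + s <= 1 -> 0 <= y -> y + s <= 1 ->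
     P x y (s / 2) -> P (x + s / 2) y (s / 2) ->
     P x (y + s / 2) (s / 2) -> P (x + s / 2) (y + s / 2) (s / 2) -> P x y s) ->
  (forall a b, 0 <= a <= 1 -> 0 <= b <= 1 -> exists d, 0 < d /\
     forall x y s, 0 < s < d -> x <= a <= x + s -> y <= b <= y + s ->
       0 <= x -> x + s <= 1 -> 0 <= y -> y + s <= 1 -> P x y s) ->
  P 0 0 1.
Proof.
  intros Hsub Hloc. apply NNPP. intros Hn.
  pose (good := fun (p p' : R * R * R) =>
    snd p' = snd p / 2 /\
    (fst (fst p') = fst (fst p) \/ fst (fst p') = fst (fst p) + snd p / 2) /\
    (snd (fst p') = snd (fst p) \/ snd (fst p') = snd (fst p) + snd p / 2)).
  pose (inv := fun p : R * R * R => 0 < snd p /\ 0 <= fst (fst p) /\ fst (fst p) + snd p <= 1 /\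
     0 <= snd (fst p) /\ snd (fst p) + snd p <= 1 /\ ~ P (fst (fst p)) (snd (fst p)) (snd p)).
  (* The premise [inv p] stands under the existential, so that the choice function [next] is
     total. *)
  assert (Hex : forall p, exists p', inv p -> good p p' /\ inv p').
  { intros [[x y] s]. destruct (classic (inv (x, y, s))) as [H|H];
      [|exists (x, y, s); tauto].
    destruct H as (H1 & H2 & H3 & H4 & H5 & H6). simpl in *.
    apply NNPP. intros Hno.
    assert (Hq : forall x' y', x' = x \/ x' = x + s / 2 -> y' = y \/ y' = y + s / 2 -> P x' y' (s / 2)).
    { intros x' y' Hx' Hy'. apply NNPP. intros HP. apply Hno. exists (x', y', s / 2). intros _.
      unfold good, inv; simpl. repeat split; auto; destruct Hx', Hy'; lra. }
    apply H6, Hsub; auto. }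
  destruct (fun_choice _ Hex) as [next Hnext].
  pose (sq := fun n => Nat.iter n next (0, 0, 1)).
  assert (Hinv : forall n, inv (sq n)).
  { induction n.
    - unfold inv; simpl. repeat split; try lra. exact Hn.
    - apply (Hnext (sq n) IHn). }
  assert (Hgood : forall n, good (sq n) (sq (S n))).
  { intros n. apply (Hnext (sq n) (Hinv n)). }
  assert (Hs : forall n, snd (sq n) = (/ 2) ^ n).
  { induction n; [reflexivity|]. destruct (Hgood n) as [H _]. rewrite H, IHn. simpl. field. }
  destruct (nested_intervals (fun n => fst (fst (sq n))) (fun n => snd (sq n))) as [a Ha].
  { intros n. destruct (Hgood n) as (H & [H1|H1] & _); rewrite H1; destruct (Hinv n); lra. }
  { intros n. destruct (Hgood n) as (H & [H1|H1] & _); rewrite H1, H; destruct (Hinv n); lra. }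
  { intros n. destruct (Hinv n); lra. }
  destruct (nested_intervals (fun n => snd (fst (sq n))) (fun n => snd (sq n))) as [b Hb].
  { intros n. destruct (Hgood n) as (H & _ & [H1|H1]); rewrite H1; destruct (Hinv n); lra. }
  { intros n. destruct (Hgood n) as (H & _ & [H1|H1]); rewrite H1, H; destruct (Hinv n); lra. }
  { intros n. destruct (Hinv n); lra. }
  destruct (Hloc a b) as [d [Hd H]].
  { generalize (Ha 0%nat). simpl. lra. }
  { generalize (Hb 0%nat). simpl. lra. }
  destruct (pow_lt_1_zero (/ 2)) with (y := d) as [n Hn1].
  { rewrite Rabs_right; lra. }
  { exact Hd. }
  specialize (Hn1 n (Nat.le_refl n)). rewrite <- Hs in Hn1.
  destruct (Hinv n) as (K1 & K2 & K3 & K4 & K5 & K6).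
  apply K6. apply H; auto.
  split; [exact K1|]. eapply Rle_lt_trans; [apply Rle_abs|exact Hn1].
Qed.

(** Heine-Borel as an induction over sets, the form that bisection proves: the unit square is mapped
    onto a square around the disc. The union rule with [S = T] also gives passage to subsets.
    Boundedness of continuous functions and existence of cluster points both follow. *)
Lemma disc_compact (B : R) (Q : (C -> Prop) -> Prop) : 0 < B ->
  (forall S T U : C -> Prop, Q S -> Q T -> (forall w, U w -> S w \/ T w) -> Q U) ->
  (forall c, exists d, 0 < d /\ Q (fun w => Cmod (w - c) < d)) ->
  Q (fun w => Cmod w <= B).
Proof.
  intros HB Hun Hloc.
  pose (g := fun x y : R => (B * (2 * x - 1), B * (2 * y - 1)) : C).
  pose (sq := fun x y s w => exists u v, x <= u <= x + s /\ y <= v <= y + s /\ w = g u v).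
  assert (H : Q (sq 0 0 1)).
  { apply (square_bisection (fun x y s => Q (sq x y s))).
    - intros x y s _ _ _ _ _ H1 H2 H3 H4.
      apply (Hun _ _ _ (Hun _ _ _ H1 H2 (fun w H => H)) (Hun _ _ _ H3 H4 (fun w H => H))).
      intros w (u & v & Hu & Hv & ->).
      destruct (Rle_dec v (y + s / 2)); [left|right];
        (destruct (Rle_dec u (x + s / 2)); [left|right]); exists u, v; repeat split; lra.
    - intros a b _ _. destruct (Hloc (g a b)) as [d [Hd HQ]].
      (* The map [g] stretches each coordinate by [2 * B], so a square of side [s] lands within
         [4 * B * s] of the image of any of its points. *)
      exists (d / (4 * B)). split; [apply Rdiv_lt_0_compat; lra|].
      intros x y s Hs Ha Hb _ _ _ _. apply (Hun _ _ _ HQ HQ). intros w (u & v & Hu & Hv & ->). left.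
      replace (g u v - g a b)%C with (RtoC (B * (2 * (u - a))) + RtoC (B * (2 * (v - b))) * Ci)%C
        by (apply injective_projections; simpl; ring).
      eapply Rle_lt_trans; [apply Cmod_triangle|]. rewrite Cmod_mult, Cmod_Ci, !Cmod_R.
      assert (H2 : Rabs (B * (2 * (u - a))) <= B * (2 * s)) by (apply Rabs_le; nra).
      assert (H3 : Rabs (B * (2 * (v - b))) <= B * (2 * s)) by (apply Rabs_le; nra).
      assert (H4 : 4 * B * s < 4 * B * (d / (4 * B))) by (apply Rmult_lt_compat_l; lra).
      replace (4 * B * (d / (4 * B))) with d in H4 by (field; lra). lra. }
  apply (Hun _ _ _ H H). intros [x y] Hw. left.
  assert (Hxy := Rmax_Cmod (x, y)). simpl in Hxy.
  assert (Hx : Rabs x <= B) by (generalize (Rmax_l (Rabs x) (Rabs y)); lra).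
  assert (Hy : Rabs y <= B) by (generalize (Rmax_r (Rabs x) (Rabs y)); lra).
  apply Rabs_le_between in Hx. apply Rabs_le_between in Hy.
  assert (Hb : forall t, - B <= t <= B -> 0 <= (t / B + 1) / 2 <= 0 + 1).
  { intros t Ht. assert (Hi : t = B * (t / B)) by (field; lra).
    assert (-1 <= t / B <= 1); [|lra]. split; apply Rmult_le_reg_l with B; lra. }
  exists ((x / B + 1) / 2), ((y / B + 1) / 2). repeat split; try apply Hb; auto.
  apply injective_projections; simpl; field; lra.
Qed.

(** * Goursat's theorem for a parametrized square *)

Section Goursat.

(** A curved region is the image of the unit square under [gam], with partial derivatives [g1] and
    [g2]. Bisection takes place in the parameters, and [L] converts lengths there into lengths in
    the plane. *)
Variables (gam g1 g2 : R -> R -> C) (L : R).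
Hypothesis Hg1 : forall x y, rd (fun u => gam u y) x (g1 x y).
Hypothesis Hg2 : forall x y, rd (fun v => gam x v) y (g2 x y).
Hypothesis Hc1 : forall x y, cont_R (fun u => g1 u y) x.
Hypothesis Hc2 : forall x y, cont_R (fun v => g2 x v) y.
Hypothesis HL : 0 <= L.
Hypothesis HL1 : forall x y, 0 <= x <= 1 -> 0 <= y <= 1 -> Cmod (g1 x y) <= L.
Hypothesis HL2 : forall x y, 0 <= x <= 1 -> 0 <= y <= 1 -> Cmod (g2 x y) <= L.
Hypothesis Hlip : forall x y x' y', 0 <= x <= 1 -> 0 <= y <= 1 -> 0 <= x' <= 1 -> 0 <= y' <= 1 ->
  Cmod (gam x y - gam x' y') <= L * (Rabs (x - x') + Rabs (y - y')).

Definition hside (p : C -> C) (y a b : R) : C := CI (fun u => p (gam u y) * g1 u y)%C a b.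
Definition vside (p : C -> C) (x a b : R) : C := CI (fun v => p (gam x v) * g2 x v)%C a b.

(* The integral of the pulled-back form [p(gamma) d gamma] along the boundary of a square. *)
Definition Qsq (p : C -> C) (x y s : R) : C :=
  (hside p y x (x + s) + vside p (x + s) y (y + s)
   - hside p (y + s) x (x + s) - vside p x y (y + s))%C.

Definition good_on (p : C -> C) : Prop :=
  forall x y, 0 <= x <= 1 -> 0 <= y <= 1 -> cont_C p (gam x y).

Lemma h_ex (p : C -> C) (y a b : R) : good_on p -> 0 <= a -> a <= b -> b <= 1 -> 0 <= y <= 1 ->
  ex_CI (fun u => p (gam u y) * g1 u y)%C a b.
Proof.
  intros Hp Ha Hab Hb Hy. apply cont_R_ex_RInt_in; [exact Hab|].
  intros t Ht. apply (cont_R_mult (fun u => p (gam u y)) (fun u => g1 u y)); [|apply Hc1].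
  apply (cont_R_comp p (fun u => gam u y)); [apply Hp; lra|]. eapply rd_cont. apply Hg1.
Qed.

Lemma v_ex (p : C -> C) (x a b : R) : good_on p -> 0 <= a -> a <= b -> b <= 1 -> 0 <= x <= 1 ->
  ex_CI (fun v => p (gam x v) * g2 x v)%C a b.
Proof.
  intros Hp Ha Hab Hb Hy. apply cont_R_ex_RInt_in; [exact Hab|].
  intros t Ht. apply (cont_R_mult (fun u => p (gam x u)) (fun u => g2 x u)); [|apply Hc2].
  apply (cont_R_comp p (fun u => gam x u)); [apply Hp; lra|]. eapply rd_cont. apply Hg2.
Qed.

(** The inner sides are traversed once in each direction and cancel. *)
Lemma Qsq_sub (p : C -> C) (x y s : R) : good_on p ->
  0 < s -> 0 <= x -> x + s <= 1 -> 0 <= y -> y + s <= 1 ->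
  Qsq p x y s = (Qsq p x y (s / 2) + Qsq p (x + s / 2) y (s / 2)
    + Qsq p x (y + s / 2) (s / 2) + Qsq p (x + s / 2) (y + s / 2) (s / 2))%C.
Proof.
  intros Hp Hs Hx Hxs Hy Hys. unfold Qsq.
  replace (x + s / 2 + s / 2) with (x + s) by field.
  replace (y + s / 2 + s / 2) with (y + s) by field.
  assert (Hh : forall y', 0 <= y' <= 1 ->
    hside p y' x (x + s) = (hside p y' x (x + s / 2) + hside p y' (x + s / 2) (x + s))%C).
  { intros y' Hy'. symmetry. apply CI_chasles; apply h_ex; auto; lra. }
  assert (Hv : forall x', 0 <= x' <= 1 ->
    vside p x' y (y + s) = (vside p x' y (y + s / 2) + vside p x' (y + s / 2) (y + s))%C).
  { intros x' Hx'. symmetry. apply CI_chasles; apply v_ex; auto; lra. }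
  rewrite !Hh, !Hv by lra. ring.
Qed.

(** Each side contributes the difference of [P] at the images of its ends, and the four differences
    cancel. *)
Lemma Qsq_primitive (P p : C -> C) (x y s : R) : good_on p ->
  (forall z, cd P z (p z)) -> 0 <= s -> 0 <= x -> x + s <= 1 -> 0 <= y -> y + s <= 1 ->
  Qsq p x y s = 0%C.
Proof.
  intros Hp HP Hs Hx Hxs Hy Hys.
  assert (Hh : forall y', 0 <= y' <= 1 -> hside p y' x (x + s) = (P (gam (x + s)%R y') - P (gam x y'))%C).
  { intros y' Hy'. apply (CI_ftc (fun u => P (gam u y'))); [lra| |].
    - intros t _. apply (cd_comp_rd P (fun u => gam u y')); auto.
    - intros t Ht. apply (cont_R_mult (fun u => p (gam u y')) (fun u => g1 u y')); [|apply Hc1].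
      apply (cont_R_comp p (fun u => gam u y')); [apply Hp; lra|]. eapply rd_cont. apply Hg1. }
  assert (Hv : forall x', 0 <= x' <= 1 -> vside p x' y (y + s) = (P (gam x' (y + s)%R) - P (gam x' y))%C).
  { intros x' Hx'. apply (CI_ftc (fun u => P (gam x' u))); [lra| |].
    - intros t _. apply (cd_comp_rd P (fun u => gam x' u)); auto.
    - intros t Ht. apply (cont_R_mult (fun u => p (gam x' u)) (fun u => g2 x' u)); [|apply Hc2].
      apply (cont_R_comp p (fun u => gam x' u)); [apply Hp; lra|]. eapply rd_cont. apply Hg2. }
  unfold Qsq. rewrite !Hh, !Hv by lra. ring.
Qed.

Lemma Qsq_minus (p q : C -> C) (x y s : R) : good_on p -> good_on q ->
  0 <= s -> 0 <= x -> x + s <= 1 -> 0 <= y -> y + s <= 1 ->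
  Qsq (fun z => p z - q z)%C x y s = (Qsq p x y s - Qsq q x y s)%C.
Proof.
  intros Hp Hq Hs Hx Hxs Hy Hys.
  assert (Hh : forall y', 0 <= y' <= 1 ->
    hside (fun z => p z - q z)%C y' x (x + s) = (hside p y' x (x + s) - hside q y' x (x + s))%C).
  { intros y' Hy'. unfold hside. rewrite <- CI_minus by (apply h_ex; auto; lra).
    apply CI_ext; [lra|]. intros; ring. }
  assert (Hv : forall x', 0 <= x' <= 1 ->
    vside (fun z => p z - q z)%C x' y (y + s) = (vside p x' y (y + s) - vside q x' y (y + s))%C).
  { intros x' Hx'. unfold vside. rewrite <- CI_minus by (apply v_ex; auto; lra).
    apply CI_ext; [lra|]. intros; ring. }
  unfold Qsq. rewrite !Hh, !Hv by lra. ring.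
Qed.

Lemma Qsq_bound (p : C -> C) (x y s M : R) : good_on p ->
  0 <= s -> 0 <= x -> x + s <= 1 -> 0 <= y -> y + s <= 1 -> 0 <= M ->
  (forall u v, x <= u <= x + s -> y <= v <= y + s -> Cmod (p (gam u v)) <= M) ->
  Cmod (Qsq p x y s) <= 4 * (s * (M * L)).
Proof.
  intros Hp Hs Hx Hxs Hy Hys HM0 HM.
  assert (Hh : forall y', y <= y' <= y + s -> Cmod (hside p y' x (x + s)) <= s * (M * L)).
  { intros y' Hy'. replace (s * (M * L)) with ((x + s - x) * (M * L)) by ring.
    apply CI_bound; [lra|apply h_ex; auto; lra|].
    intros t Ht. rewrite Cmod_mult. apply Rmult_le_compat; try apply Cmod_ge_0.
    - apply HM; auto.
    - apply HL1; lra. }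
  assert (Hv : forall x', x <= x' <= x + s -> Cmod (vside p x' y (y + s)) <= s * (M * L)).
  { intros x' Hx'. replace (s * (M * L)) with ((y + s - y) * (M * L)) by ring.
    apply CI_bound; [lra|apply v_ex; auto; lra|].
    intros t Ht. rewrite Cmod_mult. apply Rmult_le_compat; try apply Cmod_ge_0.
    - apply HM; auto.
    - apply HL2; lra. }
  unfold Qsq.
  eapply Rle_trans; [apply Cmod_triangle_minus|].
  eapply Rle_trans; [apply Rplus_le_compat_r, Cmod_triangle_minus|].
  eapply Rle_trans; [apply Rplus_le_compat_r, Rplus_le_compat_r, Cmod_triangle|].
  generalize (Hh y ltac:(lra)) (Hh (y + s) ltac:(lra)) (Hv x ltac:(lra)) (Hv (x + s) ltac:(lra)). lra.
Qed.

(** The bound [eps * s^2] is additive over quarters. On a small square [q] differs by [o(s)] from an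
    affine function, which has a primitive and so contributes nothing; the perimeter supplies the
    second factor [s]. *)
Theorem goursat (q : C -> C) :
  (forall x y, 0 <= x <= 1 -> 0 <= y <= 1 -> exists l, cd q (gam x y) l) ->
  Qsq q 0 0 1 = 0%C.
Proof.
  intros Hq.
  assert (Hgood : good_on q) by (intros x y Hx Hy; destruct (Hq x y Hx Hy); eapply cd_cont; eassumption).
  apply Cmod_small_0. intros eps Heps.
  replace eps with (eps * (1 * 1)) by ring.
  apply (square_bisection (fun x y s => Cmod (Qsq q x y s) <= eps * (s * s))).
  - intros x y s Hs Hx Hxs Hy Hys A1 A2 A3 A4. rewrite Qsq_sub by auto.
    eapply Rle_trans; [apply Cmod_triangle|].
    eapply Rle_trans; [apply Rplus_le_compat_r, Cmod_triangle|].
    eapply Rle_trans; [apply Rplus_le_compat_r, Rplus_le_compat_r, Cmod_triangle|]. lra.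
  - intros a b Ha Hb.
    set (z0 := gam a b).
    (* Perimeter [4 * s], speed at most [L] and distance at most [2 * L * s] from [z0] give
       [8 * e * L^2 * s^2] in total; the [+ 1] allows [L = 0]. *)
    set (e := eps / (8 * (L * L + 1))).
    assert (He : 0 < e) by (apply Rdiv_lt_0_compat; nra).
    destruct (Hq a b Ha Hb) as [l Hql]. destruct (Hql e He) as [d [Hd H]]. fold z0 in H.
    assert (Hd' : 0 < d / (2 * (L + 1))) by (apply Rdiv_lt_0_compat; lra).
    exists (d / (2 * (L + 1))). split; [exact Hd'|].
    intros x y s Hs Hxa Hyb Hx Hxs Hy Hys.
    set (p := fun z => (q z0 + l * (z - z0))%C).
    set (P := fun z => (q z0 * z + l * (/ 2 * (z * z) - z0 * z))%C).
    assert (H2 : RtoC 2 <> RtoC 0) by (intros E; apply RtoC_inj in E; lra).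
    assert (HPp : forall z, cd P z (p z)).
    { intros z. unfold p. replace (q z0 + l * (z - z0))%C
        with (q z0 * 1 + l * (/ 2 * (2 * z) - z0 * 1))%C by (field; exact H2).
      apply cd_plus; [apply cd_scal, cd_id|]. apply cd_scal. apply cd_minus.
      - apply cd_scal, cd_sqr.
      - apply cd_scal, cd_id. }
    assert (Hpc : forall z, cont_C p z).
    { intros z. apply (cd_cont p z (0 + l * (1 - 0))%C).
      apply cd_plus; [apply cd_const|]. apply cd_scal.
      apply cd_minus; [apply cd_id|apply cd_const]. }
    assert (Hpg : good_on p) by (intros u v _ _; apply Hpc).
    assert (Hrg : good_on (fun z => q z - p z)%C).
    { intros u v Hu Hv eps' Heps'.
      destruct (Hgood u v Hu Hv (eps' / 2)) as [d1 [Hd1 K1]]; [lra|].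
      destruct (Hpg u v Hu Hv (eps' / 2)) as [d2 [Hd2 K2]]; [lra|].
      exists (Rmin d1 d2). split; [apply Rmin_pos; lra|]. intros w Hw.
      specialize (K1 w (Rlt_min_l _ _ _ Hw)).
      specialize (K2 w (Rlt_min_r _ _ _ Hw)).
      replace (q w - p w - (q (gam u v) - p (gam u v)))%C
        with ((q w - q (gam u v)) - (p w - p (gam u v)))%C by ring.
      eapply Rle_lt_trans; [apply Cmod_triangle_minus|]. lra. }
    assert (HQ : Qsq q x y s = Qsq (fun z => q z - p z)%C x y s).
    { rewrite Qsq_minus by (auto; lra).
      rewrite (Qsq_primitive P p) by (auto; lra). ring. }
    rewrite HQ.
    eapply Rle_trans; [apply (Qsq_bound _ _ _ _ (e * (L * (2 * s)))); auto; try lra; try nra|].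
    + apply Rmult_le_pos; [lra|]. apply Rmult_le_pos; lra.
    + intros u v Hu Hv.
      assert (Hl : Cmod (gam u v - z0) <= L * (2 * s)).
      { eapply Rle_trans; [apply Hlip; lra|]. apply Rmult_le_compat_l; [lra|].
        assert (Rabs (u - a) <= s) by (apply Rabs_le; lra).
        assert (Rabs (v - b) <= s) by (apply Rabs_le; lra). lra. }
      assert (Hl' : Cmod (gam u v - z0) < d).
      { eapply Rle_lt_trans; [exact Hl|].
        apply Rle_lt_trans with ((L + 1) * (2 * s)); [apply Rmult_le_compat_r; lra|].
        apply Rlt_le_trans with ((L + 1) * (2 * (d / (2 * (L + 1))))).
        - apply Rmult_lt_compat_l; lra.
        - apply Req_le. field. lra. }
      specialize (H _ Hl'). replace (z0 + (gam u v - z0))%C with (gam u v) in H by ring.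
      replace (q (gam u v) - p (gam u v))%C
        with (q (gam u v) - q z0 - l * (gam u v - z0))%C by (unfold p; ring).
      eapply Rle_trans; [exact H|]. apply Rmult_le_compat_l; lra.
    + replace (4 * (s * (e * (L * (2 * s)) * L))) with ((8 * e * (L * L)) * (s * s)) by ring.
      apply Rmult_le_compat_r; [nra|].
      apply Rle_trans with (8 * e * (L * L + 1)); [apply Rmult_le_compat_l; lra|].
      apply Req_le. unfold e. field. nra.
Qed.

End Goursat.

(** * Circles *)


Lemma rd_pair (u v : R -> R) (t a b : R) :
  derivable_pt_lim u t a -> derivable_pt_lim v t b ->
  rd (fun x => (u x, v x) : C) t (a, b).
Proof.
  intros Hu Hv eps Heps.
  destruct (Hu (eps / 2)) as [d1 H1]; [lra|]. destruct (Hv (eps / 2)) as [d2 H2]; [lra|].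
  exists (Rmin d1 d2). split; [apply Rmin_pos; apply cond_pos|]. intros h Hh.
  destruct (Req_dec h 0) as [->|Hh0].
  { rewrite Rplus_0_r.
    replace ((u t, v t) - (u t, v t) - (a, b) * 0)%C with (RtoC 0) by ring.
    rewrite Cmod_0, Rabs_R0. lra. }
  specialize (H1 h Hh0 (Rlt_min_l _ _ _ Hh)).
  specialize (H2 h Hh0 (Rlt_min_r _ _ _ Hh)).
  assert (Hp : 0 < Rabs h) by (apply Rabs_pos_lt; exact Hh0).
  replace ((u (t + h)%R, v (t + h)%R) - (u t, v t) - (a, b) * h)%C
    with ((RtoC (((u (t + h) - u t) / h - a))%R + Ci * RtoC ((v (t + h) - v t) / h - b)%R) * RtoC h)%C.
  2: { apply injective_projections; simpl; field; exact Hh0. }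
  rewrite Cmod_mult, Cmod_R. apply Rmult_le_compat_r; [lra|].
  eapply Rle_trans; [apply Cmod_triangle|]. rewrite Cmod_mult, !Cmod_R, Cmod_Ci. lra.
Qed.

Lemma rd_scal (f : R -> C) (c : C) (t : R) (a : C) : rd f t a -> rd (fun x => c * f x)%C t (c * a)%C.
Proof.
  intros H. apply (cd_comp_rd (fun z => c * z)%C f).
  - generalize (cd_scal _ c _ _ (cd_id (f t))). rewrite Cmult_1_r. auto.
  - exact H.
Qed.

Lemma rd_shift (f : R -> C) (c : C) (t : R) (a : C) : rd f t a -> rd (fun x => c + f x)%C t a.
Proof.
  intros H. replace a with ((0 + 1) * a)%C by ring. apply (cd_comp_rd (fun z => c + z)%C f).
  - apply cd_plus; [apply cd_const|apply cd_id].
  - exact H.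
Qed.

Lemma rd_affine (a b c : C) (t : R) : rd (fun x => a + (b + x * c))%C t c.
Proof.
  intros eps Heps. exists 1. split; [lra|]. intros h _.
  rewrite RtoC_plus.
  replace (a + (b + (t + h) * c) - (a + (b + t * c)) - c * h)%C with (RtoC 0) by ring.
  rewrite Cmod_0. apply Rmult_le_pos; [lra|apply Rabs_pos].
Qed.

(** This is [exp(2 pi i y)], scaled so that one turn is the side [[0, 1]] of the parameter square;
    [dpi] is [2 pi i]. *)
Definition ee (y : R) : C := (cos (2 * PI * y), sin (2 * PI * y)).

Definition dpi : C := (0, 2 * PI).

Lemma ee_rd (y : R) : rd ee y (dpi * ee y)%C.
Proof.
  replace (dpi * ee y)%C
    with ((- sin (2 * PI * y)) * (2 * PI), cos (2 * PI * y) * (2 * PI)) .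
  2: { apply injective_projections; simpl; ring. }
  assert (Hl : derivable_pt_lim (fun x => 2 * PI * x) y (2 * PI)).
  { apply is_derive_Reals. auto_derive; auto. ring. }
  apply rd_pair.
  - exact (derivable_pt_lim_comp (fun x => 2 * PI * x) cos y _ _ Hl (derivable_pt_lim_cos _)).
  - exact (derivable_pt_lim_comp (fun x => 2 * PI * x) sin y _ _ Hl (derivable_pt_lim_sin _)).
Qed.

Lemma ee_mod (y : R) : Cmod (ee y) = 1.
Proof.
  unfold Cmod, ee; simpl. rewrite !Rmult_1_r.
  generalize (sin2_cos2 (2 * PI * y)). unfold Rsqr. intros H.
  replace (cos (2 * PI * y) * cos (2 * PI * y) + sin (2 * PI * y) * sin (2 * PI * y)) with 1 by lra.
  apply sqrt_1.
Qed.

Lemma ee_neq_0 (y : R) : ee y <> 0%C.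
Proof. apply Cmod_gt_0. rewrite ee_mod. lra. Qed.

Lemma ee_period : ee 1 = ee 0.
Proof.
  unfold ee. rewrite Rmult_1_r, Rmult_0_r, cos_2PI, sin_2PI, cos_0, sin_0. reflexivity.
Qed.

Lemma ee_cont (y : R) : cont_R ee y.
Proof. eapply rd_cont, ee_rd. Qed.

Lemma dpi_mod : Cmod dpi = 2 * PI.
Proof.
  replace dpi with (RtoC (2 * PI) * Ci)%C by (apply injective_projections; simpl; ring).
  rewrite Cmod_mult, Cmod_Ci, Cmod_R, Rmult_1_r. apply Rabs_right.
  generalize PI_RGT_0. lra.
Qed.

Lemma dpi_neq_0 : dpi <> 0%C.
Proof. apply Cmod_gt_0. rewrite dpi_mod. generalize PI_RGT_0. lra. Qed.

Lemma ee_lip (y y' : R) : Cmod (ee y - ee y') <= 2 * PI * Rabs (y - y').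
Proof.
  assert (H : forall a b, a <= b -> Cmod (ee b - ee a) <= 2 * PI * Rabs (b - a)).
  { intros a b Hab.
    assert (Hc : forall t, cont_R (fun y => dpi * ee y)%C t).
    { intros t. apply (cont_R_mult (fun _ => dpi) ee); [apply cont_R_const|apply ee_cont]. }
    rewrite <- (CI_ftc ee (fun y => dpi * ee y)%C a b Hab (fun t _ => ee_rd t) (fun t _ => Hc t)).
    rewrite Rabs_right by lra. rewrite (Rmult_comm (2 * PI)).
    apply CI_bound; [exact Hab|apply cont_R_ex_RInt, Hc|].
    intros t _. rewrite Cmod_mult, dpi_mod, ee_mod. lra. }
  destruct (Rle_dec y y') as [Hl|Hl].
  - rewrite Cmod_minus_sym, Rabs_minus_sym. apply H, Hl.
  - apply H. lra.
Qed.

(* [(1 / (2 pi i))] times the integral of [p] over the circle of centre [c] and radius [r]. *)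
Definition circ (p : C -> C) (c : C) (r : R) : C :=
  CI (fun y => p (c + r * ee y) * (r * ee y))%C 0 1.

Lemma circ_cont (p : C -> C) (c : C) (r : R) (y : R) :
  cont_C p (c + r * ee y)%C -> cont_R (fun y => p (c + r * ee y) * (r * ee y))%C y.
Proof.
  intros Hp.
  assert (H1 : cont_R (fun y => c + r * ee y)%C y).
  { eapply rd_cont. apply rd_shift. apply (rd_scal ee (RtoC r)), ee_rd. }
  apply (cont_R_mult (fun y => p (c + r * ee y)%C) (fun y => r * ee y)%C).
  - apply (cont_R_comp p (fun y => c + r * ee y)%C); auto.
  - eapply rd_cont. apply (rd_scal ee (RtoC r)), ee_rd.
Qed.

Lemma circ_ex (p : C -> C) (c : C) (r : R) :
  (forall y, cont_C p (c + r * ee y)%C) ->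
  ex_CI (fun y => p (c + r * ee y) * (r * ee y))%C 0 1.
Proof. intros Hp. apply cont_R_ex_RInt. intros t. apply circ_cont, Hp. Qed.

Lemma circ_bound (p : C -> C) (c : C) (r M : R) : 0 <= r ->
  (forall y, cont_C p (c + r * ee y)%C) -> (forall y, Cmod (p (c + r * ee y)%C) <= M) ->
  Cmod (circ p c r) <= M * r.
Proof.
  intros Hr Hp HM. replace (M * r) with ((1 - 0) * (M * r)) by ring.
  apply CI_bound; [lra|apply circ_ex, Hp|]. intros t _.
  rewrite !Cmod_mult, ee_mod, Cmod_R, Rabs_right, Rmult_1_r by lra.
  apply Rmult_le_compat_r; auto.
Qed.

Lemma circ_ext (p q : C -> C) (c : C) (r : R) :
  (forall y, p (c + r * ee y)%C = q (c + r * ee y)%C) -> circ p c r = circ q c r.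
Proof. intros H. apply CI_ext; [lra|]. intros t _. rewrite H. reflexivity. Qed.

Lemma circ_plus (p q : C -> C) (c : C) (r : R) :
  (forall y, cont_C p (c + r * ee y)%C) -> (forall y, cont_C q (c + r * ee y)%C) ->
  circ (fun w => p w + q w)%C c r = (circ p c r + circ q c r)%C.
Proof.
  intros Hp Hq. unfold circ. rewrite <- CI_plus by (apply circ_ex; auto).
  apply CI_ext; [lra|]. intros; ring.
Qed.

Lemma circ_scal (p : C -> C) (a c : C) (r : R) :
  (forall y, cont_C p (c + r * ee y)%C) ->
  circ (fun w => a * p w)%C c r = (a * circ p c r)%C.
Proof.
  intros Hp. unfold circ. rewrite <- CI_scal by (apply circ_ex; auto).
  apply CI_ext; [lra|]. intros; ring.
Qed.

(** The point is the image of [r * ee y] under the contraction with fixed point [z] and ratio [eps].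
    Hence it stays in the disc by convexity, never meets [z], and tends to [z] with [eps]. *)
Lemma shrunk_circle_point (z : C) (r eps y : R) : Cmod z < r -> 0 < eps <= 1 ->
  Cmod ((1 - eps)%R * z + (eps * r)%R * ee y) <= r /\
  ((1 - eps)%R * z + (eps * r)%R * ee y)%C <> z /\
  Cmod ((1 - eps)%R * z + (eps * r)%R * ee y - z) <= eps * (2 * r).
Proof.
  intros Hz Heps. assert (Hz0 := Cmod_ge_0 z).
  assert (E : ((1 - eps)%R * z + (eps * r)%R * ee y - z = eps * (r * ee y - z))%C)
    by (rewrite RtoC_minus, RtoC_mult; ring).
  assert (Hw : Cmod (r * ee y)%C = r) by (rewrite Cmod_mult, ee_mod, Cmod_R, Rabs_right; lra).
  repeat split.
  - eapply Rle_trans; [apply Cmod_triangle|].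
    rewrite !Cmod_mult, !Cmod_R, ee_mod, !Rabs_right by nra. nra.
  - intros E0. rewrite E0 in E.
    apply (f_equal Cmod) in E. replace (z - z)%C with (RtoC 0) in E by ring.
    rewrite Cmod_mult, Cmod_0, Cmod_R, Rabs_right in E by lra.
    generalize (Cmod_triangle_rev (r * ee y)%C z). rewrite Hw. nra.
  - rewrite E, Cmod_mult, Cmod_R, Rabs_right by lra.
    generalize (Cmod_triangle_minus (r * ee y)%C z). rewrite Hw. nra.
Qed.

(** The contractions towards [z] with ratios from [eps] to 1 sweep out the region between the two
    circles without meeting [z]. Goursat's theorem applies to this sweep; the sides [y = 0] and
    [y = 1] coincide by periodicity and cancel, which leaves the two circles. *)
Lemma circ_shrink (q : C -> C) (z : C) (r eps : R) :
  Cmod z < r -> 0 < eps <= 1 ->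
  (forall w, Cmod w <= r -> w <> z -> exists l, cd q w l) ->
  circ q 0%C r = circ q (RtoC (1 - eps) * z)%C (eps * r).
Proof.
  intros Hz Heps Hq.
  assert (Hz0 := Cmod_ge_0 z). assert (Hpi := PI_RGT_0).
  (* Written as an affine function of [x] in the shape of [rd_affine]; [Hgam] and [Hgam2] recover
     the contraction of ratio [rho x]. *)
  pose (gam := fun x y : R => (z + (eps * (r * ee y - z) + x * ((1 - eps) * (r * ee y - z))))%C).
  pose (g1 := fun x y : R => ((1 - eps) * (r * ee y - z))%C).
  pose (rho := fun x : R => (eps + (1 - eps) * x)%R).
  pose (g2 := fun x y : R => (rho x * (r * (dpi * ee y)))%C).
  assert (Hgam : forall x y, gam x y = (z + rho x * (r * ee y - z))%C).
  { intros x y. unfold gam, rho. rewrite RtoC_plus, RtoC_mult, RtoC_minus. ring. }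
  assert (Hgam2 : forall x y, gam x y = ((1 - rho x)%R * z + (rho x * r)%R * ee y)%C).
  { intros x y. rewrite Hgam, RtoC_minus, RtoC_mult. ring. }
  assert (Hrho : forall x, 0 <= x <= 1 -> eps <= rho x <= 1).
  { intros x Hx. unfold rho. nra. }
  assert (Hw : forall y, Cmod (r * ee y)%C = r).
  { intros y. rewrite Cmod_mult, ee_mod, Cmod_R, Rabs_right; lra. }
  assert (Hd2 : forall y, Cmod (r * ee y - z) <= 2 * r).
  { intros y. generalize (Cmod_triangle_minus (r * ee y)%C z). rewrite Hw. lra. }
  assert (HG : Qsq gam g1 g2 q 0 0 1 = 0%C).
  (* The first summand bounds the derivative in [x], the second the derivative in [y]. *)
  { apply goursat with (L := (1 - eps) * (2 * r) + r * (2 * PI)).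
    - intros x y. apply rd_affine.
    - intros x y.
      assert (H : rd (fun v => ((1 - rho x)%R * z + (rho x * r)%R * ee v)%C) y ((rho x * r)%R * (dpi * ee y))%C).
      { apply rd_shift. apply (rd_scal ee), ee_rd. }
      replace (g2 x y) with ((rho x * r)%R * (dpi * ee y))%C by (unfold g2; rewrite RtoC_mult; ring).
      intros e He. destruct (H e He) as [d [Hd H']]. exists d. split; [exact Hd|].
      intros h Hh. rewrite !Hgam2. apply H', Hh.
    - intros x y. exact (cont_R_const (g1 x y) x).
    - intros x y. unfold g2. apply (cont_R_mult (fun _ => RtoC (rho x))); [apply cont_R_const|].
      apply (cont_R_mult (fun _ => RtoC r)); [apply cont_R_const|].
      apply (cont_R_mult (fun _ => dpi)); [apply cont_R_const|]. apply ee_cont.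
    - assert (0 <= (1 - eps) * (2 * r)) by (apply Rmult_le_pos; lra).
      assert (0 <= r * (2 * PI)) by (apply Rmult_le_pos; lra). lra.
    - intros x y Hx Hy. unfold g1. rewrite <- RtoC_minus, Cmod_mult, Cmod_R, (Rabs_right (1 - eps)) by lra.
      assert (0 <= r * (2 * PI)) by (apply Rmult_le_pos; lra).
      assert ((1 - eps) * Cmod (r * ee y - z) <= (1 - eps) * (2 * r))
        by (apply Rmult_le_compat_l; [lra|apply Hd2]). lra.
    - intros x y Hx Hy. unfold g2. rewrite !Cmod_mult, dpi_mod, ee_mod, !Cmod_R.
      specialize (Hrho x Hx). rewrite !Rabs_right by lra.
      assert (0 <= (1 - eps) * (2 * r)) by (apply Rmult_le_pos; lra).
      assert (H1 : 0 <= r * (2 * PI)) by (apply Rmult_le_pos; lra).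
      rewrite Rmult_1_r.
      assert (rho x * (r * (2 * PI)) <= 1 * (r * (2 * PI))) by (apply Rmult_le_compat_r; lra). lra.
    - intros x y x' y' Hx Hy Hx' Hy'.
      rewrite !Hgam.
      replace (z + rho x * (r * ee y - z) - (z + rho x' * (r * ee y' - z)))%C
        with ((1 - eps)%R * (x - x')%R * (r * ee y - z) + rho x' * (r * (ee y - ee y')))%C.
      2: { unfold rho. rewrite !RtoC_plus, !RtoC_mult, !RtoC_minus. ring. }
      eapply Rle_trans; [apply Cmod_triangle|]. rewrite !Cmod_mult, !Cmod_R.
      specialize (Hrho x' Hx'). rewrite (Rabs_right (1 - eps)), (Rabs_right r), (Rabs_right (rho x')) by lra.
      assert (Ha := Rabs_pos (x - x')). assert (Hb := Rabs_pos (y - y')).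
      assert (B1 : (1 - eps) * Rabs (x - x') * Cmod (r * ee y - z) <= (1 - eps) * Rabs (x - x') * (2 * r)).
      { apply Rmult_le_compat_l; [apply Rmult_le_pos; lra|apply Hd2]. }
      assert (B2 : rho x' * (r * Cmod (ee y - ee y')) <= 1 * (r * (2 * PI * Rabs (y - y')))).
      { apply Rmult_le_compat; try lra.
        - apply Rmult_le_pos; [lra|apply Cmod_ge_0].
        - apply Rmult_le_compat_l; [lra|apply ee_lip]. }
      assert (B3 : 0 <= (1 - eps) * (2 * r) * Rabs (y - y')).
      { apply Rmult_le_pos; [|lra]. apply Rmult_le_pos; lra. }
      assert (B4 : 0 <= r * (2 * PI) * Rabs (x - x')).
      { apply Rmult_le_pos; [|lra]. apply Rmult_le_pos; lra. }
      lra.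
    - intros x y Hx Hy. specialize (Hrho x Hx). rewrite Hgam2.
      destruct (shrunk_circle_point z r (rho x) y Hz ltac:(lra)) as (P1 & P2 & _). apply Hq; auto. }
  assert (Hc : forall w, Cmod w <= r -> w <> z -> cont_C q w).
  { intros w H1 H2. destruct (Hq w H1 H2) as [l Hl]. eapply cd_cont, Hl. }
  assert (Hne : forall e y, 0 < e <= 1 ->
    cont_C q ((1 - e)%R * z + (e * r)%R * ee y)%C).
  { intros e y He. destruct (shrunk_circle_point z r e y Hz He) as (P1 & P2 & _). apply Hc; auto. }
  assert (Hv : forall x, 0 <= x <= 1 ->
    vside gam g2 q x 0 1 = (dpi * circ q ((1 - rho x)%R * z)%C (rho x * r))%C).
  { intros x Hx. unfold circ. rewrite <- CI_scal.
    - apply CI_ext; [lra|]. intros t _. rewrite Hgam2. unfold g2.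
      rewrite !RtoC_mult. ring.
    - apply circ_ex. intros y. apply Hne. specialize (Hrho x Hx). lra. }
  assert (Hh : hside gam g1 q 1 0 1 = hside gam g1 q 0 0 1).
  { apply CI_ext; [lra|]. intros t _. unfold gam, g1. rewrite ee_period. reflexivity. }
  unfold Qsq in HG. rewrite !Rplus_0_l in HG. rewrite Hh, !Hv in HG by lra.
  replace (rho 1) with 1 in HG by (unfold rho; ring).
  replace (rho 0) with eps in HG by (unfold rho; ring).
  replace ((1 - 1)%R * z)%C with (RtoC 0) in HG by (rewrite RtoC_minus; ring).
  rewrite Rmult_1_l in HG.
  apply Cminus_eq_0.
  set (X := circ q 0 r) in *. set (Y := circ q ((1 - eps)%R * z)%C (eps * r)) in *.
  replace (X - Y)%C with (/ dpi * (dpi * (X - Y)))%C by (field; apply dpi_neq_0).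
  replace (dpi * (X - Y))%C with (RtoC 0); [ring|].
  rewrite <- HG. ring.
Qed.

(** * Cauchy's formula and Taylor coefficients *)


Lemma cont_bounded_disc (f : C -> C) (r : R) : 0 < r ->
  (forall w, Cmod w <= r -> cont_C f w) ->
  exists M, 0 <= M /\ forall w, Cmod w <= r -> Cmod (f w) <= M.
Proof.
  intros Hr Hc.
  apply (disc_compact r (fun S => exists M, 0 <= M /\ forall w, S w -> Cmod w <= r -> Cmod (f w) <= M)) in Hr.
  - destruct Hr as [M [HM H]]. exists M. auto.
  - intros S T U [M1 [P1 H1]] [M2 [P2 H2]] HU. exists (M1 + M2). split; [lra|].
    intros w Hw Hwr. destruct (HU w Hw) as [H|H]; [specialize (H1 w H Hwr)|specialize (H2 w H Hwr)]; lra.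
  - intros c. destruct (Rle_dec (Cmod c) r) as [H|H].
    + destruct (Hc c H 1 Rlt_0_1) as [d [Hd Hd1]]. exists d. split; [exact Hd|].
      exists (Cmod (f c) + 1). split; [generalize (Cmod_ge_0 (f c)); lra|].
      intros w Hw _. specialize (Hd1 w Hw). generalize (Cmod_triangle_rev (f w) (f c)). lra.
    + exists (Cmod c - r). split; [lra|]. exists 0. split; [lra|]. intros w Hw Hwr.
      rewrite Cmod_minus_sym in Hw. generalize (Cmod_triangle_rev c w). lra.
Qed.

Lemma analytic_cont (f : C -> C) (w : C) : analytic_D f -> inD w -> cont_C f w.
Proof. intros Hf Hw. eapply cd_cont, analytic_cd; auto. Qed.

Lemma analytic_bounded (f : C -> C) (r : R) : analytic_D f -> 0 < r < 1 ->
  exists M, 0 <= M /\ forall w, Cmod w <= r -> Cmod (f w) <= M.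
Proof.
  intros Hf Hr. apply cont_bounded_disc; [lra|].
  intros w Hw. apply analytic_cont; [exact Hf|unfold inD; lra].
Qed.

Lemma cd_pow (n : nat) (z : C) : cd (fun w => w ^ n)%C z (INR n * z ^ pred n)%C.
Proof.
  induction n as [|n IH].
  - simpl. replace (0 * 1)%C with (RtoC 0) by ring. apply cd_const.
  - assert (H := cd_mult _ _ _ _ _ (cd_id z) IH).
    replace (INR (S n) * z ^ pred (S n))%C with (1 * z ^ n + z * (INR n * z ^ pred n))%C; [exact H|].
    rewrite S_INR, RtoC_plus. destruct n; simpl; ring.
Qed.

Lemma cd_inv_pow (n : nat) (z : C) : z <> 0%C ->
  exists l, cd (fun w => / w ^ n)%C z l.
Proof.
  intros Hz. eexists. apply (cd_comp (fun x => / x)%C (fun w => w ^ n)%C).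
  - apply cd_inv. apply Cpow_nz, Hz.
  - apply cd_pow.
Qed.

Lemma cd_div_pow (f : C -> C) (n : nat) (w a : C) : cd f w a -> w <> 0%C ->
  exists l, cd (fun w => f w * / w ^ n)%C w l.
Proof.
  intros Hf Hw. destruct (cd_inv_pow n w Hw) as [l Hl]. eexists.
  apply (cd_mult f (fun w => / w ^ n)%C); eassumption.
Qed.

Lemma cd_cont_scal (f : C -> C) (w : C) : (exists l, cd f w l) ->
  cont_C f w /\ forall c, cont_C (fun w => c * f w)%C w.
Proof.
  intros [l Hl]. split; [exact (cd_cont _ _ _ Hl)|]. intros c. eapply cd_cont, cd_scal, Hl.
Qed.

Lemma Cmod_circle (r y : R) : 0 <= r -> Cmod (0 + r * ee y) = r.
Proof.
  intros Hr. rewrite Cplus_0_l, Cmod_mult, ee_mod, Cmod_R, Rabs_right; lra.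
Qed.

Lemma circle_point (r y : R) : 0 < r < 1 ->
  inD (0 + r * ee y) /\ (0 + r * ee y)%C <> 0%C /\ Cmod (0 + r * ee y)%C = r.
Proof.
  intros Hr. assert (E := Cmod_circle r y ltac:(lra)). unfold inD. repeat split; try lra.
  apply Cmod_gt_0. lra.
Qed.

(** Cauchy's integral for the Taylor coefficient of order [n], over the circle of radius [r]. *)
Definition tcr (f : C -> C) (n : nat) (r : R) : C := circ (fun w => f w * / w ^ S n)%C 0%C r.

(* Taylor coefficients at the origin; the radius [1/2] is immaterial by [tcr_tc]. *)
Definition tc (f : C -> C) (n : nat) : C := tcr f n (/ 2).

Lemma tcr_radius (f : C -> C) (n : nat) (r s : R) : analytic_D f -> 0 < s <= r -> r < 1 ->
  tcr f n r = tcr f n s.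
Proof.
  intros Hf Hs Hr. unfold tcr.
  rewrite (circ_shrink _ 0%C r (s / r)).
  - f_equal; [ring|field; lra].
  - rewrite Cmod_0. lra.
  - split; [apply Rdiv_lt_0_compat; lra|]. apply Rmult_le_reg_r with r; [lra|].
    unfold Rdiv. rewrite Rmult_assoc, Rinv_l; lra.
  - intros w Hw Hw0. apply (cd_div_pow f (S n) w (cder f w)); [|exact Hw0].
    apply analytic_cd; [exact Hf|unfold inD; lra].
Qed.

Lemma tcr_tc (f : C -> C) (n : nat) (r : R) : analytic_D f -> 0 < r < 1 -> tcr f n r = tc f n.
Proof.
  intros Hf Hr. unfold tc. destruct (Rle_dec r (/ 2)).
  - symmetry. apply tcr_radius; [exact Hf|lra|lra].
  - apply tcr_radius; [exact Hf|lra|lra].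
Qed.

(** On radius [s] the integral is [s^-(n+1)] times a number [I] independent of [s], yet it does not
    depend on the radius. Comparing [r] with [r / 2] gives [I = 2^(n+1) * I], hence [I = 0], and no
    trigonometric integral has to be computed. *)
Lemma tcr_const_S (c : C) (n : nat) (r : R) : 0 < r < 1 -> tcr (fun _ => c) (S n) r = 0%C.
Proof.
  intros Hr.
  assert (Ha : analytic_D (fun _ : C => c)) by (apply (cd_analytic _ (fun _ => 0%C)); intros; apply cd_const).
  pose (I := CI (fun y => c * / ee y ^ S n)%C 0 1).
  assert (H : forall s, 0 < s < 1 -> tcr (fun _ => c) (S n) s = (/ RtoC s ^ S n * I)%C).
  { intros s Hs. unfold tcr, circ, I. rewrite <- CI_scal.
    - apply CI_ext; [lra|]. intros t _. rewrite Cplus_0_l.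
      assert (Hs0 : RtoC s <> 0%C) by (intros E; apply RtoC_inj in E; lra).
      assert (He := ee_neq_0 t).
      rewrite !Cpow_mult_l. simpl. field. repeat split; auto; apply Cpow_nz; auto.
    - apply cont_R_ex_RInt. intros t.
      apply (cont_R_mult (fun _ => c) (fun y => / ee y ^ S n)%C); [apply cont_R_const|].
      destruct (cd_inv_pow (S n) (ee t) (ee_neq_0 t)) as [l Hl].
      apply (cont_R_comp (fun w => / w ^ S n)%C ee); [eapply cd_cont, Hl|apply ee_cont]. }
  assert (H1 := tcr_radius (fun _ => c) (S n) r (r / 2) Ha ltac:(lra) ltac:(lra)).
  rewrite !H in H1 by lra.
  assert (Hr0 : RtoC r <> 0%C) by (intros E; apply RtoC_inj in E; lra).
  assert (H20 : RtoC 2 <> 0%C) by (intros E; apply RtoC_inj in E; lra).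
  replace (RtoC (r / 2)) with (RtoC r * / 2)%C in H1 by (unfold Rdiv; rewrite RtoC_mult, RtoC_inv; auto).
  rewrite Cpow_mult_l in H1.
  assert (Hp : (RtoC r ^ S n)%C <> 0%C) by (apply Cpow_nz; auto).
  assert (H2 : (I = 2 ^ S n * I)%C).
  { replace I with (r ^ S n * (/ r ^ S n * I))%C at 1 by (field; auto).
    rewrite H1. rewrite Cpow_inv by auto. field. split; auto. apply Cpow_nz; auto. }
  assert (H3 : (I * (2 ^ S n - 1) = 0)%C).
  { replace (I * (2 ^ S n - 1))%C with (2 ^ S n * I - I)%C by ring. rewrite <- H2. ring. }
  assert (H4 : I = 0%C).
  { apply Cmod_eq_0. apply (f_equal Cmod) in H3. rewrite Cmod_mult, Cmod_0 in H3.
    assert (H5 : 0 < Cmod (2 ^ S n - 1)%C).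
    { assert (H6 := Cmod_triangle_rev (2 ^ S n)%C 1%C).
      rewrite Cmod_pow, Cmod_1, Cmod_R, Rabs_right in H6 by lra.
      assert (1 <= 2 ^ n) by (apply pow_R1_Rle; lra). simpl in H6. simpl. lra. }
    apply Rmult_integral in H3. destruct H3; lra. }
  rewrite H by lra. rewrite H4. ring.
Qed.

Lemma tcr_const_0 (c : C) (r : R) : 0 < r -> tcr (fun _ => c) 0 r = c.
Proof.
  intros Hr. unfold tcr, circ.
  assert (Hr0 : RtoC r <> 0%C) by (intros E; apply RtoC_inj in E; lra).
  rewrite (CI_ext _ (fun _ => c)); [|lra|].
  - unfold CI. rewrite (RInt_const (V := CRV)).
    replace (1 - 0) with 1 by ring. apply (scal_one (K := R_Ring) (V := C_R_ModuleSpace)).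
  - intros t _. rewrite Cplus_0_l. simpl. field. split; auto. apply ee_neq_0.
Qed.

(** Finite geometric expansion of [1 / (w - z)] in powers of [z / w]. With the exact remainder, no
    infinite sum is exchanged with an integral. *)
Lemma geom_kernel (N : nat) (f : C -> C) (z w : C) : w <> 0%C -> w <> z ->
  (f w * / (w - z) = csum N (fun n => z ^ n * (f w * / w ^ S n)) + (z ^ N * / w ^ N) * (f w * / (w - z)))%C.
Proof.
  intros H1 H2.
  assert (H3 : (w - z <> 0)%C) by (intros E; apply H2, Cminus_eq_0, E).
  induction N as [|N IH].
  - simpl. field; auto.
  - rewrite IH at 1. simpl. field. repeat split; auto. apply Cpow_nz; auto.
Qed.

Lemma circ_csum (N : nat) (F : nat -> C -> C) (c : C) (r : R) :
  (forall n y, cont_C (F n) (c + r * ee y)%C) ->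
  (forall y, cont_C (fun w => csum N (fun n => F n w)) (c + r * ee y)%C) /\
  circ (fun w => csum N (fun n => F n w)) c r = csum N (fun n => circ (F n) c r).
Proof.
  intros HF. induction N as [|N [IH1 IH2]].
  - split.
    + intros y. exact (cd_cont _ _ _ (cd_const 0%C _)).
    + simpl. unfold circ. rewrite (CI_ext _ (fun _ => 0%C)); [|lra|intros; ring].
      unfold CI. rewrite (RInt_const (V := CRV)).
      apply (scal_zero_r (K := R_Ring) (V := C_R_ModuleSpace)).
  - split.
    + intros y eps Heps. simpl.
      destruct (IH1 y (eps / 2)) as [d1 [Hd1 H1]]; [lra|].
      destruct (HF N y (eps / 2)) as [d2 [Hd2 H2]]; [lra|].
      exists (Rmin d1 d2). split; [apply Rmin_pos; lra|]. intros x Hx.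
      specialize (H1 x (Rlt_min_l _ _ _ Hx)).
      specialize (H2 x (Rlt_min_r _ _ _ Hx)).
      match goal with |- Cmod ((?a + ?b) - (?c + ?d))%C < _ =>
        replace ((a + b) - (c + d))%C with ((a - c) + (b - d))%C by ring end.
      eapply Rle_lt_trans; [apply Cmod_triangle|]. lra.
    + simpl. rewrite circ_plus by auto. rewrite IH2. reflexivity.
Qed.

(** The difference quotient is differentiable away from [z] and bounded near [z], so its integral
    does not change when the circle is shrunk to [z], while the length of the circle tends to 0. *)
Theorem cauchy_kernel (f : C -> C) (z : C) (r : R) : analytic_D f -> Cmod z < r -> r < 1 ->
  circ (fun w => (f w - f z) * / (w - z))%C 0%C r = 0%C.
Proof.
  intros Hf Hz Hr.
  assert (Hz0 := Cmod_ge_0 z).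
  set (q := fun w => ((f w - f z) * / (w - z))%C).
  assert (Hzd : inD z) by (unfold inD; lra).
  assert (Hq : forall w, Cmod w <= r -> w <> z -> exists l, cd q w l).
  { intros w Hw E. eexists.
    apply (cd_mult (fun w => f w - f z)%C (fun w => / (w - z))%C).
    - apply cd_minus; [apply analytic_cd; [exact Hf|unfold inD; lra]|apply cd_const].
    - apply (cd_comp (fun x => / x)%C (fun w => w - z)%C).
      + apply cd_inv. intros H0. apply E, Cminus_eq_0, H0.
      + apply cd_minus; [apply cd_id|apply cd_const]. }
  destruct (analytic_cd f z Hf Hzd 1 Rlt_0_1) as [d [Hd H]].
  set (M := Cmod (cder f z) + 1).
  assert (HM : 0 < M) by (unfold M; generalize (Cmod_ge_0 (cder f z)); lra).
  apply Cmod_small_0. intros e He.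
  (* The bound [d / (4 * r)] keeps the small circle where the quotient is at most [M]; the bound
     [e / (M * r)] makes its integral at most [e]. *)
  set (eps := Rmin 1 (Rmin (d / (4 * r)) (e / (M * r)))).
  assert (E1 : 0 < d / (4 * r)) by (apply Rdiv_lt_0_compat; lra).
  assert (E2 : 0 < e / (M * r)) by (apply Rdiv_lt_0_compat; nra).
  assert (Heps : 0 < eps <= 1).
  { split; [repeat apply Rmin_pos; lra|apply Rmin_l]. }
  assert (K1 : eps * (2 * r) < d).
  { apply Rle_lt_trans with (d / (4 * r) * (2 * r)).
    - apply Rmult_le_compat_r; [lra|]. unfold eps. eapply Rle_trans; [apply Rmin_r|apply Rmin_l].
    - replace (d / (4 * r) * (2 * r)) with (d / 2) by (field; lra). lra. }
  assert (K2 : M * (eps * r) <= e).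
  { apply Rle_trans with (M * (e / (M * r) * r)).
    - apply Rmult_le_compat_l; [lra|]. apply Rmult_le_compat_r; [lra|].
      unfold eps. eapply Rle_trans; [apply Rmin_r|apply Rmin_r].
    - apply Req_le. field. split; lra. }
  rewrite (circ_shrink q z r eps Hz Heps Hq).
  eapply Rle_trans; [|exact K2].
  assert (Hpt : forall y, Cmod ((1 - eps)%R * z + (eps * r)%R * ee y) <= r /\
     ((1 - eps)%R * z + (eps * r)%R * ee y)%C <> z /\
     Cmod ((1 - eps)%R * z + (eps * r)%R * ee y - z) < d).
  { intros y. destruct (shrunk_circle_point z r eps y Hz Heps) as (P1 & P2 & P3).
    repeat split; auto. lra. }
  apply circ_bound; [nra| |].
  - intros y. destruct (Hpt y) as (P1 & P2 & _). destruct (Hq _ P1 P2) as [l Hl]. eapply cd_cont, Hl.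
  - intros y. destruct (Hpt y) as (_ & P2 & P3).
    set (w := ((1 - eps)%R * z + (eps * r)%R * ee y)%C) in *.
    specialize (H _ P3). replace (z + (w - z))%C with w in H by ring.
    assert (P4 : (w - z <> 0)%C) by (intros E; apply P2, Cminus_eq_0, E).
    assert (P5 : 0 < Cmod (w - z)) by (apply Cmod_gt_0; exact P4).
    unfold q.
    rewrite Cmod_mult, Cmod_inv by exact P4.
    apply Rmult_le_reg_r with (Cmod (w - z)); [exact P5|].
    rewrite Rmult_assoc, Rinv_l, Rmult_1_r by lra.
    replace (f w - f z)%C with ((f w - f z - cder f z * (w - z)) + cder f z * (w - z))%C by ring.
    eapply Rle_trans; [apply Cmod_triangle|]. rewrite (Cmod_mult (cder f z)). unfold M. lra.
Qed.

Lemma csum_ext (n : nat) (F G : nat -> C) : (forall i, (i < n)%nat -> F i = G i) -> csum n F = csum n G.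
Proof. induction n; intros H; simpl; [reflexivity|]. rewrite IHn, H by (intros; auto with arith). reflexivity. Qed.

Lemma csum_plus (n : nat) (F G : nat -> C) : csum n (fun i => F i + G i)%C = (csum n F + csum n G)%C.
Proof. induction n; simpl; [ring|]. rewrite IHn. ring. Qed.

Lemma csum_scal (n : nat) (c : C) (F : nat -> C) : csum n (fun i => c * F i)%C = (c * csum n F)%C.
Proof. induction n; simpl; [ring|]. rewrite IHn. ring. Qed.

Lemma csum_0 (n : nat) (F : nat -> C) : (forall i, (i < n)%nat -> F i = 0%C) -> csum n F = 0%C.
Proof.
  intros H. rewrite (csum_ext n F (fun _ => 0 * 0)%C).
  - rewrite csum_scal. ring.
  - intros i Hi. rewrite H by exact Hi. ring.
Qed.

Lemma csum_single (n j : nat) (F : nat -> C) : (j < n)%nat ->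
  (forall i, (i < n)%nat -> i <> j -> F i = 0%C) -> csum n F = F j.
Proof.
  induction n; intros Hj H; [lia|]. simpl. destruct (Nat.eq_dec j n) as [->|E].
  - rewrite csum_0; [ring|]. intros i Hi. apply H; lia.
  - rewrite IHn, (H n) by (try lia; intros; apply H; lia). ring.
Qed.

(** [cauchy_kernel] concerns [h = f - f z], so expanding the kernel produces the coefficients of [f]
    minus those of the constant [f z]. The latter vanish except at order 0, where they give back
    [f z] itself. Cauchy's formula and Taylor's expansion thus come out together. *)
Theorem taylor_remainder (f : C -> C) (r M : R) (z : C) (N : nat) :
  analytic_D f -> 0 < r < 1 -> (forall w, Cmod w <= r -> Cmod (f w) <= M) -> Cmod z < r ->
  Cmod (f z - csum N (fun n => tc f n * z ^ n)%C) <= 2 * M * (Cmod z / r) ^ N * (r / (r - Cmod z)).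
Proof.
  intros Hf Hr HM Hz.
  assert (Hz0 := Cmod_ge_0 z).
  set (h := fun w => (f w - f z)%C).
  assert (Hh : forall w, inD w -> cd h w (cder f w - 0)%C).
  { intros w Hw. apply cd_minus; [apply analytic_cd; auto|apply cd_const]. }
  assert (Hpt : forall y, (inD (0 + r * ee y) /\ (0 + r * ee y)%C <> 0%C /\ (0 + r * ee y)%C <> z /\
     Cmod (0 + r * ee y)%C = r)).
  { intros y. destruct (circle_point r y Hr) as (E1 & E2 & E). repeat split; auto.
    intros E0. rewrite E0 in E. lra. }
  assert (Hdiv : forall (p : C -> C) n y, (forall w, inD w -> exists a, cd p w a) ->
    cont_C (fun w => p w * / w ^ n)%C (0 + r * ee y)%C /\
    forall c, cont_C (fun w => c * (p w * / w ^ n))%C (0 + r * ee y)%C).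
  { intros p n y Hp. destruct (Hpt y) as (P1 & P2 & _). destruct (Hp _ P1) as [a Ha].
    apply (cd_cont_scal (fun w => p w * / w ^ n)%C), (cd_div_pow p n _ a); auto. }
  assert (Eh : forall w, inD w -> exists a, cd h w a) by (intros w Hw; eexists; apply Hh, Hw).
  assert (Ef : forall w, inD w -> exists a, cd f w a) by (intros w Hw; eexists; apply analytic_cd; auto).
  assert (Ez : forall w, inD w -> exists a, cd (fun _ => f z) w a) by (intros w _; eexists; apply cd_const).
  assert (C3 : forall y, cont_C (fun w => (z ^ N * / w ^ N) * (h w * / (w - z)))%C (0 + r * ee y)%C).
  { intros y. destruct (Hpt y) as (P1 & P2 & P3 & _). destruct (cd_inv_pow N _ P2) as [l Hl].
    eapply cd_cont. apply (cd_mult (fun w => z ^ N * / w ^ N)%C (fun w => h w * / (w - z))%C).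
    - apply cd_scal, Hl.
    - apply (cd_mult h (fun w => / (w - z))%C); [apply Hh, P1|].
      apply (cd_comp (fun x => / x)%C (fun w => w - z)%C).
      + apply cd_inv. intros H0. apply P3, Cminus_eq_0, H0.
      + apply cd_minus; [apply cd_id|apply cd_const]. }
  assert (HK := cauchy_kernel f z r Hf Hz ltac:(lra)).
  rewrite (circ_ext _ (fun w => csum N (fun n => z ^ n * (h w * / w ^ S n)) + (z ^ N * / w ^ N) * (h w * / (w - z)))%C) in HK.
  2: { intros y. destruct (Hpt y) as (P1 & P2 & P3 & _). apply (geom_kernel N h z); auto. }
  destruct (circ_csum N (fun n w => z ^ n * (h w * / w ^ S n))%C 0%C r) as [S1 S2];
    [intros; apply Hdiv, Eh|].
  rewrite circ_plus in HK by auto. rewrite S2 in HK.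
  set (Rm := circ (fun w => (z ^ N * / w ^ N) * (h w * / (w - z)))%C 0%C r) in HK.
  assert (HRm : Cmod Rm <= 2 * M * (Cmod z / r) ^ N * (/ (r - Cmod z)) * r).
  { apply circ_bound; [lra|exact C3|]. intros y. destruct (Hpt y) as (P1 & P2 & P3 & P4).
    set (w := (0 + r * ee y)%C) in *.
    assert (P5 : (w - z <> 0)%C) by (intros E; apply P3, Cminus_eq_0, E).
    rewrite !Cmod_mult, !Cmod_inv, !Cmod_pow, P4 by (auto; apply Cpow_nz; auto).
    unfold Rdiv. rewrite Rpow_mult_distr, pow_inv.
    assert (P6 : 0 <= Cmod z ^ N * / r ^ N).
    { apply Rmult_le_pos; [apply pow_le, Hz0|]. left. apply Rinv_0_lt_compat, pow_lt. lra. }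
    assert (P7 : Cmod (h w) <= 2 * M).
    { unfold h. eapply Rle_trans; [apply Cmod_triangle_minus|].
      generalize (HM w ltac:(lra)) (HM z ltac:(lra)). lra. }
    assert (P8 : / Cmod (w - z) <= / (r - Cmod z)).
    { apply Rinv_le_contravar; [lra|]. generalize (Cmod_triangle_rev w z). lra. }
    replace (2 * M * (Cmod z ^ N * / r ^ N) * / (r - Cmod z))
      with ((Cmod z ^ N * / r ^ N) * (2 * M * / (r - Cmod z))) by ring.
    apply Rmult_le_compat_l; [exact P6|].
    apply Rmult_le_compat; auto; [apply Cmod_ge_0|].
    left. apply Rinv_0_lt_compat, Cmod_gt_0, P5. }
  assert (Hcoef : forall n, circ (fun w => z ^ n * (h w * / w ^ S n))%C 0%C r
     = (z ^ n * tc f n + z ^ n * (- (1)) * tcr (fun _ => f z) n r)%C).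
  { intros n. rewrite (circ_scal (fun w => h w * / w ^ S n)%C) by (intros; apply Hdiv, Eh).
    rewrite <- (tcr_tc f n r Hf Hr). unfold tcr.
    rewrite (circ_ext (fun w => h w * / w ^ S n)%C (fun w => f w * / w ^ S n + - (1) * (f z * / w ^ S n))%C)
      by (intros; unfold h; ring).
    rewrite (circ_plus (fun w => f w * / w ^ S n)%C), (circ_scal (fun w => f z * / w ^ S n)%C);
      [ring|intros y; apply (Hdiv (fun _ => f z)), Ez|intros y; apply Hdiv, Ef|].
    intros y. apply (Hdiv (fun _ => f z)), Ez. }
  rewrite (csum_ext N _ (fun n => tc f n * z ^ n + (- (1)) * (z ^ n * tcr (fun _ => f z) n r))%C) in HK
    by (intros n _; rewrite Hcoef; ring).
  rewrite csum_plus, csum_scal in HK.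
  (* For [N = 0] there is no term of order 0 to produce [f z]; the bound is then direct, because
     [r / (r - |z|) >= 1]. *)
  destruct N as [|N].
  - simpl in *. replace (f z - 0)%C with (f z) by ring.
    assert (HMz := HM z ltac:(lra)). assert (0 <= Cmod (f z)) by apply Cmod_ge_0.
    assert (1 <= r / (r - Cmod z)).
    { apply Rmult_le_reg_r with (r - Cmod z); [lra|]. unfold Rdiv. rewrite Rmult_assoc, Rinv_l; lra. }
    nra.
  - rewrite (csum_single (S N) 0 (fun n => z ^ n * tcr (fun _ => f z) n r)%C) in HK.
    + rewrite tcr_const_0 in HK by lra. simpl (z ^ 0)%C in HK.
      set (SS := csum (S N) (fun n => tc f n * z ^ n)%C) in *.
      replace (f z - SS)%C with Rm.
      * eapply Rle_trans; [exact HRm|]. apply Req_le. unfold Rdiv. ring.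
      * apply Cminus_eq_0. rewrite <- HK. ring.
    + lia.
    + intros i Hi Hi0. destruct i as [|i]; [lia|]. rewrite tcr_const_S by lra. ring.
Qed.

Lemma tc_bound (f : C -> C) (r M : R) (n : nat) :
  analytic_D f -> 0 < r < 1 -> (forall w, Cmod w <= r -> Cmod (f w) <= M) ->
  Cmod (tc f n) <= M / r ^ n.
Proof.
  intros Hf Hr HM. rewrite <- (tcr_tc f n r Hf Hr). unfold tcr.
  assert (Hp : 0 < r ^ n) by (apply pow_lt; lra).
  replace (M / r ^ n) with (M / r ^ S n * r) by (simpl; field; split; lra).
  apply circ_bound; [lra| |].
  - intros y. destruct (circle_point r y Hr) as (P1 & P2 & _).
    apply (cd_cont_scal (fun w => f w * / w ^ S n)%C), (cd_div_pow f _ _ (cder f (0 + r * ee y)%C)); auto.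
    apply analytic_cd; auto.
  - intros y. destruct (circle_point r y Hr) as (P1 & P2 & P3).
    rewrite Cmod_mult, Cmod_inv, Cmod_pow, P3 by (apply Cpow_nz; auto).
    apply Rmult_le_compat_r; [|apply HM; lra].
    left. apply Rinv_0_lt_compat. simpl. nra.
Qed.

(** * Power series *)


(** Every term of the remainder contains [h^2], so replacing [|h|] by [eta] gains the factor
    [(|h| / eta)^2]. [E] is the same remainder at the real points [|z|] and [eta], and it obeys the
    same recurrence with nonnegative terms. *)
Lemma pow_second_order (z h : C) (eta : R) (n : nat) : 0 < eta -> Cmod h <= eta ->
  Cmod ((z + h) ^ n - z ^ n - INR n * h * z ^ pred n) <= (Cmod h / eta) ^ 2 * (Cmod z + eta) ^ n.
Proof.
  intros He Hh. assert (Hz := Cmod_ge_0 z). assert (Hh0 := Cmod_ge_0 h).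
  pose (E := fun n => (Cmod z + eta) ^ n - Cmod z ^ n - INR n * eta * Cmod z ^ pred n).
  assert (HEr : forall n, E (S n) = INR n * (eta * eta) * Cmod z ^ pred n + (Cmod z + eta) * E n).
  { intros m. unfold E. rewrite S_INR. simpl pred.
    destruct m; [simpl; ring|]. simpl pred. rewrite <- !tech_pow_Rmult. ring. }
  assert (HE : forall n, 0 <= E n).
  { induction n0; [unfold E; simpl; lra|]. rewrite HEr.
    assert (0 <= INR n0 * (eta * eta) * Cmod z ^ pred n0).
    { apply Rmult_le_pos; [|apply pow_le, Hz]. apply Rmult_le_pos; [apply pos_INR|nra]. }
    assert (0 <= (Cmod z + eta) * E n0) by (apply Rmult_le_pos; lra). lra. }
  set (k := (Cmod h / eta) ^ 2).
  assert (Hk : 0 <= k) by (unfold k; apply pow2_ge_0).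
  assert (Hkh : k * (eta * eta) = Cmod h * Cmod h) by (unfold k; field; lra).
  assert (HD : Cmod ((z + h) ^ n - z ^ n - INR n * h * z ^ pred n) <= k * E n).
  { induction n as [|n IH].
    - simpl. replace (1 - 1 - 0 * h * 1)%C with (RtoC 0) by ring. rewrite Cmod_0.
      unfold E; simpl. lra.
    - replace ((z + h) ^ S n - z ^ S n - INR (S n) * h * z ^ pred (S n))%C
        with (INR n * (h * h) * z ^ pred n + (z + h) * ((z + h) ^ n - z ^ n - INR n * h * z ^ pred n))%C.
      2: { rewrite S_INR, RtoC_plus. destruct n; simpl; ring. }
      eapply Rle_trans; [apply Cmod_triangle|]. rewrite HEr, !Cmod_mult, Cmod_pow, Cmod_R, Rabs_right
        by (apply Rle_ge, pos_INR).
      rewrite <- Hkh.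
      assert (Cmod (z + h) * Cmod ((z + h) ^ n - z ^ n - INR n * h * z ^ pred n) <= (Cmod z + eta) * (k * E n)).
      { apply Rmult_le_compat; try apply Cmod_ge_0; auto.
        eapply Rle_trans; [apply Cmod_triangle|lra]. }
      lra. }
  eapply Rle_trans; [exact HD|]. apply Rmult_le_compat_l; [exact Hk|].
  unfold E.
  assert (0 <= Cmod z ^ n) by (apply pow_le, Hz).
  assert (0 <= INR n * eta * Cmod z ^ pred n).
  { apply Rmult_le_pos; [|apply pow_le, Hz]. apply Rmult_le_pos; [apply pos_INR|lra]. }
  lra.
Qed.

(** * Limits of complex sequences and geometric majorants *)

Definition clim (u : nat -> C) (l : C) : Prop :=
  forall eps, 0 < eps -> exists N, forall n, (N <= n)%nat -> Cmod (u n - l) <= eps.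

Lemma clim_plus (u v : nat -> C) (a b : C) :
  clim u a -> clim v b -> clim (fun n => u n + v n)%C (a + b)%C.
Proof.
  intros Hu Hv eps He. destruct (Hu (eps / 2)) as [N1 H1]; [lra|].
  destruct (Hv (eps / 2)) as [N2 H2]; [lra|]. exists (N1 + N2)%nat. intros n Hn.
  specialize (H1 n ltac:(lia)). specialize (H2 n ltac:(lia)).
  replace (u n + v n - (a + b))%C with ((u n - a) + (v n - b))%C by ring.
  eapply Rle_trans; [apply Cmod_triangle|lra].
Qed.

Lemma clim_scal (u : nat -> C) (c a : C) : clim u a -> clim (fun n => c * u n)%C (c * a)%C.
Proof.
  intros Hu eps He. assert (Hc := Cmod_ge_0 c).
  destruct (Hu (eps / (Cmod c + 1))) as [N H]; [apply Rdiv_lt_0_compat; lra|].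
  exists N. intros n Hn. specialize (H n Hn).
  replace (c * u n - c * a)%C with (c * (u n - a))%C by ring. rewrite Cmod_mult.
  assert (H0 := Cmod_ge_0 (u n - a)).
  apply (Rmult_le_compat_l (Cmod c + 1)) in H; [|lra].
  replace ((Cmod c + 1) * (eps / (Cmod c + 1))) with eps in H by (field; lra). nra.
Qed.

Lemma clim_ext (u v : nat -> C) (l : C) (N0 : nat) :
  (forall n, (N0 <= n)%nat -> u n = v n) -> clim u l -> clim v l.
Proof.
  intros H Hu eps He. destruct (Hu eps He) as [N H1]. exists (N + N0)%nat.
  intros n Hn. rewrite <- H by lia. apply H1. lia.
Qed.

Lemma clim_shift (u : nat -> C) (l : C) : clim u l -> clim (fun n => u (S n)) l.
Proof.
  intros H eps He. destruct (H eps He) as [N HN]. exists N. intros n Hn. apply HN. lia.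
Qed.

Lemma clim_bound (u : nat -> C) (l x : C) (B : R) (N0 : nat) :
  clim u l -> (forall n, (N0 <= n)%nat -> Cmod (u n - x) <= B) -> Cmod (l - x) <= B.
Proof.
  intros Hu HB. apply le_epsilon. intros eps He. destruct (Hu eps He) as [N H].
  specialize (H (N + N0)%nat ltac:(lia)). specialize (HB (N + N0)%nat ltac:(lia)).
  eapply Rle_trans; [apply (Cmod_triangle_3 _ (u (N + N0)%nat))|].
  rewrite (Cmod_minus_sym l). lra.
Qed.

Lemma clim_unique (u : nat -> C) (a b : C) : clim u a -> clim u b -> a = b.
Proof.
  intros Ha Hb. apply Cminus_eq_0, Cmod_small_0. intros eps He.
  destruct (Hb eps He) as [N H]. apply (clim_bound u a b eps N Ha). exact H.
Qed.

Lemma clim_const_eventually (u : nat -> C) (l : C) (N0 : nat) :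
  (forall n, (N0 <= n)%nat -> u n = l) -> clim u l.
Proof.
  intros H eps He. exists N0. intros n Hn. rewrite H by exact Hn.
  replace (l - l)%C with (RtoC 0) by ring. rewrite Cmod_0. lra.
Qed.

Lemma csum_S (n : nat) (F : nat -> C) : csum (S n) F = (F 0%nat + csum n (fun i => F (S i)))%C.
Proof. induction n; [simpl; ring|]. simpl in *. rewrite IHn. ring. Qed.

Lemma csum_geom_bound (m n : nat) (F : nat -> C) (M q : R) : 0 <= q < 1 -> 0 <= M ->
  (forall i, Cmod (F i) <= M * q ^ i) ->
  Cmod (csum (m + n) F - csum m F) <= M * q ^ m / (1 - q).
Proof.
  intros Hq HM HF.
  assert (H : Cmod (csum (m + n) F - csum m F) <= M * (q ^ m - q ^ (m + n)) / (1 - q)).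
  { induction n.
    - rewrite Nat.add_0_r. replace (csum m F - csum m F)%C with (RtoC 0) by ring.
      rewrite Cmod_0. apply Req_le. field. lra.
    - rewrite Nat.add_succ_r. simpl csum.
      replace (csum (m + n) F + F (m + n)%nat - csum m F)%C
        with ((csum (m + n) F - csum m F) + F (m + n)%nat)%C by ring.
      eapply Rle_trans; [apply Cmod_triangle|].
      specialize (HF (m + n)%nat).
      apply Rle_trans with (M * (q ^ m - q ^ (m + n)) / (1 - q) + M * q ^ (m + n)); [lra|].
      apply Req_le. simpl. field. lra. }
  eapply Rle_trans; [exact H|]. unfold Rdiv. apply Rmult_le_compat_r.
  - left. apply Rinv_0_lt_compat. lra.
  - apply Rmult_le_compat_l; [exact HM|]. assert (0 <= q ^ (m + n)) by (apply pow_le; lra). lra.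
Qed.

Lemma csum_sum_n (n : nat) (F : nat -> C) : csum (S n) F = sum_n (G := C_R_NormedModule) F n.
Proof.
  induction n.
  - rewrite sum_O. simpl. ring.
  - rewrite sum_Sn, <- IHn. reflexivity.
Qed.

Lemma clim_geom (F : nat -> C) (M q : R) : 0 <= q < 1 -> 0 <= M ->
  (forall i, Cmod (F i) <= M * q ^ i) -> exists l, clim (fun n => csum n F) l.
Proof.
  intros Hq HM HF.
  assert (Hex : ex_series (V := C_R_NormedModule) F).
  { apply (ex_series_le (K := R_AbsRing) (V := CRV) F (fun i => M * q ^ i)).
    - intros i. rewrite <- Cmod_norm. apply HF.
    - apply (ex_series_scal (K := R_AbsRing) (V := R_NormedModule) M (fun i => q ^ i)).
      apply ex_series_geom. rewrite Rabs_right; lra. }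
  destruct Hex as [l Hl]. exists l. intros eps He.
  assert (Hb := Hl (fun y : C => Cmod (y - l) <= eps)).
  destruct Hb as [N HN].
  - assert (Hn := locally_le_locally_norm (K := R_AbsRing) (V := C_R_NormedModule) l).
    apply Hn. exists (mkposreal eps He). intros y Hy. unfold ball_norm in Hy.
    rewrite <- Cmod_norm in Hy. left. exact Hy.
  - exists (S N). intros n Hn. destruct n as [|n]; [lia|]. rewrite csum_sum_n. apply HN. lia.
Qed.

(** * Power series on the unit disc *)

Definition psum (a : nat -> C) (z : C) (N : nat) : C := csum N (fun n => a n * z ^ n)%C.

(* The power series with coefficients [a] converges on the unit disc. *)
Definition ps_disc (a : nat -> C) : Prop :=
  forall r, 0 < r < 1 -> exists M, 0 <= M /\ forall n, Cmod (a n) <= M * (/ r) ^ n.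

Definition has_ps (a : nat -> C) (f : C -> C) : Prop :=
  forall z, inD z -> clim (psum a z) (f z).

(** The coefficient bound at the radius halfway between [x] and 1 leaves a geometric factor at
    [x]. *)
Lemma ps_term_bound (a : nat -> C) (x : R) : ps_disc a -> 0 <= x < 1 ->
  exists M q, 0 <= M /\ 0 <= q < 1 /\ forall n, Cmod (a n) * x ^ n <= M * q ^ n.
Proof.
  intros Ha Hx. destruct (Ha ((1 + x) / 2)) as [M [HM H]]; [lra|].
  exists M, (x / ((1 + x) / 2)). split; [exact HM|]. split.
  - apply Rdiv_in_0_1. lra.
  - intros n. unfold Rdiv at 1. rewrite Rpow_mult_distr.
    replace (M * (x ^ n * (/ ((1 + x) / 2)) ^ n)) with (M * (/ ((1 + x) / 2)) ^ n * x ^ n) by ring.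
    apply Rmult_le_compat_r; [apply pow_le; lra|apply H].
Qed.

Lemma ps_exists (a : nat -> C) : ps_disc a -> exists f, has_ps a f.
Proof.
  intros Ha.
  assert (H : forall z, exists l, inD z -> clim (psum a z) l).
  { intros z. destruct (classic (inD z)) as [Hz|Hz]; [|exists z; tauto].
    destruct (ps_term_bound a (Cmod z) Ha) as (M & q & HM & Hq & H).
    { split; [apply Cmod_ge_0|exact Hz]. }
    destruct (clim_geom (fun n => a n * z ^ n)%C M q Hq HM) as [l Hl].
    - intros n. rewrite Cmod_mult, Cmod_pow. apply H.
    - exists l. auto. }
  destruct (fun_choice _ H) as [f Hf]. exists f. exact Hf.
Qed.

Definition dcoef (a : nat -> C) (n : nat) : C := (INR (S n) * a (S n))%C.

(** The sum [1 + q + ... + q^n] has [n + 1] terms, each at least [q^n]. *)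
Lemma pow_succ_bound (q : R) (n : nat) : 0 <= q < 1 -> INR (S n) * q ^ n <= / (1 - q).
Proof.
  intros Hq.
  assert (H : INR (S n) * q ^ n * (1 - q) <= 1 - q ^ S n).
  { induction n; [simpl; lra|]. rewrite S_INR.
    assert (Hp : 0 <= q ^ n <= 1) by (split; [apply pow_le; lra|rewrite <- (pow1 n); apply pow_incr; split; [apply Hq|left; apply Hq]]).
    apply (Rmult_le_compat_l q) in IHn; [|lra]. simpl in IHn |- *. simpl.
    assert (Hqp : 0 <= q * q ^ n <= 1) by (split; [apply Rmult_le_pos; lra|rewrite <- (Rmult_1_r 1); apply Rmult_le_compat; lra]).
    assert (q * q ^ n * (1 - q) <= 1 * (1 - q)) by (apply Rmult_le_compat_r; lra).
    nra. }
  apply Rmult_le_reg_r with (1 - q); [lra|]. rewrite Rinv_l by lra.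
  assert (0 <= q ^ S n) by (apply pow_le; lra). lra.
Qed.

(** The factor [n + 1] is absorbed by the gap between [r] and a larger radius [s]. *)
Lemma ps_disc_dcoef (a : nat -> C) : ps_disc a -> ps_disc (dcoef a).
Proof.
  intros Ha r Hr. set (s := (1 + r) / 2). destruct (Ha s) as [M [HM H]]; [unfold s; lra|].
  assert (Hs : r < s < 1) by (unfold s; lra).
  assert (Hq : 0 <= r / s < 1) by (apply Rdiv_in_0_1; lra).
  assert (Hsi : 0 < / s) by (apply Rinv_0_lt_compat; lra).
  assert (Hqi : 0 < / (1 - r / s)) by (apply Rinv_0_lt_compat; lra).
  exists (M * / s * / (1 - r / s)). split.
  { repeat apply Rmult_le_pos; lra. }
  intros n. unfold dcoef. rewrite Cmod_mult, Cmod_R, Rabs_right by apply Rle_ge, pos_INR.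
  assert (Hn := pow_succ_bound (r / s) n Hq).
  assert (Hrn : 0 < (/ r) ^ n) by (apply pow_lt, Rinv_0_lt_compat; lra).
  apply Rle_trans with (INR (S n) * (M * (/ s) ^ S n)).
  { apply Rmult_le_compat_l; [apply pos_INR|apply H]. }
  replace (INR (S n) * (M * (/ s) ^ S n)) with (M * / s * ((INR (S n) * (r / s) ^ n) * (/ r) ^ n)).
  2: { unfold Rdiv. rewrite Rpow_mult_distr. simpl pow.
       assert (E : r ^ n * (/ r) ^ n = 1) by (rewrite <- Rpow_mult_distr, Rinv_r, pow1; lra).
       transitivity (M * / s * INR (S n) * (/ s) ^ n * (r ^ n * (/ r) ^ n)); [ring|]. rewrite E. ring. }
  replace (M * / s * / (1 - r / s) * (/ r) ^ n) with (M * / s * (/ (1 - r / s) * (/ r) ^ n)) by ring.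
  apply Rmult_le_compat_l; [apply Rmult_le_pos; lra|]. apply Rmult_le_compat_r; lra.
Qed.

Definition icoef (a : nat -> C) (n : nat) : C :=
  match n with O => RtoC 0 | S m => (/ INR (S m) * a m)%C end.

Lemma INR_S_neq_0 (n : nat) : RtoC (INR (S n)) <> RtoC 0.
Proof. intros E. apply RtoC_inj in E. generalize (lt_0_INR (S n) ltac:(lia)). lra. Qed.

Lemma dcoef_icoef (a : nat -> C) (n : nat) : dcoef (icoef a) n = a n.
Proof. unfold dcoef, icoef. field. apply INR_S_neq_0. Qed.

Lemma ps_disc_icoef (a : nat -> C) : ps_disc a -> ps_disc (icoef a).
Proof.
  intros Ha r Hr. destruct (Ha r Hr) as [M [HM H]]. exists M. split; [exact HM|].
  assert (H1 : 1 <= / r) by (rewrite <- Rinv_1; apply Rinv_le_contravar; lra).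
  intros [|n].
  - simpl. rewrite Cmod_0. lra.
  - unfold icoef. rewrite Cmod_mult, Cmod_inv, Cmod_R by apply INR_S_neq_0.
    rewrite Rabs_right by apply Rle_ge, pos_INR.
    assert (H2 : / INR (S n) <= 1).
    { rewrite <- Rinv_1. apply Rinv_le_contravar; [lra|]. apply (le_INR 1). lia. }
    assert (H3 : 0 < / INR (S n)) by (apply Rinv_0_lt_compat, lt_0_INR; lia).
    assert (H4 : 0 <= (/ r) ^ n) by (apply pow_le; lra).
    specialize (H n). assert (H5 := Cmod_ge_0 (a n)).
    apply Rle_trans with (1 * (M * (/ r) ^ n)); [apply Rmult_le_compat; lra|].
    simpl. assert (0 <= M * (/ r) ^ n) by (apply Rmult_le_pos; lra). nra.
Qed.

(** With [eta] fixed so that [|z| + eta < 1], [pow_second_order] bounds the remainder of each term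
    by [|h|^2] times the term of a convergent series. Summation gives the bound [K |h|^2], from
    which differentiability follows. *)
Lemma ps_deriv (a : nat -> C) (f g : C -> C) : ps_disc a -> has_ps a f -> has_ps (dcoef a) g ->
  forall z, inD z -> cd f z (g z).
Proof.
  intros Ha Hf Hg z Hz. unfold inD in Hz. assert (Hz0 := Cmod_ge_0 z).
  set (eta := (1 - Cmod z) / 2). set (R1 := Cmod z + eta).
  assert (He : 0 < eta) by (unfold eta; lra).
  assert (HR1 : 0 <= R1 < 1) by (unfold R1, eta; lra).
  destruct (ps_term_bound a R1 Ha HR1) as (M & q & HM & Hq & HMq).
  set (K := M / (1 - q) / (eta * eta)).
  assert (HK : forall h, Cmod h <= eta -> Cmod (f (z + h) - f z - g z * h)%C <= K * (Cmod h * Cmod h)).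
  { intros h Hh.
    assert (Hzh : inD (z + h)).
    { unfold inD. eapply Rle_lt_trans; [apply Cmod_triangle|]. unfold R1 in HR1. lra. }
    assert (L : clim (fun N => csum (S N) (fun n => a n * ((z + h) ^ n - z ^ n - INR n * h * z ^ pred n))%C)
                  (f (z + h) + (- (1)) * f z + (- h) * g z)%C).
    (* The derived series is cut at [N] and the other two at [S N], because differentiation lowers
       the degree by one. *)
    { apply (clim_ext (fun N => csum (S N) (fun n => a n * (z + h) ^ n)%C + (- (1)) * csum (S N) (fun n => a n * z ^ n)%C
         + (- h) * csum N (fun n => dcoef a n * z ^ n)%C)%C _ _ 0).
      - intros N _.
        assert (E : csum N (fun n => dcoef a n * z ^ n)%C = csum (S N) (fun n => a n * (INR n * z ^ pred n))%C).
        { rewrite csum_S. simpl (INR 0). rewrite (csum_ext N (fun n => dcoef a n * z ^ n)%C (fun i => a (S i) * (INR (S i) * z ^ pred (S i)))%C).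
          - ring.
          - intros i _. unfold dcoef. simpl pred. ring. }
        rewrite E, <- !csum_scal, <- !csum_plus. apply csum_ext. intros i _. ring.
      - apply clim_plus; [apply clim_plus|].
        + apply clim_shift with (u := psum a (z + h)%C). apply Hf, Hzh.
        + apply clim_scal. apply clim_shift with (u := psum a z). apply Hf, Hz.
        + apply clim_scal, Hg, Hz. }
    replace (f (z + h) - f z - g z * h)%C with ((f (z + h) + (- (1)) * f z + (- h) * g z) - 0)%C by ring.
    apply (clim_bound _ _ _ _ 0 L). intros N _.
    set (F := fun n => (a n * ((z + h) ^ n - z ^ n - INR n * h * z ^ pred n))%C).
    assert (HF : forall i, Cmod (F i) <= (Cmod h / eta) ^ 2 * M * q ^ i).
    { intros i. unfold F. rewrite Cmod_mult.
      apply Rle_trans with (Cmod (a i) * ((Cmod h / eta) ^ 2 * R1 ^ i)).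
      - apply Rmult_le_compat_l; [apply Cmod_ge_0|]. apply pow_second_order; assumption.
      - specialize (HMq i). assert (0 <= (Cmod h / eta) ^ 2) by apply pow2_ge_0. nra. }
    assert (B := csum_geom_bound 0 (S N) F ((Cmod h / eta) ^ 2 * M) q Hq
       ltac:(apply Rmult_le_pos; [apply pow2_ge_0|exact HM]) HF).
    simpl csum in B at 2. eapply Rle_trans; [exact B|]. apply Req_le. unfold K. simpl. field. lra. }
  assert (HK0 : 0 <= K).
  { unfold K. apply Rmult_le_pos; [apply Rmult_le_pos; [exact HM|]|]; left; apply Rinv_0_lt_compat; nra. }
  intros eps Heps. exists (Rmin eta (eps / (K + 1))).
  assert (Hd : 0 < eps / (K + 1)) by (apply Rdiv_lt_0_compat; lra).
  split; [apply Rmin_pos; lra|]. intros h Hh.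
  assert (H1 := Rlt_min_l _ _ _ Hh).
  assert (H2 := Rlt_min_r _ _ _ Hh).
  eapply Rle_trans; [apply HK; lra|]. assert (H0 := Cmod_ge_0 h).
  assert (H3 : K * Cmod h <= eps).
  { apply Rle_trans with (K * (eps / (K + 1))); [apply Rmult_le_compat_l; lra|].
    apply Rmult_frac_le; lra. }
  nra.
Qed.

Lemma ps_disc_tc (f : C -> C) : analytic_D f -> ps_disc (tc f).
Proof.
  intros Hf r Hr. destruct (analytic_bounded f r Hf ltac:(lra)) as [M [HM0 HM]].
  exists M. split; [exact HM0|]. intros n. rewrite pow_inv. apply tc_bound; assumption.
Qed.

Lemma has_ps_tc (f : C -> C) : analytic_D f -> has_ps (tc f) f.
Proof.
  intros Hf z Hz. unfold inD in Hz. assert (Hz0 := Cmod_ge_0 z).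
  set (r := (1 + Cmod z) / 2). assert (Hr : Cmod z < r < 1) by (unfold r; lra).
  destruct (analytic_bounded f r Hf ltac:(lra)) as [M [HM0 HM]].
  intros eps Heps.
  set (B := 2 * M * (r / (r - Cmod z))).
  assert (HB : 0 <= B).
  { unfold B. apply Rmult_le_pos; [lra|]. apply Rmult_le_pos; [lra|]. left. apply Rinv_0_lt_compat. lra. }
  destruct (pow_lt_1_zero (Cmod z / r)) with (y := eps / (B + 1)) as [N HN].
  - assert (H1 := Rdiv_in_0_1 (Cmod z) r ltac:(lra)). rewrite Rabs_right; lra.
  - apply Rdiv_lt_0_compat; lra.
  - exists N. intros n Hn. specialize (HN n Hn). rewrite Cmod_minus_sym.
    eapply Rle_trans; [apply (taylor_remainder f r M z n Hf ltac:(lra) HM); lra|].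
    apply Rabs_def2 in HN. destruct HN as [HN _].
    replace (2 * M * (Cmod z / r) ^ n * (r / (r - Cmod z))) with (B * (Cmod z / r) ^ n) by (unfold B; ring).
    apply Rle_trans with (B * (eps / (B + 1))); [apply Rmult_le_compat_l; lra|].
    apply Rmult_frac_le; lra.
Qed.

(** * Derivatives, primitives and the integration operator on the disc *)

Lemma inD_open (z : C) : inD z -> exists d, 0 < d /\ forall y, Cmod (y - z) < d -> inD y.
Proof.
  intros Hz. unfold inD in *. exists (1 - Cmod z). split; [lra|]. intros y Hy.
  generalize (Cmod_triangle_rev y z). lra.
Qed.

Lemma cd_ext_D (f g : C -> C) (z l : C) :
  (forall y, inD y -> f y = g y) -> inD z -> cd f z l -> cd g z l.
Proof.
  intros H Hz Hf. destruct (inD_open z Hz) as [d [Hd Hy]].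
  apply (cd_ext_loc f g z l d Hd); auto.
Qed.

Lemma cder_ext_D (f g : C -> C) : analytic_D f ->
  (forall y, inD y -> f y = g y) -> forall z, inD z -> cder f z = cder g z.
Proof.
  intros Hf H z Hz. symmetry. apply cd_cder. apply (cd_ext_D f g); auto. apply analytic_cd; auto.
Qed.

Lemma analytic_ext (f g : C -> C) : (forall y, inD y -> f y = g y) -> analytic_D f -> analytic_D g.
Proof.
  intros H Hf. apply (cd_analytic g (cder f)). intros z Hz. apply (cd_ext_D f g); auto. apply analytic_cd; auto.
Qed.

Lemma cder_has_ps (f : C -> C) : analytic_D f -> has_ps (dcoef (tc f)) (cder f).
Proof.
  intros Hf. destruct (ps_exists (dcoef (tc f)) (ps_disc_dcoef _ (ps_disc_tc f Hf))) as [g Hg].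
  intros z Hz.
  rewrite (cd_cder f z (g z)); [apply Hg, Hz|].
  apply (ps_deriv (tc f)); auto; [apply ps_disc_tc|apply has_ps_tc]; assumption.
Qed.

(** The derivative is again the sum of a power series, and such sums are differentiable. *)
Theorem analytic_cder (f : C -> C) : analytic_D f -> analytic_D (cder f).
Proof.
  intros Hf.
  assert (H1 := ps_disc_dcoef _ (ps_disc_tc f Hf)).
  destruct (ps_exists _ (ps_disc_dcoef _ H1)) as [g Hg].
  apply (cd_analytic _ g). apply (ps_deriv (dcoef (tc f))); auto. apply cder_has_ps, Hf.
Qed.

(** The Taylor series is integrated term by term; the fundamental theorem of calculus on segments
    then evaluates [Iop]. *)
Theorem analytic_primitive (f : C -> C) : analytic_D f ->
  exists F, forall z, inD z -> cd F z (f z).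
Proof.
  intros Hf. assert (H1 := ps_disc_icoef _ (ps_disc_tc f Hf)).
  destruct (ps_exists _ H1) as [F HF]. exists F.
  apply (ps_deriv (icoef (tc f))); auto.
  intros z Hz. apply (clim_ext (psum (tc f) z) _ _ 0).
  - intros N _. apply csum_ext. intros i _. rewrite dcoef_icoef. reflexivity.
  - apply has_ps_tc; auto.
Qed.

(** The origin suffices: [cauchy_weighted] reaches the other points by an affine change of
    variable. *)
Lemma cauchy_estimate_0 (f : C -> C) (r M : R) : analytic_D f -> 0 < r < 1 ->
  (forall w, Cmod w <= r -> Cmod (f w) <= M) -> Cmod (cder f 0%C) <= M / r.
Proof.
  intros Hf Hr HM.
  assert (H0 : inD 0%C) by (unfold inD; rewrite Cmod_0; lra).
  rewrite (clim_unique _ _ (dcoef (tc f) 0) (cder_has_ps f Hf 0%C H0)).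
  - unfold dcoef. simpl. rewrite Cmod_mult, Cmod_R, Rabs_R1, Rmult_1_l.
    rewrite <- (pow_1 r). apply tc_bound; auto.
  - apply (clim_const_eventually _ _ 1). intros n Hn.
    unfold psum. rewrite (csum_single n 0); [|lia|].
    + simpl. ring.
    + intros i _ Hi. destruct i as [|i]; [lia|]. rewrite Cpow_S. ring.
Qed.

Lemma inD_segment (t : R) (z : C) : 0 <= t <= 1 -> inD z -> inD (t * z)%C.
Proof.
  intros Ht Hz. unfold inD in *. rewrite Cmod_mult, Cmod_R, Rabs_right by lra.
  generalize (Cmod_ge_0 z). nra.
Qed.

Lemma Iop_ftc (F f : C -> C) (z : C) :
  (forall w, inD w -> cd F w (f w)) -> analytic_D f -> inD z -> Iop f z = (F z - F 0)%C.
Proof.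
  intros HF Hf Hz.
  change (CI (fun t => f (t * z) * z)%C 0 1 = (F z - F 0)%C).
  rewrite (CI_ftc (fun t => F (0 + t * z))%C (fun t => f (t * z) * z)%C); [|lra| |].
  - f_equal; [|f_equal]; f_equal; ring.
  - intros t Ht. apply cd_rd. replace (0 + t * z)%C with (t * z)%C by ring.
    apply HF, inD_segment; auto.
  - intros t Ht. apply (cont_R_mult (fun t => f (t * z)%C) (fun _ => z)); [|apply cont_R_const].
    assert (H : rd (fun x => f (0 + x * z)%C) t (cder f (0 + t * z) * z)%C).
    { apply cd_rd. apply analytic_cd; auto. replace (0 + t * z)%C with (t * z)%C by ring. apply inD_segment; auto. }
    apply rd_cont in H. intros e He. destruct (H e He) as [d [Hd H']]. exists d. split; [exact Hd|].
    intros y Hy. specialize (H' y Hy). rewrite !Cplus_0_l in H'. exact H'.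
Qed.

Theorem Iop_cd (f : C -> C) (z : C) : analytic_D f -> inD z -> cd (Iop f) z (f z).
Proof.
  intros Hf Hz. destruct (analytic_primitive f Hf) as [F HF].
  apply (cd_ext_D (fun w => F w - F 0)%C (Iop f)); auto.
  - intros w Hw. symmetry. apply Iop_ftc; auto.
  - generalize (cd_minus _ _ _ _ _ (HF z Hz) (cd_const (F 0%C) z)).
    replace (f z - 0)%C with (f z) by ring. auto.
Qed.

Lemma Iop_analytic (f : C -> C) : analytic_D f -> analytic_D (Iop f).
Proof. intros Hf. apply (cd_analytic _ f). intros z Hz. apply Iop_cd; auto. Qed.

Lemma Iop_0 (f : C -> C) : analytic_D f -> Iop f 0%C = 0%C.
Proof.
  intros Hf. destruct (analytic_primitive f Hf) as [F HF].
  rewrite (Iop_ftc F f); auto; [ring|]. unfold inD. rewrite Cmod_0. lra.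
Qed.

(** * Weighted growth and Bloch norms *)


Lemma cder_n_S (k : nat) (f : C -> C) : cder_n (S k) f = cder (cder_n k f).
Proof. reflexivity. Qed.

Lemma cder_n_cder (k : nat) (f : C -> C) : cder_n k (cder f) = cder_n (S k) f.
Proof. unfold cder_n. induction k; simpl in *; [reflexivity|]. rewrite IHk. reflexivity. Qed.

Lemma analytic_cder_n (k : nat) (f : C -> C) : analytic_D f -> analytic_D (cder_n k f).
Proof. intros Hf. induction k; [exact Hf|]. rewrite cder_n_S. apply analytic_cder, IHk. Qed.

Lemma cder_n_ext_D (k : nat) (f g : C -> C) : analytic_D f ->
  (forall z, inD z -> f z = g z) -> forall z, inD z -> cder_n k f z = cder_n k g z.
Proof.
  intros Hf H. induction k; [exact H|]. intros z Hz. rewrite !cder_n_S.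
  apply cder_ext_D; auto. apply analytic_cder_n, Hf.
Qed.

Lemma analytic_plus (f g : C -> C) : analytic_D f -> analytic_D g -> analytic_D (fun z => f z + g z)%C.
Proof.
  intros Hf Hg. apply (cd_analytic _ (fun z => cder f z + cder g z)%C).
  intros z Hz. apply cd_plus; apply analytic_cd; auto.
Qed.

Lemma analytic_minus (f g : C -> C) : analytic_D f -> analytic_D g -> analytic_D (fun z => f z - g z)%C.
Proof.
  intros Hf Hg. apply (cd_analytic _ (fun z => cder f z - cder g z)%C).
  intros z Hz. apply cd_minus; apply analytic_cd; auto.
Qed.

Lemma analytic_mult (f g : C -> C) : analytic_D f -> analytic_D g -> analytic_D (fun z => f z * g z)%C.
Proof.
  intros Hf Hg. apply (cd_analytic _ (fun z => cder f z * g z + f z * cder g z)%C).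
  intros z Hz. apply cd_mult; apply analytic_cd; auto.
Qed.

Lemma analytic_const (c : C) : analytic_D (fun _ => c).
Proof. apply (cd_analytic _ (fun _ => RtoC 0)). intros. apply cd_const. Qed.

Lemma cder_plus (f g : C -> C) (z : C) : analytic_D f -> analytic_D g -> inD z ->
  cder (fun z => f z + g z)%C z = (cder f z + cder g z)%C.
Proof. intros Hf Hg Hz. apply cd_cder, cd_plus; apply analytic_cd; auto. Qed.

Lemma cder_minus (f g : C -> C) (z : C) : analytic_D f -> analytic_D g -> inD z ->
  cder (fun z => f z - g z)%C z = (cder f z - cder g z)%C.
Proof. intros Hf Hg Hz. apply cd_cder, cd_minus; apply analytic_cd; auto. Qed.

Lemma cder_mult (f g : C -> C) (z : C) : analytic_D f -> analytic_D g -> inD z ->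
  cder (fun z => f z * g z)%C z = (cder f z * g z + f z * cder g z)%C.
Proof. intros Hf Hg Hz. apply cd_cder, cd_mult; apply analytic_cd; auto. Qed.

Lemma cder_n_plus (k : nat) (f g : C -> C) : analytic_D f -> analytic_D g -> forall z, inD z ->
  cder_n k (fun z => f z + g z)%C z = (cder_n k f z + cder_n k g z)%C.
Proof.
  intros Hf Hg. induction k; [reflexivity|]. intros z Hz. rewrite !cder_n_S.
  rewrite <- cder_plus by (auto using analytic_cder_n).
  apply cder_ext_D; auto. apply analytic_cder_n, analytic_plus; auto.
Qed.

Lemma cder_n_minus (k : nat) (f g : C -> C) : analytic_D f -> analytic_D g -> forall z, inD z ->
  cder_n k (fun z => f z - g z)%C z = (cder_n k f z - cder_n k g z)%C.
Proof.
  intros Hf Hg. induction k; [reflexivity|]. intros z Hz. rewrite !cder_n_S.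
  rewrite <- cder_minus by (auto using analytic_cder_n).
  apply cder_ext_D; auto. apply analytic_cder_n, analytic_minus; auto.
Qed.

Lemma inD_0 : inD 0%C.
Proof. unfold inD. rewrite Cmod_0. lra. Qed.

Lemma Iop_n_analytic (N : nat) (F : C -> C) : analytic_D F -> analytic_D (Iop_n N F).
Proof. intros HF. induction N; [exact HF|]. apply Iop_analytic, IHN. Qed.

Lemma cder_n_Iop_n (j N : nat) (F : C -> C) : analytic_D F -> forall z, inD z ->
  cder_n j (Iop_n (j + N) F) z = Iop_n N F z.
Proof.
  intros HF. induction j; intros z Hz; [reflexivity|].
  rewrite <- cder_n_cder. rewrite <- IHj by exact Hz.
  apply cder_n_ext_D; auto.
  - apply analytic_cder. apply (Iop_n_analytic (S j + N)), HF.
  - intros w Hw. apply cd_cder. apply (Iop_cd (Iop_n (j + N) F)); auto.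
    apply Iop_n_analytic, HF.
Qed.

Lemma cder_n_Iop_n_0 (j N : nat) (F : C -> C) : analytic_D F -> (j < N)%nat ->
  cder_n j (Iop_n N F) 0%C = 0%C.
Proof.
  intros HF Hj. replace N with (j + S (N - S j))%nat by lia.
  rewrite cder_n_Iop_n by (auto using inD_0).
  apply (Iop_0 (Iop_n (N - S j) F)). apply Iop_n_analytic, HF.
Qed.

(** The distance to the circle stands in for the Bloch weight [1 - |z|^2]: the two differ by a
    factor between 1 and 2, and powers of [1 - t |z|] have explicit primitives along radii. *)
Definition wt (s : R) (z : C) : R := Rpower (1 - Cmod z) s.

Lemma wt_pos (s : R) (z : C) : 0 < wt s z.
Proof. apply exp_pos. Qed.

Lemma wt_plus (s t : R) (z : C) : wt (s + t) z = wt s z * wt t z.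
Proof. apply Rpower_plus. Qed.

Lemma wt_1 (z : C) : inD z -> wt 1 z = 1 - Cmod z.
Proof. intros Hz. apply Rpower_1. unfold inD in Hz. lra. Qed.

Lemma wt_0 (z : C) : inD z -> wt 0 z = 1.
Proof. intros Hz. apply Rpower_O. unfold inD in Hz. lra. Qed.

(** Exponents such as [beta - alpha + t] may have either sign, hence [Rabs s]. *)
Lemma Rpower_comparable (x y s : R) : 0 < x -> 0 < y -> x <= 2 * y -> y <= 2 * x ->
  Rpower x s <= Rpower 2 (Rabs s) * Rpower y s.
Proof.
  intros Hx Hy H1 H2. unfold Rpower. rewrite <- exp_plus.
  assert (L1 : ln x <= ln 2 + ln y).
  { rewrite <- ln_mult by lra. apply Rcomplements.ln_le; lra. }
  assert (L2 : ln y <= ln 2 + ln x).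
  { rewrite <- ln_mult by lra. apply Rcomplements.ln_le; lra. }
  assert (L : Rabs (ln x - ln y) <= ln 2) by (apply Rabs_le; lra).
  assert (K : s * (ln x - ln y) <= Rabs s * ln 2).
  { eapply Rle_trans; [apply Rle_abs|]. rewrite Rabs_mult.
    apply Rmult_le_compat_l; [apply Rabs_pos|exact L]. }
  destruct (Rle_lt_or_eq_dec (s * ln x) (Rabs s * ln 2 + s * ln y)) as [H|H]; [lra| |].
  - left. apply exp_increasing, H.
  - right. rewrite H. reflexivity.
Qed.

Lemma wt_comparable (s : R) (z w : C) : inD w -> Cmod (z - w) <= (1 - Cmod w) / 2 ->
  inD z /\ wt s w <= Rpower 2 (Rabs s) * wt s z.
Proof.
  intros Hw Hz. unfold inD in *.
  assert (H1 := Cmod_triangle_rev z w). assert (H2 := Cmod_triangle_rev w z).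
  rewrite (Cmod_minus_sym w z) in H2.
  split; [lra|]. apply Rpower_comparable; lra.
Qed.

(* Cauchy's estimate on the disc of centre [w] and half the distance of [w] to the circle. *)
Lemma cauchy_weighted (s : R) : exists K, 0 < K /\ forall (f : C -> C) (w : C) (B : R),
  analytic_D f -> inD w ->
  (forall z, Cmod (z - w) <= (1 - Cmod w) / 2 -> wt s z * Cmod (f z) <= B) ->
  wt (s + 1) w * Cmod (cder f w) <= K * B.
Proof.
  exists (2 * Rpower 2 (Rabs s)). split; [apply Rmult_lt_0_compat; [lra|apply exp_pos]|].
  intros f w B Hf Hw HB.
  set (d := 1 - Cmod w). assert (Hd : 0 < d) by (unfold d, inD in *; lra).
  assert (Hin : forall x, inD x -> inD (w + d * x)).
  { intros x Hx. unfold inD in *. eapply Rle_lt_trans; [apply Cmod_triangle|].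
    rewrite Cmod_mult, Cmod_R, Rabs_right by lra. unfold d in *. nra. }
  set (h := fun x => f (w + d * x)%C).
  assert (Hh : forall x, inD x -> cd h x (cder f (w + d * x) * d)%C).
  { intros x Hx. apply (cd_comp f (fun x => w + d * x)%C).
    - apply analytic_cd; auto.
    - generalize (cd_plus _ _ _ _ _ (cd_const w x) (cd_scal _ d _ _ (cd_id x))).
      replace (0 + d * 1)%C with (RtoC d) by ring. auto. }
  assert (Ha : analytic_D h) by (apply (cd_analytic h _ Hh)).
  assert (H0 := cauchy_estimate_0 h (/ 2) (Rpower 2 (Rabs s) * B * / wt s w) Ha ltac:(lra)).
  rewrite (cd_cder _ _ _ (Hh _ inD_0)) in H0.
  replace (w + d * 0)%C with w in H0 by ring.
  rewrite Cmod_mult, Cmod_R, (Rabs_right d) in H0 by lra.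
  assert (Hws := wt_pos s w).
  rewrite wt_plus, wt_1 by exact Hw. fold d.
  apply Rle_trans with (wt s w * (Rpower 2 (Rabs s) * B * / wt s w / / 2)).
  - replace (wt s w * d * Cmod (cder f w)) with (wt s w * (Cmod (cder f w) * d)) by ring.
    apply Rmult_le_compat_l; [lra|]. apply H0.
    intros x Hx. unfold h. set (z := (w + d * x)%C).
    assert (Hz : Cmod (z - w) <= (1 - Cmod w) / 2).
    { unfold z. replace (w + d * x - w)%C with (d * x)%C by ring.
      rewrite Cmod_mult, Cmod_R, Rabs_right by lra. fold d. nra. }
    destruct (wt_comparable s z w Hw Hz) as [Hz1 Hz2].
    specialize (HB z Hz). assert (Hz3 := wt_pos s z). assert (Hz4 := Cmod_ge_0 (f z)).
    apply Rmult_le_reg_r with (wt s w); [exact Hws|].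
    rewrite Rmult_assoc, Rinv_l, Rmult_1_r by lra.
    assert (0 < Rpower 2 (Rabs s)) by apply exp_pos.
    apply Rle_trans with (Cmod (f z) * (Rpower 2 (Rabs s) * wt s z)).
    + apply Rmult_le_compat_l; lra.
    + replace (Cmod (f z) * (Rpower 2 (Rabs s) * wt s z)) with (Rpower 2 (Rabs s) * (wt s z * Cmod (f z))) by ring.
      apply Rmult_le_compat_l; lra.
  - apply Req_le. field. lra.
Qed.

Lemma growth_integral (s : R) (h : C -> C) (B : R) : 0 < s -> 0 <= B -> analytic_D h -> h 0%C = 0%C ->
  (forall z, inD z -> wt (s + 1) z * Cmod (cder h z) <= B) ->
  forall z, inD z -> wt s z * Cmod (h z) <= B / s.
Proof.
  intros Hs HB Hh H0 HC z Hz.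
  assert (Hz0 := Cmod_ge_0 z). set (m := Cmod z) in *.
  assert (Hm : m < 1) by exact Hz.
  set (G := fun t => B / s * Rpower (1 - t * m) (- s)).
  set (g := fun t => B * m * Rpower (1 - t * m) (- s - 1)).
  assert (Ht : forall t, 0 <= t <= 1 -> 0 < 1 - t * m) by (intros t Ht; nra).
  assert (HD : forall c e t, 0 <= t <= 1 ->
    is_derive (fun t => c * Rpower (1 - t * m) e) t (c * (e * Rpower (1 - t * m) (e - 1) * - m))).
  { intros c e t Ht1. apply is_derive_Reals. apply (derivable_pt_lim_scal (fun t => Rpower (1 - t * m) e)).
    apply (derivable_pt_lim_comp (fun t => 1 - t * m) (fun x => Rpower x e)).
    - apply is_derive_Reals. auto_derive; auto. ring.
    - apply derivable_pt_lim_power. auto. }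
  assert (HG : forall t, 0 <= t <= 1 -> is_derive G t (g t)).
  { intros t Ht1. unfold g.
    replace (B * m * Rpower (1 - t * m) (- s - 1)) with (B / s * (- s * Rpower (1 - t * m) (- s - 1) * - m))
      by (field; lra).
    apply HD, Ht1. }
  assert (Hg : forall t, 0 <= t <= 1 -> continuous g t).
  { intros t Ht1. apply (ex_derive_continuous (V := R_NormedModule) g t). eexists. apply HD, Ht1. }
  assert (Hint : is_RInt g 0 1 (G 1 - G 0)).
  { apply (is_RInt_derive (V := R_CompleteNormedModule) G g 0 1); intros t Ht1;
      rewrite Rmin_left, Rmax_right in Ht1 by lra; auto. }
  assert (Hac := analytic_cder h Hh).
  assert (Hc : forall t, 0 <= t <= 1 -> cont_R (fun t => cder h (0 + t * z) * z)%C t).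
  { intros t Ht1. apply (cont_R_mult (fun t => cder h (0 + t * z)%C) (fun _ => z)); [|apply cont_R_const].
    eapply rd_cont. apply cd_rd. apply analytic_cd; auto.
    rewrite Cplus_0_l. apply inD_segment; auto. }
  assert (Hhz : h z = CI (fun t => cder h (0 + t * z) * z)%C 0 1).
  { rewrite (CI_ftc (fun t => h (0 + t * z)%C)); [|lra| |exact Hc].
    - replace (0 + 1 * z)%C with z by ring. replace (0 + 0 * z)%C with (RtoC 0) by ring. rewrite H0. ring.
    - intros t Ht1. apply cd_rd, analytic_cd; auto. rewrite Cplus_0_l. apply inD_segment; auto. }
  assert (Hle : Cmod (h z) <= G 1 - G 0).
  { rewrite Hhz, Cmod_norm.
    apply (norm_RInt_le (V := C_R_NormedModule) (fun t => cder h (0 + t * z) * z)%C g 0 1); [lra| | |exact Hint].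
    - intros t Ht1. rewrite <- Cmod_norm, Cmod_mult, Cplus_0_l. fold m.
      assert (Hin := inD_segment t z Ht1 Hz). specialize (HC _ Hin).
      unfold wt in HC. rewrite Cmod_mult, Cmod_R, Rabs_right in HC by lra. fold m in HC.
      unfold g. replace (- s - 1) with (- (s + 1)) by ring. rewrite Rpower_Ropp.
      assert (Hp : 0 < Rpower (1 - t * m) (s + 1)) by apply exp_pos.
      replace (B * m * / Rpower (1 - t * m) (s + 1)) with (B * / Rpower (1 - t * m) (s + 1) * m) by ring.
      apply Rmult_le_compat_r; [lra|].
      apply Rmult_le_reg_l with (Rpower (1 - t * m) (s + 1)); [exact Hp|].
      replace (Rpower (1 - t * m) (s + 1) * (B * / Rpower (1 - t * m) (s + 1))) with B by (field; lra).
      exact HC.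
    - apply (RInt_correct (V := CRV)). apply cont_R_ex_RInt_in; [lra|exact Hc]. }
  assert (HG0 : 0 <= G 0).
  { unfold G. apply Rmult_le_pos; [|left; apply exp_pos].
    apply Rmult_le_pos; [exact HB|left; apply Rinv_0_lt_compat; exact Hs]. }
  apply Rle_trans with (wt s z * G 1).
  - apply Rmult_le_compat_l; [left; apply wt_pos|lra].
  - unfold G, wt. fold m. rewrite Rmult_1_l, Rpower_Ropp. apply Req_le. field.
    split; [lra|]. apply Rgt_not_eq, exp_pos.
Qed.

Lemma Rpower_sq_comparable (a : R) (z : C) : inD z ->
  wt a z <= Rpower 2 (Rabs a) * Rpower (1 - Cmod z ^ 2) a /\
  Rpower (1 - Cmod z ^ 2) a <= Rpower 2 (Rabs a) * wt a z.
Proof.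
  intros Hz. unfold inD in Hz. assert (H0 := Cmod_ge_0 z).
  split; apply Rpower_comparable; nra.
Qed.

Lemma bloch_w_wt (a : R) (f : C -> C) (z : C) : inD z ->
  wt a z * Cmod (cder f z) <= Rpower 2 (Rabs a) * bloch_w a f z /\
  bloch_w a f z <= Rpower 2 (Rabs a) * (wt a z * Cmod (cder f z)).
Proof.
  intros Hz. destruct (Rpower_sq_comparable a z Hz) as [H1 H2].
  unfold bloch_w. assert (H0 := Cmod_ge_0 (cder f z)).
  rewrite <- !Rmult_assoc. split; apply Rmult_le_compat_r; assumption.
Qed.

Lemma bloch_w_ge_0 (a : R) (f : C -> C) (z : C) : 0 <= bloch_w a f z.
Proof. apply Rmult_le_pos; [left; apply exp_pos|apply Cmod_ge_0]. Qed.

(** [real] sends an infinite supremum to 0, so the norm is meaningful only once a bound [M] makes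
    the supremum finite; the value at 0 shows that the set is not empty. *)
Lemma bloch_lub (a : R) (f : C -> C) (M : R) : (forall z, inD z -> bloch_w a f z <= M) ->
  real (Lub_Rbar (fun r => exists z, inD z /\ r = bloch_w a f z)) <= M /\
  forall z, inD z -> bloch_w a f z <= real (Lub_Rbar (fun r => exists z, inD z /\ r = bloch_w a f z)).
Proof.
  intros HM.
  set (E := fun r => exists z, inD z /\ r = bloch_w a f z).
  destruct (Lub_Rbar_correct E) as [H1 H2].
  assert (H3 : Rbar_le (Lub_Rbar E) M).
  { apply H2. intros r [z [Hz ->]]. apply HM, Hz. }
  assert (H4 : Rbar_le (bloch_w a f 0%C) (Lub_Rbar E)).
  { apply H1. exists 0%C. split; [apply inD_0|reflexivity]. }
  assert (H5 : forall z, inD z -> Rbar_le (bloch_w a f z) (Lub_Rbar E)).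
  { intros z Hz. apply H1. exists z. auto. }
  destruct (Lub_Rbar E) as [l| |]; simpl in *; try tauto.
Qed.

Lemma bloch_norm_le (a : R) (f : C -> C) (M : R) : (forall z, inD z -> bloch_w a f z <= M) ->
  bloch_norm a f <= Cmod (f 0%C) + M.
Proof. intros HM. destruct (bloch_lub a f M HM). unfold bloch_norm. lra. Qed.

Lemma bloch_w_le_norm (a : R) (f : C -> C) (z : C) : in_bloch a f -> inD z ->
  bloch_w a f z + Cmod (f 0%C) <= bloch_norm a f.
Proof.
  intros [_ [M HM]] Hz. destruct (bloch_lub a f M HM) as [_ H]. specialize (H z Hz).
  unfold bloch_norm. lra.
Qed.

Lemma bloch_norm_ge_0 (a : R) (f : C -> C) : in_bloch a f -> 0 <= bloch_norm a f.
Proof.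
  intros Hf. generalize (bloch_w_le_norm a f 0%C Hf inD_0) (bloch_w_ge_0 a f 0%C) (Cmod_ge_0 (f 0%C)). lra.
Qed.

Lemma wt_le_bloch_norm (a : R) (f : C -> C) (z : C) : in_bloch a f -> inD z ->
  wt a z * Cmod (cder f z) <= Rpower 2 (Rabs a) * bloch_norm a f.
Proof.
  intros Hf Hz. destruct (bloch_w_wt a f z Hz) as [H _]. eapply Rle_trans; [exact H|].
  apply Rmult_le_compat_l; [left; apply exp_pos|].
  generalize (bloch_w_le_norm a f z Hf Hz) (Cmod_ge_0 (f 0%C)). lra.
Qed.

Lemma in_bloch_wt (a : R) (f : C -> C) (B : R) : analytic_D f ->
  (forall z, inD z -> wt a z * Cmod (cder f z) <= B) ->
  in_bloch a f /\ bloch_norm a f <= Cmod (f 0%C) + Rpower 2 (Rabs a) * B.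
Proof.
  intros Hf HB.
  assert (H : forall z, inD z -> bloch_w a f z <= Rpower 2 (Rabs a) * B).
  { intros z Hz. destruct (bloch_w_wt a f z Hz) as [_ H]. eapply Rle_trans; [exact H|].
    apply Rmult_le_compat_l; [left; apply exp_pos|auto]. }
  split; [split; [exact Hf|exists (Rpower 2 (Rabs a) * B); exact H]|apply bloch_norm_le, H].
Qed.

Lemma growth_cder_n (s : R) (m : nat) : exists K, 0 < K /\ forall (f : C -> C) (B : R),
  analytic_D f -> (forall z, inD z -> wt s z * Cmod (f z) <= B) ->
  forall z, inD z -> wt (s + INR m) z * Cmod (cder_n m f z) <= K * B.
Proof.
  induction m as [|m [K [HK IH]]].
  - exists 1. split; [lra|]. intros f B Hf HB z Hz. simpl. rewrite Rplus_0_r, Rmult_1_l. auto.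
  - destruct (cauchy_weighted (s + INR m)) as [K' [HK' H]].
    exists (K' * K). split; [apply Rmult_lt_0_compat; auto|].
    intros f B Hf HB z Hz. rewrite S_INR, cder_n_S, <- Rplus_assoc, Rmult_assoc.
    apply H; auto; [apply analytic_cder_n, Hf|].
    intros w Hw. apply IH; auto. apply (wt_comparable s w z Hz Hw).
Qed.

(** Converse of [growth_cder_n]: the zeros at 0 permit integration from the origin, and every
    intermediate exponent [s + INR m] is positive. *)
Lemma growth_primitive_n (s : R) (m : nat) : 0 < s -> exists K, 0 < K /\ forall (u : C -> C) (B : R),
  0 <= B -> analytic_D u -> (forall j, (j < m)%nat -> cder_n j u 0%C = 0%C) ->
  (forall z, inD z -> wt (s + INR m) z * Cmod (cder_n m u z) <= B) ->
  forall z, inD z -> wt s z * Cmod (u z) <= K * B.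
Proof.
  intros Hs. induction m as [|m [K [HK IH]]].
  - exists 1. split; [lra|]. intros u B _ _ _ HB z Hz. specialize (HB z Hz). simpl in HB.
    rewrite Rplus_0_r in HB. lra.
  - assert (Hm : 0 < s + INR m) by (generalize (pos_INR m); lra).
    exists (K * / (s + INR m)). split; [apply Rmult_lt_0_compat; [exact HK|apply Rinv_0_lt_compat, Hm]|].
    intros u B HB0 Hu Hj HB z Hz.
    replace (K * / (s + INR m) * B) with (K * (B / (s + INR m))) by (unfold Rdiv; ring).
    apply IH; auto.
    + apply Rmult_le_pos; [exact HB0|]. left. apply Rinv_0_lt_compat, Hm.
    + apply growth_integral; auto.
      * apply analytic_cder_n, Hu.
      * intros w Hw. specialize (HB w Hw). rewrite S_INR, <- Rplus_assoc, cder_n_S in HB. exact HB.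
Qed.

(** * Montel's theorem *)


Section Diagonal.

Variable a : nat -> nat -> C.
Hypothesis Ha : forall n, exists B, 0 < B /\ forall m, Cmod (a m n) <= B.

(* [p 0, ..., p (N - 1)] is a cluster point of the first [N] columns. *)
Definition cluster (N : nat) (p : nat -> C) : Prop :=
  forall eps M, 0 < eps -> exists m, (M <= m)%nat /\ forall n, (n < N)%nat -> Cmod (a m n - p n) <= eps.

Definition upd (p : nat -> C) (N : nat) (c : C) : nat -> C :=
  fun n => if Nat.eq_dec n N then c else p n.

(** If no value [c] could be added, each [c] would have a disc that column [N] eventually avoids
    along the rows close to [p]. By compactness those rows would avoid the whole disc of radius [B],
    which contains every entry of the column. *)
Lemma cluster_extend (N : nat) (p : nat -> C) : cluster N p -> exists c, cluster (S N) (upd p N c).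
Proof.
  intros Hp. apply NNPP. intros Hno.
  destruct (Ha N) as [B [HB HaB]].
  assert (Hc : forall c, exists eps M, 0 < eps /\ forall m, (M <= m)%nat ->
     (forall n, (n < N)%nat -> Cmod (a m n - p n) <= eps) -> eps < Cmod (a m N - c)).
  { intros c. apply NNPP. intros H1. apply Hno. exists c. intros eps M He.
    apply NNPP. intros H2. apply H1. exists eps, M. split; [exact He|].
    intros m Hm Hn. apply Rnot_le_lt. intros H3. apply H2. exists m. split; [exact Hm|].
    intros n Hn1. unfold upd. destruct (Nat.eq_dec n N) as [->|Hd]; [exact H3|apply Hn; lia]. }
  assert (HQ : exists eps M, 0 < eps /\ forall m, (M <= m)%nat ->
     (forall n, (n < N)%nat -> Cmod (a m n - p n) <= eps) -> ~ Cmod (a m N) <= B).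
  { apply (disc_compact B (fun S => exists eps M, 0 < eps /\ forall m, (M <= m)%nat ->
      (forall n, (n < N)%nat -> Cmod (a m n - p n) <= eps) -> ~ S (a m N)) HB).
    - intros S T U (e1 & M1 & He1 & H1) (e2 & M2 & He2 & H2) HU.
      exists (Rmin e1 e2), (M1 + M2)%nat. split; [apply Rmin_pos; assumption|].
      assert (h1 := Rmin_l e1 e2). assert (h2 := Rmin_r e1 e2).
      intros m Hm Hn Hw. destruct (HU _ Hw) as [H|H]; [apply (H1 m)|apply (H2 m)]; auto; try lia;
        intros i Hi; specialize (Hn i Hi); lra.
    - intros c. destruct (Hc c) as (eps & M & He & H). exists eps. split; [exact He|].
      exists eps, M. split; [exact He|]. intros m Hm Hn Hlt. specialize (H m Hm Hn). lra. }
  destruct HQ as (eps & M & He & H). destruct (Hp eps M He) as (m & Hm & Hn).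
  exact (H m Hm Hn (HaB m)).
Qed.

(** Cluster values are fixed column by column, each compatible with the earlier ones, and only
    afterwards are rows selected: the row [phi k] is within [1 / (k + 1)] of the limits in the first
    [k] columns. No nested subsequences occur. *)
Lemma diagonal_subsequence : exists (phi : nat -> nat) (l : nat -> C),
  (forall m, (phi m < phi (S m))%nat) /\ forall n, clim (fun m => a (phi m) n) (l n).
Proof.
  assert (Hext : forall N p, exists c, cluster N p -> cluster (S N) (upd p N c)).
  { intros N p. destruct (classic (cluster N p)) as [H|H].
    - destruct (cluster_extend N p H) as [c Hc]. exists c. auto.
    - exists 0%C. tauto. }
  destruct (fun_choice _ (fun N => fun_choice _ (Hext N))) as [c Hc].
  pose (pp := fix pp (N : nat) : nat -> C :=
    match N with O => (fun _ => RtoC 0) | S N => upd (pp N) N (c N (pp N)) end).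
  assert (Hpp : forall N, cluster N (pp N)).
  { induction N.
    - intros eps M _. exists M. split; [lia|]. intros; lia.
    - apply Hc, IHN. }
  pose (l := fun n => pp (S n) n).
  assert (Hl : forall N n, (n < N)%nat -> pp N n = l n).
  { induction N; intros n Hn; [lia|]. destruct (Nat.eq_dec n N) as [->|Hd]; [reflexivity|].
    rewrite <- IHN by lia. simpl. unfold upd. destruct (Nat.eq_dec n N); [contradiction|reflexivity]. }
  assert (Hsel : forall k prev, exists m, (prev < m)%nat /\
     forall n, (n < k)%nat -> Cmod (a m n - l n) <= / INR (S k)).
  { intros k prev. destruct (Hpp k (/ INR (S k)) (S prev)) as (m & Hm & H).
    - apply Rinv_0_lt_compat, lt_0_INR. lia.
    - exists m. split; [lia|]. intros n Hn. rewrite <- (Hl k n Hn). auto. }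
  destruct (fun_choice _ (fun k => fun_choice _ (Hsel k))) as [sel Hsel'].
  pose (phi := fix phi (k : nat) : nat := match k with O => O | S k => sel (S k) (phi k) end).
  exists phi, l. split.
  - intros m. simpl. apply Hsel'.
  - intros n eps He. destruct (archimed_cor1 eps He) as [N [HN HN0]].
    exists (S n + N)%nat. intros m Hm. destruct m as [|m]; [lia|].
    simpl phi. destruct (Hsel' (S m) (phi m)) as [_ H]. specialize (H n ltac:(lia)).
    eapply Rle_trans; [exact H|]. eapply Rle_trans; [|left; exact HN].
    apply Rinv_le_contravar; [apply lt_0_INR; lia|apply le_INR; lia].
Qed.

End Diagonal.

(* Convergence to [0] uniformly on compact subsets of the disc. *)
Definition luc (e : nat -> C -> C) : Prop :=
  forall r eps, 0 < r < 1 -> 0 < eps -> exists m0, forall m w, (m0 <= m)%nat -> Cmod w <= r ->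
    Cmod (e m w) <= eps.

(** With exponent 0, [cauchy_weighted] puts no weight on [e] and the factor [1 - |w| >= 1 - r] on
    the derivative; the discs around points of modulus at most [r] stay within radius
    [(1 + r) / 2]. *)
Lemma luc_cder (e : nat -> C -> C) : (forall m, analytic_D (e m)) -> luc e -> luc (fun m => cder (e m)).
Proof.
  intros Ha He r eps Hr Heps. destruct (cauchy_weighted 0) as [K [HK H]].
  destruct (He ((1 + r) / 2) (eps * (1 - r) / K)) as [m0 Hm0]; [lra| |].
  { apply Rdiv_lt_0_compat; [apply Rmult_lt_0_compat; lra|exact HK]. }
  exists m0. intros m w Hm Hw.
  assert (Hw1 : inD w) by (unfold inD; lra).
  specialize (H (e m) w (eps * (1 - r) / K) (Ha m) Hw1).
  assert (H1 : wt (0 + 1) w * Cmod (cder (e m) w) <= K * (eps * (1 - r) / K)).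
  { apply H. intros z Hz. rewrite wt_0 by (apply (wt_comparable 0 z w Hw1 Hz)). rewrite Rmult_1_l.
    apply Hm0; [exact Hm|]. generalize (Cmod_triangle_rev z w). lra. }
  rewrite Rplus_0_l, wt_1 in H1 by exact Hw1.
  replace (K * (eps * (1 - r) / K)) with (eps * (1 - r)) in H1 by (field; lra).
  assert (H2 := Cmod_ge_0 (cder (e m) w)).
  apply Rmult_le_reg_r with (1 - r); [lra|]. nra.
Qed.

Lemma luc_cder_n (e : nat -> C -> C) (k : nat) : (forall m, analytic_D (e m)) -> luc e ->
  luc (fun m => cder_n k (e m)).
Proof.
  intros Ha He. induction k; [exact He|].
  apply (luc_cder (fun m => cder_n k (e m))); [|exact IHk].
  intros m. apply analytic_cder_n, Ha.
Qed.

Lemma ps_tail (b : nat -> C) (z l : C) (M q : R) (N : nat) : 0 <= q < 1 -> 0 <= M ->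
  (forall n, Cmod (b n) * Cmod z ^ n <= M * q ^ n) ->
  clim (psum b z) l ->
  Cmod (l - psum b z N) <= M * q ^ N / (1 - q).
Proof.
  intros Hq HM Hb Hl. apply (clim_bound _ _ _ _ N Hl). intros n Hn.
  replace n with (N + (n - N))%nat by lia. apply csum_geom_bound; auto.
  intros i. rewrite Cmod_mult, Cmod_pow. apply Hb.
Qed.

(** Local bounds give Taylor coefficients bounded uniformly in [m], so a diagonal subsequence makes
    all of them converge. On [|w| <= r], tails are uniformly small by geometric decay with ratio
    [r / r'], and finitely many coefficients remain; each of the three differences gets
    [eps / 3]. *)
Theorem montel (fs : nat -> C -> C) : (forall m, analytic_D (fs m)) ->
  (forall r, 0 < r < 1 -> exists M, 0 <= M /\ forall m w, Cmod w <= r -> Cmod (fs m w) <= M) ->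
  exists (phi : nat -> nat) (f : C -> C), (forall m, (phi m < phi (S m))%nat) /\ analytic_D f /\
    luc (fun m z => fs (phi m) z - f z)%C.
Proof.
  intros Ha Hb.
  pose (a := fun m n => tc (fs m) n).
  assert (Hab : forall r, 0 < r < 1 -> exists M, 0 <= M /\ forall m n, Cmod (a m n) <= M * (/ r) ^ n).
  { intros r Hr. destruct (Hb r Hr) as [M [HM H]]. exists M. split; [exact HM|].
    intros m n. rewrite pow_inv. apply tc_bound; auto. }
  destruct (diagonal_subsequence a) as (phi & l & Hphi & Hl).
  { intros n. destruct (Hab (/ 2)) as [M [HM H]]; [lra|].
    exists (M * (/ / 2) ^ n + 1). split.
    - assert (0 <= M * (/ / 2) ^ n); [|lra]. apply Rmult_le_pos; [exact HM|apply pow_le; lra].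
    - intros m. specialize (H m n). lra. }
  assert (Hlb : forall r M n, (forall m n, Cmod (a m n) <= M * (/ r) ^ n) -> Cmod (l n) <= M * (/ r) ^ n).
  { intros r M n H. replace (l n) with (l n - 0)%C by ring.
    apply (clim_bound _ _ _ _ 0 (Hl n)). intros m _.
    replace (a (phi m) n - 0)%C with (a (phi m) n) by ring. apply H. }
  assert (Hlps : ps_disc l).
  { intros r Hr. destruct (Hab r Hr) as [M [HM H]]. exists M. split; [exact HM|]. intros n. apply Hlb, H. }
  destruct (ps_exists l Hlps) as [f Hf]. destruct (ps_exists _ (ps_disc_dcoef l Hlps)) as [g Hg].
  exists phi, f. split; [exact Hphi|]. split.
  { apply (cd_analytic f g). apply (ps_deriv l); auto. }
  intros r eps Hr Heps.
  set (r' := (1 + r) / 2). assert (Hr' : r < r' < 1) by (unfold r'; lra).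
  destruct (Hab r' ltac:(lra)) as [M [HM HMa]].
  set (q := r / r').
  assert (Hq : 0 <= q < 1) by (apply Rdiv_in_0_1; lra).
  assert (Hqn : forall x n w, Cmod w <= r -> Cmod x <= M * (/ r') ^ n -> Cmod x * Cmod w ^ n <= M * q ^ n).
  { intros x n w Hw Hx. unfold q, Rdiv. rewrite Rpow_mult_distr.
    replace (M * (r ^ n * (/ r') ^ n)) with (M * (/ r') ^ n * r ^ n) by ring.
    apply Rmult_le_compat; [apply Cmod_ge_0|apply pow_le, Cmod_ge_0|exact Hx|].
    apply pow_incr. split; [apply Cmod_ge_0|exact Hw]. }
  assert (Hd0 : 0 <= M / (1 - q)) by (apply Rmult_le_pos; [exact HM|left; apply Rinv_0_lt_compat; lra]).
  assert (Hd : 0 < M / (1 - q) + 1) by lra.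
  destruct (pow_lt_1_zero q) with (y := eps / 3 / (M / (1 - q) + 1)) as [N HN].
  { rewrite Rabs_right; lra. }
  { apply Rdiv_lt_0_compat; lra. }
  specialize (HN N (Nat.le_refl N)). apply Rabs_def2 in HN. destruct HN as [HN _].
  assert (Htail : M * q ^ N / (1 - q) <= eps / 3).
  { replace (M * q ^ N / (1 - q)) with (M / (1 - q) * q ^ N) by (field; lra).
    assert (0 <= q ^ N) by (apply pow_le; lra).
    apply Rle_trans with (M / (1 - q) * (eps / 3 / (M / (1 - q) + 1))).
    - apply Rmult_le_compat_l; lra.
    - apply Rmult_frac_le; lra. }
  assert (Hfin : forall K e, 0 < e -> exists m0, forall m w, (m0 <= m)%nat -> Cmod w <= 1 ->
     Cmod (psum (a (phi m)) w K - psum l w K) <= e).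
  { induction K; intros e He.
    - exists 0%nat. intros m w _ _. unfold psum; simpl. replace (0 - 0)%C with (RtoC 0) by ring. rewrite Cmod_0. lra.
    - destruct (IHK (e / 2)) as [m1 H1]; [lra|]. destruct (Hl K (e / 2)) as [m2 H2]; [lra|].
      exists (m1 + m2)%nat. intros m w Hm Hw. specialize (H1 m w ltac:(lia) Hw). specialize (H2 m ltac:(lia)).
      unfold psum in *; simpl.
      match goal with |- Cmod ((?x + ?y) - (?u + ?v))%C <= _ =>
        replace ((x + y) - (u + v))%C with ((x - u) + (a (phi m) K - l K) * w ^ K)%C by ring end.
      eapply Rle_trans; [apply Cmod_triangle|]. rewrite Cmod_mult, Cmod_pow.
      assert (0 <= Cmod w ^ K <= 1).
      { split; [apply pow_le, Cmod_ge_0|]. rewrite <- (pow1 K). apply pow_incr.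
        split; [apply Cmod_ge_0|exact Hw]. }
      assert (H3 := Cmod_ge_0 (a (phi m) K - l K)). nra. }
  destruct (Hfin N (eps / 3)) as [m0 Hm0]; [lra|].
  exists m0. intros m w Hm Hw. specialize (Hm0 m w Hm ltac:(lra)).
  assert (Hwd : inD w) by (unfold inD; lra).
  assert (T1 := ps_tail (a (phi m)) w _ M q N Hq HM (fun n => Hqn _ n w Hw (HMa (phi m) n))
     (has_ps_tc (fs (phi m)) (Ha (phi m)) w Hwd)).
  assert (T2 := ps_tail l w _ M q N Hq HM (fun n => Hqn _ n w Hw (Hlb r' M n HMa)) (Hf w Hwd)).
  set (S1 := psum (a (phi m)) w N) in *.
  set (S2 := psum l w N) in *.
  replace (fs (phi m) w - f w)%C with ((fs (phi m) w - S1) + ((S1 - S2) + - (f w - S2)))%C by ring.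
  eapply Rle_trans; [apply Cmod_triangle|].
  eapply Rle_trans; [apply Rplus_le_compat_l, Cmod_triangle|]. rewrite Cmod_opp. lra.
Qed.

(** * Sufficient conditions for a single operator *)


Lemma IgNk_analytic (N k : nat) (g f : C -> C) : analytic_D g -> analytic_D f -> analytic_D (IgNk N k g f).
Proof.
  intros Hg Hf. apply Iop_n_analytic. apply analytic_mult; [apply analytic_cder_n, Hf|exact Hg].
Qed.

Lemma IgNk_top (N k : nat) (g f : C -> C) : analytic_D g -> analytic_D f ->
  forall z, inD z -> cder_n N (IgNk N k g f) z = (cder_n k f z * g z)%C.
Proof.
  intros Hg Hf z Hz. unfold IgNk. replace N with (N + 0)%nat at 2 by lia.
  rewrite cder_n_Iop_n; auto. apply analytic_mult; [apply analytic_cder_n, Hf|exact Hg].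
Qed.

Lemma IgNk_0 (N k : nat) (g f : C -> C) (j : nat) : analytic_D g -> analytic_D f -> (j < N)%nat ->
  cder_n j (IgNk N k g f) 0%C = 0%C.
Proof.
  intros Hg Hf Hj. apply cder_n_Iop_n_0; [|exact Hj].
  apply analytic_mult; [apply analytic_cder_n, Hf|exact Hg].
Qed.

Definition near_circle (u : C -> R) (B : R) : Prop :=
  exists r, r < 1 /\ forall z, r < Cmod z -> inD z -> u z <= B.

(* [small true u]: [u] is bounded near the circle; [small false u]: [u] tends to [0] there.
   The bounded and the compact case of the theorem differ only in this parameter. *)
Definition small (b : bool) (u : C -> R) : Prop :=
  if b then exists B, near_circle u B else forall eps, 0 < eps -> near_circle u eps.

Lemma small_true (b : bool) (u : C -> R) : small b u -> small true u.
Proof. destruct b; [auto|]. intros H. exists 1. apply H. lra. Qed.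

Lemma wt_bounded (s r : R) : r < 1 -> exists W, 0 < W /\ forall z, Cmod z <= r -> wt s z <= W.
Proof.
  intros Hr. exists (Rpower (1 - r) (- Rabs s)). split; [apply exp_pos|].
  intros z Hz. assert (Hz0 := Cmod_ge_0 z). unfold wt, Rpower.
  assert (L1 : ln (1 - r) <= ln (1 - Cmod z)) by (apply Rcomplements.ln_le; lra).
  assert (L2 : ln (1 - Cmod z) <= 0) by (rewrite <- ln_1; apply Rcomplements.ln_le; lra).
  assert (H : s * ln (1 - Cmod z) <= - Rabs s * ln (1 - r)).
  { assert (Ha := Rabs_pos s). assert (Hb := Rle_abs (- s)). rewrite Rabs_Ropp in Hb. nra. }
  destruct (Rle_lt_or_eq_dec _ _ H) as [H1|H1].
  - left. apply exp_increasing, H1.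
  - right. rewrite H1. reflexivity.
Qed.

(** Away from the circle both factors are bounded, so a bound near the circle becomes global. *)
Lemma small_bounded (s : R) (f : C -> C) : analytic_D f -> small true (fun z => wt s z * Cmod (f z)) ->
  exists B, 0 <= B /\ forall z, inD z -> wt s z * Cmod (f z) <= B.
Proof.
  intros Hf [B [r [Hr HB]]].
  (* [near_circle] allows a nonpositive [r]; the maximum with 1/2 is a genuine radius. *)
  destruct (wt_bounded s (Rmax r (/ 2))) as [W [HW HWz]]; [apply Rmax_lub_lt; lra|].
  destruct (analytic_bounded f (Rmax r (/ 2)) Hf) as [M [HM HMz]].
  { split; [apply Rlt_le_trans with (/ 2); [lra|apply Rmax_r]|apply Rmax_lub_lt; lra]. }
  exists (Rmax B 0 + W * M). assert (h1 := Rmax_l B 0). assert (h2 := Rmax_r B 0).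
  assert (h3 : 0 <= W * M) by (apply Rmult_le_pos; lra).
  split; [lra|]. intros z Hz.
  destruct (Rlt_dec r (Cmod z)) as [H|H].
  - specialize (HB z H Hz). lra.
  - assert (Cmod z <= Rmax r (/ 2)) by (eapply Rle_trans; [apply Rnot_lt_le, H|apply Rmax_l]).
    assert (wt s z * Cmod (f z) <= W * M).
    { apply Rmult_le_compat; auto; [left; apply wt_pos|apply Cmod_ge_0]. }
    lra.
Qed.

(** From order [N] down to order 1 there are [N - 1] integrations; the value at 0 vanishes as well,
    so it adds nothing to the norm. [bloch_top] is the reverse estimate. *)
Lemma bloch_from_top (b : R) (N : nat) : 0 < b -> (0 < N)%nat ->
  exists K, 0 < K /\ forall (u : C -> C) (B : R), 0 <= B -> analytic_D u ->
    (forall j, (j < N)%nat -> cder_n j u 0%C = 0%C) ->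
    (forall z, inD z -> wt (b + INR (N - 1)) z * Cmod (cder_n N u z) <= B) ->
    in_bloch b u /\ bloch_norm b u <= K * B.
Proof.
  intros Hb HN. destruct (growth_primitive_n b (N - 1) Hb) as [K [HK H]].
  exists (Rpower 2 (Rabs b) * K). split; [apply Rmult_lt_0_compat; [apply exp_pos|exact HK]|].
  intros u B HB Hu Hj Htop.
  destruct (in_bloch_wt b u (K * B) Hu) as [H1 H2].
  - apply H; auto.
    + apply analytic_cder, Hu.
    + intros j Hj1. rewrite cder_n_cder. apply Hj. lia.
    + rewrite cder_n_cder. replace (S (N - 1)) with N by lia. exact Htop.
  - split; [exact H1|].
    assert (H0 : u 0%C = 0%C) by (apply (Hj 0%nat HN)).
    rewrite H0, Cmod_0 in H2. lra.
Qed.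

Lemma bloch_top (b : R) (N : nat) : (0 < N)%nat ->
  exists K, 0 < K /\ forall (u : C -> C), in_bloch b u ->
    forall z, inD z -> wt (b + INR (N - 1)) z * Cmod (cder_n N u z) <= K * bloch_norm b u.
Proof.
  intros HN. destruct (growth_cder_n b (N - 1)) as [K [HK H]].
  exists (K * Rpower 2 (Rabs b)). split; [apply Rmult_lt_0_compat; [exact HK|apply exp_pos]|].
  intros u Hu z Hz. replace N with (S (N - 1)) at 2 by lia. rewrite <- cder_n_cder, Rmult_assoc.
  apply H; auto; [apply analytic_cder, Hu|].
  intros w Hw. apply wt_le_bloch_norm; auto.
Qed.

Section OneOperator.

Variables (alpha beta : R) (N k : nat) (g : C -> C).
Hypothesis Halpha : 0 < alpha.
Hypothesis Hbeta : 0 < beta.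
Hypothesis Hg : analytic_D g.
Hypothesis Ht : (0 < N - k)%nat /\ (N - k < N)%nat.

(** The balance is [N - 1 = (k - 1) + (N - k)]. Truncated subtraction is exact here, because [Ht]
    gives [1 <= k < N]. *)
Lemma weighted_product (x y : R) (z : C) :
  wt (beta + INR (N - 1)) z * (x * y)
  = (wt (alpha + INR (k - 1)) z * x) * (wt (beta - alpha + INR (N - k)) z * y).
Proof.
  replace (beta + INR (N - 1)) with (alpha + INR (k - 1) + (beta - alpha + INR (N - k))).
  - rewrite wt_plus. ring.
  - replace (N - 1)%nat with ((k - 1) + (N - k))%nat by lia. rewrite plus_INR. ring.
Qed.

Lemma bounded_sufficient :
  small true (fun z => wt (beta - alpha + INR (N - k)) z * Cmod (g z)) ->
  bounded_op alpha beta (IgNk N k g).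
Proof.
  intros Hs. destruct (small_bounded _ _ Hg Hs) as [B [HB HBz]].
  destruct (bloch_from_top beta N Hbeta ltac:(lia)) as [K [HK HKu]].
  destruct (bloch_top alpha k ltac:(lia)) as [K1 [HK1 H1]].
  assert (H : forall f, in_bloch alpha f -> in_bloch beta (IgNk N k g f) /\
    bloch_norm beta (IgNk N k g f) <= K * (K1 * B) * bloch_norm alpha f).
  { intros f Hf. assert (Hf0 := bloch_norm_ge_0 alpha f Hf).
    rewrite Rmult_assoc. apply HKu.
    - apply Rmult_le_pos; [apply Rmult_le_pos; lra|exact Hf0].
    - apply IgNk_analytic; [exact Hg|apply Hf].
    - intros j Hj. apply IgNk_0; auto. apply Hf.
    - intros z Hz. rewrite IgNk_top by (auto; apply Hf). rewrite Cmod_mult, weighted_product.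
      specialize (H1 f Hf z Hz). specialize (HBz z Hz).
      replace (K1 * B * bloch_norm alpha f) with (K1 * bloch_norm alpha f * B) by ring.
      apply Rmult_le_compat; auto; apply Rmult_le_pos; try apply Cmod_ge_0; left; apply wt_pos. }
  split.
  - intros f Hf. apply H, Hf.
  - exists (K * (K1 * B)). intros f Hf. apply H, Hf.
Qed.

(** Growth of [f] itself would depend on whether [alpha] is below, equal to or above 1. Weakening
    the weight on [f'] from [alpha] to [alpha + 1] avoids the distinction, and the loss is harmless
    on [|w| <= r]. *)
Lemma bloch_ball_bounded (r : R) : 0 < r < 1 -> exists M, 0 <= M /\ forall f w,
  in_bloch alpha f -> bloch_norm alpha f <= 1 -> Cmod w <= r -> Cmod (f w) <= M.
Proof.
  intros Hr. destruct (wt_bounded (- alpha) r) as [W [HW HWz]]; [lra|].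
  set (B := Rpower 2 (Rabs alpha)).
  assert (HB : 0 < B) by apply exp_pos.
  exists (1 + W * (B / alpha)).
  assert (HBa : 0 < B / alpha) by (apply Rdiv_lt_0_compat; lra).
  split; [assert (0 <= W * (B / alpha)) by (apply Rmult_le_pos; lra); lra|].
  intros f w Hf Hn Hw. assert (Hwd : inD w) by (unfold inD; lra).
  assert (Hc : forall z, inD z -> cd (fun z => f z - f 0)%C z (cder f z)).
  { intros z Hz. replace (cder f z) with (cder f z - 0)%C by ring.
    apply cd_minus; [apply analytic_cd; [apply Hf|exact Hz]|apply cd_const]. }
  assert (Hh : wt alpha w * Cmod (f w - f 0)%C <= B / alpha).
  { apply (growth_integral alpha (fun z => f z - f 0)%C B Halpha); auto.
    - lra.
    - apply (cd_analytic _ _ Hc).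
    - ring.
    - intros z Hz. rewrite (cd_cder _ _ _ (Hc z Hz)), wt_plus, wt_1 by exact Hz.
      assert (H1 := wt_le_bloch_norm alpha f z Hf Hz). fold B in H1.
      assert (H2 := Cmod_ge_0 z). unfold inD in Hz.
      assert (H3 : 0 <= wt alpha z * Cmod (cder f z)) by (apply Rmult_le_pos; [left; apply wt_pos|apply Cmod_ge_0]).
      nra. }
  assert (H0 := bloch_w_le_norm alpha f 0%C Hf inD_0). assert (H1 := bloch_w_ge_0 alpha f 0%C).
  assert (H2 : Cmod (f w - f 0)%C <= W * (B / alpha)).
  { apply Rle_trans with (wt (- alpha) w * (wt alpha w * Cmod (f w - f 0)%C)).
    - rewrite <- Rmult_assoc, <- wt_plus, Rplus_opp_l, wt_0 by exact Hwd. lra.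
    - apply Rmult_le_compat; auto; [left; apply wt_pos|].
      apply Rmult_le_pos; [left; apply wt_pos|apply Cmod_ge_0]. }
  assert (H3 := Cmod_triangle_rev (f w) (f 0%C)). lra.
Qed.

(** Montel's theorem gives the limit. The weighted bound on derivatives passes to it pointwise, so
    the limit stays in B^alpha and the differences satisfy one common bound; convergence in norm is
    not claimed. *)
Lemma bloch_ball_compact (fs : nat -> C -> C) :
  (forall m, in_bloch alpha (fs m) /\ bloch_norm alpha (fs m) <= 1) ->
  exists (phi : nat -> nat) (f : C -> C), (forall m, (phi m < phi (S m))%nat) /\ in_bloch alpha f /\
    luc (fun m z => fs (phi m) z - f z)%C /\
    exists B, 0 <= B /\ forall m z, inD z -> wt alpha z * Cmod (cder (fun z => fs (phi m) z - f z)%C z) <= B.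
Proof.
  intros Hfs.
  destruct (montel fs) as (phi & f & Hphi & Hf & Hluc).
  - intros m. apply Hfs.
  - intros r Hr. destruct (bloch_ball_bounded r Hr) as [M [HM H]]. exists M. split; [exact HM|].
    intros m w. apply H; apply Hfs.
  - set (B := Rpower 2 (Rabs alpha)). assert (HB0 : 0 < B) by apply exp_pos.
    assert (Hd : forall m z, inD z -> wt alpha z * Cmod (cder (fs m) z) <= B).
    { intros m z Hz. destruct (Hfs m) as [H1 H2].
      assert (H := wt_le_bloch_norm alpha (fs m) z H1 Hz). fold B in H. nra. }
    assert (Han : forall m, analytic_D (fun z => fs (phi m) z - f z)%C).
    { intros m. apply analytic_minus; [apply Hfs|exact Hf]. }
    assert (Hfd : forall z, inD z -> wt alpha z * Cmod (cder f z) <= B).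
    { intros z Hz. apply le_epsilon. intros e He.
      assert (Hw := wt_pos alpha z).
      destruct (luc_cder _ Han Hluc ((1 + Cmod z) / 2) (e / wt alpha z)) as [m0 Hm0].
      + assert (H0 := Cmod_ge_0 z). unfold inD in Hz. lra.
      + apply Rdiv_lt_0_compat; lra.
      + specialize (Hm0 m0 z (Nat.le_refl _)).
        rewrite cder_minus in Hm0 by (auto; apply Hfs).
        assert (H1 : Cmod (cder (fs (phi m0)) z - cder f z) <= e / wt alpha z).
        { apply Hm0. unfold inD in Hz. lra. }
        specialize (Hd (phi m0) z Hz).
        assert (H2 := Cmod_triangle_rev (cder f z) (cder (fs (phi m0)) z)).
        rewrite Cmod_minus_sym in H2.
        apply Rle_trans with (wt alpha z * (Cmod (cder (fs (phi m0)) z) + e / wt alpha z)).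
        * apply Rmult_le_compat_l; lra.
        * replace (wt alpha z * (Cmod (cder (fs (phi m0)) z) + e / wt alpha z))
            with (wt alpha z * Cmod (cder (fs (phi m0)) z) + e) by (field; lra). lra. }
    exists phi, f. split; [exact Hphi|]. split; [|split; [exact Hluc|]].
    + apply (in_bloch_wt alpha f B Hf Hfd).
    + exists (2 * B). split; [lra|]. intros m z Hz.
      rewrite cder_minus by (auto; apply Hfs).
      specialize (Hd (phi m) z Hz). specialize (Hfd z Hz). assert (Hw := wt_pos alpha z).
      assert (H := Cmod_triangle_minus (cder (fs (phi m)) z) (cder f z)).
      apply Rle_trans with (wt alpha z * (Cmod (cder (fs (phi m)) z) + Cmod (cder f z))).
      * apply Rmult_le_compat_l; lra.
      * lra.
Qed.

Lemma is_lim_seq_0 (u : nat -> R) :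
  (forall eps, 0 < eps -> exists m0, forall m, (m0 <= m)%nat -> 0 <= u m <= eps) -> is_lim_seq u 0.
Proof.
  intros H. apply is_lim_seq_spec. intros eps.
  destruct (H (eps / 2)) as [m0 Hm0]; [generalize (cond_pos eps); lra|].
  exists m0. intros m Hm. specialize (Hm0 m Hm). rewrite Rminus_0_r, Rabs_right by lra.
  generalize (cond_pos eps). lra.
Qed.

(** The disc is split at radius [r]. Inside, the derivatives of [e m] tend to 0 uniformly while [g]
    is bounded; outside, the weighted [g] is small while the weighted derivatives of [e m] stay
    bounded. *)
Lemma compact_sufficient :
  small false (fun z => wt (beta - alpha + INR (N - k)) z * Cmod (g z)) ->
  compact_op alpha beta (IgNk N k g).
Proof.
  intros Hs.
  assert (Hb := bounded_sufficient (small_true false _ Hs)).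
  split; [apply Hb|]. intros fs Hfs.
  destruct (bloch_ball_compact fs Hfs) as (phi & f & Hphi & Hf & Hluc & B & HB & HBz).
  exists phi, (IgNk N k g f). split; [exact Hphi|]. split; [apply Hb, Hf|].
  set (e := fun m z => (fs (phi m) z - f z)%C).
  assert (Han : forall m, analytic_D (e m)).
  { intros m. apply analytic_minus; [apply Hfs|apply Hf]. }
  set (u := fun m => fsub (IgNk N k g (fs (phi m))) (IgNk N k g f)).
  assert (HTa : forall m, analytic_D (IgNk N k g (fs m))) by (intros m; apply IgNk_analytic; [exact Hg|apply Hfs]).
  assert (HTf : analytic_D (IgNk N k g f)) by (apply IgNk_analytic; [exact Hg|apply Hf]).
  assert (Hua : forall m, analytic_D (u m)) by (intros m; apply analytic_minus; auto).
  assert (Hu0 : forall m j, (j < N)%nat -> cder_n j (u m) 0%C = 0%C).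
  { intros m j Hj. unfold u, fsub. rewrite cder_n_minus by (auto using inD_0).
    rewrite !IgNk_0 by (auto; try apply Hf; apply Hfs). ring. }
  assert (Hut : forall m z, inD z -> cder_n N (u m) z = (cder_n k (e m) z * g z)%C).
  { intros m z Hz. unfold u, fsub. rewrite cder_n_minus by auto.
    rewrite !IgNk_top by (auto; try apply Hf; apply Hfs). unfold e.
    rewrite cder_n_minus by (auto; try apply Hf; apply Hfs). ring. }
  destruct (bloch_from_top beta N Hbeta ltac:(lia)) as [K [HK HKu]].
  destruct (growth_cder_n alpha (k - 1)) as [K1 [HK1 H1]].
  assert (He : forall m z, inD z -> wt (alpha + INR (k - 1)) z * Cmod (cder_n k (e m) z) <= K1 * B).
  { intros m z Hz. replace k with (S (k - 1)) at 2 by lia. rewrite <- cder_n_cder.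
    apply H1; [apply analytic_cder, Han|apply HBz|exact Hz]. }
  apply is_lim_seq_0. intros eps Heps.
  assert (HKB : 0 <= K1 * B) by (apply Rmult_le_pos; lra).
  assert (Hq : 0 < eps / K) by (apply Rdiv_lt_0_compat; lra).
  (* [K] is lost between top derivative and norm, and [K1 * B] bounds the other factor; the [+ 1]
     keeps the denominator positive. *)
  destruct (Hs (eps / K / (K1 * B + 1))) as [r0 [Hr0 Hr0z]].
  { apply Rdiv_lt_0_compat; lra. }
  set (r := Rmax r0 (/ 2)).
  assert (Hr : 0 < r < 1).
  { unfold r. split; [apply Rlt_le_trans with (/ 2); [lra|apply Rmax_r]|apply Rmax_lub_lt; lra]. }
  destruct (wt_bounded (beta + INR (N - 1)) r ltac:(lra)) as [W [HW HWz]].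
  destruct (analytic_bounded g r Hg ltac:(lra)) as [G [HG HGz]].
  assert (HWG : 0 <= W * G) by (apply Rmult_le_pos; lra).
  destruct (luc_cder_n e k Han Hluc r (eps / K / (W * G + 1)) Hr) as [m0 Hm0].
  { apply Rdiv_lt_0_compat; lra. }
  exists m0. intros m Hm.
  destruct (HKu (u m) (eps / K)) as [P1 P2]; auto; [lra| |].
  - intros z Hz. rewrite Hut, Cmod_mult by exact Hz.
    destruct (Rle_dec (Cmod z) r) as [Hzr|Hzr].
    + specialize (Hm0 m z Hm Hzr). specialize (HWz z Hzr). specialize (HGz z Hzr).
      assert (Hw0 := wt_pos (beta + INR (N - 1)) z).
      assert (C1 := Cmod_ge_0 (cder_n k (e m) z)). assert (C2 := Cmod_ge_0 (g z)).
      apply Rle_trans with ((W * G) * (eps / K / (W * G + 1))).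
      * replace (wt (beta + INR (N - 1)) z * (Cmod (cder_n k (e m) z) * Cmod (g z)))
          with ((wt (beta + INR (N - 1)) z * Cmod (g z)) * Cmod (cder_n k (e m) z)) by ring.
        apply Rmult_le_compat; auto; [apply Rmult_le_pos; lra|].
        apply Rmult_le_compat; lra.
      * apply Rmult_frac_le; lra.
    + assert (Hzr0 : r0 < Cmod z).
      { apply Rnot_le_lt in Hzr. eapply Rle_lt_trans; [apply Rmax_l|exact Hzr]. }
      specialize (Hr0z z Hzr0 Hz). specialize (He m z Hz).
      rewrite weighted_product.
      apply Rle_trans with (K1 * B * (eps / K / (K1 * B + 1))).
      * apply Rmult_le_compat; auto; apply Rmult_le_pos; try apply Cmod_ge_0; left; apply wt_pos.
      * apply Rmult_frac_le; lra.
  - split; [apply bloch_norm_ge_0, P1|]. eapply Rle_trans; [exact P2|].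
    apply Req_le. field. lra.
Qed.

End OneOperator.

(** * Sums of operators, Leibniz' rule and rising factorials *)


(** Functions are total, so equality with the sum is asked only on the disc; derivatives there agree
    because the disc is open. *)
Lemma bloch_norm_triangle (b : R) (u v w : C -> C) : in_bloch b u -> in_bloch b v ->
  (forall z, inD z -> w z = u z + v z)%C ->
  in_bloch b w /\ bloch_norm b w <= bloch_norm b u + bloch_norm b v.
Proof.
  intros Hu Hv Hw.
  assert (Ha : analytic_D (fun z => u z + v z)%C) by (apply analytic_plus; [apply Hu|apply Hv]).
  assert (H : forall z, inD z -> bloch_w b w z <= bloch_w b u z + bloch_w b v z).
  { intros z Hz. unfold bloch_w.
    rewrite <- (cder_ext_D _ w Ha) by (auto; intros; symmetry; apply Hw; assumption).
    rewrite cder_plus by (auto; try apply Hu; apply Hv).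
    rewrite <- Rmult_plus_distr_l. apply Rmult_le_compat_l; [left; apply exp_pos|apply Cmod_triangle]. }
  assert (HM : forall z, inD z -> bloch_w b w z <= (bloch_norm b u - Cmod (u 0%C)) + (bloch_norm b v - Cmod (v 0%C))).
  { intros z Hz. generalize (H z Hz) (bloch_w_le_norm b u z Hu Hz) (bloch_w_le_norm b v z Hv Hz). lra. }
  split.
  - split; [|eexists; exact HM]. apply (analytic_ext (fun z => u z + v z)%C); auto.
    intros; symmetry; auto.
  - eapply Rle_trans; [apply (bloch_norm_le b w _ HM)|].
    rewrite (Hw 0%C inD_0). generalize (Cmod_triangle (u 0%C) (v 0%C)). lra.
Qed.

Lemma in_bloch_opp (b : R) (u : C -> C) : in_bloch b u -> in_bloch b (fun z => 0 - u z)%C.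
Proof.
  intros [Hu [M HM]].
  assert (Hc : forall z, inD z -> cd (fun z => 0 - u z)%C z (0 - cder u z)%C).
  { intros z Hz. apply (cd_minus (fun _ => RtoC 0)); [apply cd_const|apply analytic_cd; auto]. }
  split; [apply (cd_analytic _ _ Hc)|].
  exists M. intros z Hz. unfold bloch_w. rewrite (cd_cder _ _ _ (Hc z Hz)).
  replace (0 - cder u z)%C with (- cder u z)%C by ring. rewrite Cmod_opp. apply HM, Hz.
Qed.

Lemma in_bloch_sub (b : R) (u v : C -> C) : in_bloch b u -> in_bloch b v -> in_bloch b (fsub u v).
Proof.
  intros Hu Hv. apply (bloch_norm_triangle b u (fun z => 0 - v z)%C); [exact Hu|apply in_bloch_opp, Hv|].
  intros z _. unfold fsub. ring.
Qed.

Lemma in_bloch_zero (b : R) : in_bloch b (fun _ => RtoC 0) /\ bloch_norm b (fun _ => RtoC 0) <= 0.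
Proof.
  destruct (in_bloch_wt b (fun _ => RtoC 0) 0 (analytic_const 0%C)) as [H1 H2].
  - intros z _. rewrite (cd_cder _ _ _ (cd_const 0%C z)), Cmod_0. lra.
  - split; [exact H1|]. rewrite Cmod_0 in H2. lra.
Qed.

Lemma bounded_op_csum (a b : R) (n : nat) (T : nat -> (C -> C) -> C -> C) :
  (forall i, (i < n)%nat -> bounded_op a b (T i)) ->
  bounded_op a b (fun f z => csum n (fun i => T i f z)).
Proof.
  intros HT. induction n as [|n IH].
  - split; [intros; apply in_bloch_zero|]. exists 0. intros f Hf.
    simpl. rewrite Rmult_0_l. apply in_bloch_zero.
  - destruct IH as [I1 [K1 I2]]; [intros; apply HT; lia|].
    destruct (HT n ltac:(lia)) as [J1 [K2 J2]].
    assert (H : forall f, in_bloch a f -> in_bloch b (fun z => csum (S n) (fun i => T i f z)) /\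
      bloch_norm b (fun z => csum (S n) (fun i => T i f z))
        <= bloch_norm b (fun z => csum n (fun i => T i f z)) + bloch_norm b (T n f)).
    { intros f Hf. apply bloch_norm_triangle; auto. }
    split; [intros f Hf; apply H, Hf|].
    exists (K1 + K2). intros f Hf. destruct (H f Hf) as [_ H2].
    specialize (I2 f Hf). specialize (J2 f Hf). simpl in *. lra.
Qed.

Lemma incr_comp (phi psi : nat -> nat) : (forall m, (phi m < phi (S m))%nat) ->
  (forall m, (psi m < psi (S m))%nat) -> forall m, (phi (psi m) < phi (psi (S m)))%nat.
Proof.
  intros Hphi Hpsi m.
  assert (H : forall a d, (phi a < phi (a + S d))%nat).
  { intros a d. induction d.
    - replace (a + 1)%nat with (S a) by lia. apply Hphi.
    - replace (a + S (S d))%nat with (S (a + S d)) by lia. specialize (Hphi (a + S d)%nat). lia. }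
  specialize (Hpsi m). replace (psi (S m)) with (psi m + S (psi (S m) - psi m - 1))%nat by lia. apply H.
Qed.

Lemma incr_ge (psi : nat -> nat) : (forall m, (psi m < psi (S m))%nat) -> forall m, (m <= psi m)%nat.
Proof. intros H m. induction m; [lia|]. specialize (H m). lia. Qed.

Lemma is_lim_seq_0_elim (u : nat -> R) : is_lim_seq u 0 ->
  forall eps, 0 < eps -> exists m0, forall m, (m0 <= m)%nat -> u m <= eps.
Proof.
  intros H eps Heps. apply is_lim_seq_spec in H. destruct (H (mkposreal eps Heps)) as [m0 Hm0].
  exists m0. intros m Hm. specialize (Hm0 m Hm). simpl in Hm0. rewrite Rminus_0_r in Hm0.
  generalize (Rle_abs (u m)). lra.
Qed.

(** A subsequence good for the first [n] operators is thinned out once more for the last one; the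
    first limit survives the thinning. *)
Lemma compact_op_csum (a b : R) (n : nat) (T : nat -> (C -> C) -> C -> C) :
  (forall i, (i < n)%nat -> compact_op a b (T i)) ->
  compact_op a b (fun f z => csum n (fun i => T i f z)).
Proof.
  intros HT. induction n as [|n IH].
  - split; [intros; apply in_bloch_zero|]. intros fs _. exists (fun m => m), (fun _ => RtoC 0).
    split; [intros; lia|]. split; [apply in_bloch_zero|].
    apply is_lim_seq_0. intros eps Heps. exists 0%nat. intros m _.
    destruct (in_bloch_zero b) as [H1 H2].
    destruct (bloch_norm_triangle b _ _ (fsub (fun _ => RtoC 0) (fun _ => RtoC 0)) H1 H1) as [H3 H4].
    { intros z _. unfold fsub. ring. }
    assert (H5 := bloch_norm_ge_0 _ _ H3).
    unfold fsub in *. simpl. lra.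
  - destruct IH as [I1 I2]; [intros; apply HT; lia|].
    destruct (HT n ltac:(lia)) as [J1 J2].
    split.
    { intros f Hf. apply (bloch_norm_triangle b (fun z => csum n (fun i => T i f z)) (T n f)); auto. }
    intros fs Hfs. destruct (I2 fs Hfs) as (phi & h1 & Hphi & Hh1 & L1).
    destruct (J2 (fun m => fs (phi m))) as (psi & h2 & Hpsi & Hh2 & L2).
    { intros m. apply Hfs. }
    exists (fun m => phi (psi m)), (fun z => h1 z + h2 z)%C.
    split; [apply incr_comp; auto|]. split.
    { apply (bloch_norm_triangle b h1 h2); auto. }
    apply is_lim_seq_0. intros eps Heps.
    destruct (is_lim_seq_0_elim _ L1 (eps / 2)) as [m1 H1]; [lra|].
    destruct (is_lim_seq_0_elim _ L2 (eps / 2)) as [m2 H2]; [lra|].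
    exists (m1 + m2)%nat. intros m Hm.
    assert (Hpm := incr_ge psi Hpsi m).
    specialize (H1 (psi m) ltac:(lia)). specialize (H2 m ltac:(lia)).
    destruct (bloch_norm_triangle b (fsub (fun z => csum n (fun i => T i (fs (phi (psi m))) z)) h1)
      (fsub (T n (fs (phi (psi m)))) h2)
      (fsub (fun z => csum (S n) (fun i => T i (fs (phi (psi m))) z)) (fun z => h1 z + h2 z)%C)) as [H3 H4].
    + apply in_bloch_sub; [apply I1, Hfs|exact Hh1].
    + apply in_bloch_sub; [apply J1, Hfs|exact Hh2].
    + intros z _. unfold fsub. simpl. ring.
    + split; [apply bloch_norm_ge_0, H3|lra].
Qed.

(** Binomial coefficients by Pascal's rule, equal to 0 for [l > n], so that Leibniz sums may be
    extended beyond their last term. *)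
Fixpoint bin (n l : nat) : nat :=
  match l, n with
  | O, _ => 1%nat
  | S _, O => 0%nat
  | S l', S n' => (bin n' l' + bin n' (S l'))%nat
  end.

Lemma bin_0 (n : nat) : bin n 0 = 1%nat.
Proof. destruct n; reflexivity. Qed.

Lemma bin_gt (n l : nat) : (n < l)%nat -> bin n l = 0%nat.
Proof.
  revert l. induction n; intros [|l] H; try lia; [reflexivity|].
  simpl. rewrite !IHn by lia. reflexivity.
Qed.

Lemma analytic_csum (n : nat) (F : nat -> C -> C) : (forall i, (i < n)%nat -> analytic_D (F i)) ->
  analytic_D (fun z => csum n (fun i => F i z)).
Proof.
  intros H. induction n; [exact (analytic_const 0%C)|].
  apply (analytic_plus (fun z => csum n (fun i => F i z)) (F n)); [apply IHn; intros; apply H; lia|apply H; lia].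
Qed.

Lemma cder_n_csum (k n : nat) (F : nat -> C -> C) (z : C) : (forall i, (i < n)%nat -> analytic_D (F i)) ->
  inD z -> cder_n k (fun z => csum n (fun i => F i z)) z = csum n (fun i => cder_n k (F i) z).
Proof.
  intros H Hz. induction n.
  - simpl. clear H. revert z Hz. induction k; intros z Hz; [reflexivity|].
    rewrite cder_n_S. apply cd_cder. apply (cd_ext_D (fun _ => RtoC 0)); auto; [|apply cd_const].
    intros y Hy. symmetry. apply IHk, Hy.
  - simpl. rewrite <- IHn by (intros; apply H; lia).
    apply (cder_n_plus k (fun z => csum n (fun i => F i z)) (F n)); auto.
    apply analytic_csum. intros; apply H; lia.
Qed.

Lemma cder_scal (c : C) (f : C -> C) (z : C) : analytic_D f -> inD z ->
  cder (fun z => c * f z)%C z = (c * cder f z)%C.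
Proof. intros Hf Hz. apply cd_cder, cd_scal, analytic_cd; auto. Qed.

Lemma leibniz (n : nat) (f h : C -> C) (z : C) : analytic_D f -> analytic_D h -> inD z ->
  cder_n n (fun z => f z * h z)%C z
  = csum (S n) (fun l => INR (bin n l) * (cder_n (n - l) f z * cder_n l h z))%C.
Proof.
  intros Hf Hh. revert z. induction n as [|n IH]; intros z Hz.
  - simpl. ring.
  - set (G := fun l w => (INR (bin n l) * (cder_n (n - l) f w * cder_n l h w))%C).
    assert (HG : forall l, analytic_D (G l)).
    { intros l. apply (analytic_mult (fun _ => RtoC (INR (bin n l)))); [apply analytic_const|].
      apply analytic_mult; apply analytic_cder_n; assumption. }
    rewrite cder_n_S.
    rewrite (cder_ext_D _ (fun w => csum (S n) (fun l => G l w))); auto.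
    2: apply analytic_cder_n, analytic_mult; assumption.
    assert (E := cder_n_csum 1 (S n) G z (fun l _ => HG l) Hz).
    change (cder (fun w => csum (S n) (fun l => G l w)) z = csum (S n) (fun l => cder (G l) z)) in E.
    rewrite E.
    rewrite (csum_ext (S n) _ (fun l => INR (bin n l) * (cder_n (S n - l) f z * cder_n l h z)
        + INR (bin n l) * (cder_n (n - l) f z * cder_n (S l) h z))%C).
    2: { intros l Hl. unfold G. rewrite cder_scal.
         - rewrite cder_mult by (auto; apply analytic_cder_n; assumption).
           replace (S n - l)%nat with (S (n - l)) by lia. rewrite !cder_n_S. ring.
         - apply analytic_mult; apply analytic_cder_n; assumption.
         - exact Hz. }
    rewrite csum_plus.
    rewrite (csum_S n (fun l => INR (bin n l) * (cder_n (S n - l) f z * cder_n l h z))%C).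
    rewrite (csum_S (S n) (fun l => INR (bin (S n) l) * (cder_n (S n - l) f z * cder_n l h z))%C).
    rewrite !bin_0.
    (* The added term carries [bin n (S n) = 0]; both sums now have the same length and Pascal's
       rule applies term by term. *)
    assert (E2 : csum n (fun i => INR (bin n (S i)) * (cder_n (S n - S i) f z * cder_n (S i) h z))%C
      = csum (S n) (fun i => INR (bin n (S i)) * (cder_n (S n - S i) f z * cder_n (S i) h z))%C).
    { simpl. rewrite (bin_gt n (S n)) by lia. simpl (INR 0). ring. }
    rewrite E2, <- Cplus_assoc, <- csum_plus. f_equal. apply csum_ext. intros l Hl.
    change (bin (S n) (S l)) with (bin n l + bin n (S l))%nat.
    replace (S n - S l)%nat with (n - l)%nat by lia.
    rewrite plus_INR, RtoC_plus. ring.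
Qed.

Lemma csum_swap (n m : nat) (F : nat -> nat -> C) :
  csum n (fun i => csum m (fun j => F i j)) = csum m (fun j => csum n (fun i => F i j)).
Proof.
  induction n; simpl.
  - symmetry. apply csum_0. reflexivity.
  - rewrite IHn, <- csum_plus. reflexivity.
Qed.

Lemma csum_remove (n i : nat) (F : nat -> C) : (i < n)%nat ->
  csum n F = (F i + csum n (fun j => if Nat.eq_dec j i then RtoC 0 else F j))%C.
Proof.
  intros Hi.
  rewrite (csum_ext n F (fun j => (if Nat.eq_dec j i then F i else RtoC 0)
     + (if Nat.eq_dec j i then RtoC 0 else F j))%C).
  - rewrite csum_plus. f_equal. rewrite (csum_single n i); auto.
    + destruct (Nat.eq_dec i i); tauto.
    + intros j _ Hj. destruct (Nat.eq_dec j i); tauto.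
  - intros j _. destruct (Nat.eq_dec j i) as [->|]; ring.
Qed.

(** Turns the Leibniz index [l] into the order [j = T - l] of the derivative of [f], over a range of
    [j] common to all operators. *)
Lemma csum_reindex (m T J : nat) (G : nat -> C) : (m <= T)%nat -> (T < J)%nat ->
  (forall l, (m < l)%nat -> G l = 0%C) ->
  csum (S m) G = csum J (fun j => if le_dec j T then G (T - j)%nat else RtoC 0).
Proof.
  intros Hm HJ HG.
  rewrite (csum_ext (S m) G (fun l => csum J (fun j => if Nat.eq_dec j (T - l) then G l else RtoC 0))).
  - rewrite csum_swap. apply csum_ext. intros j Hj. destruct (le_dec j T) as [H|H].
    + destruct (le_dec (T - j) m) as [H1|H1].
      * rewrite (csum_single (S m) (T - j)); [|lia|].
        -- destruct (Nat.eq_dec j (T - (T - j))); [reflexivity|lia].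
        -- intros l Hl Hd. destruct (Nat.eq_dec j (T - l)); [lia|reflexivity].
      * rewrite HG by lia. apply csum_0. intros l Hl. destruct (Nat.eq_dec j (T - l)); [lia|reflexivity].
    + apply csum_0. intros l Hl. destruct (Nat.eq_dec j (T - l)); [lia|reflexivity].
  - intros l Hl. rewrite (csum_single J (T - l)); [|lia|].
    + destruct (Nat.eq_dec (T - l) (T - l)); tauto.
    + intros j _ Hd. destruct (Nat.eq_dec j (T - l)); tauto.
Qed.

(** * Rising factorials and their independence *)

Fixpoint rising (M j : nat) : R :=
  match j with O => 1 | S j' => rising M j' * INR (M + j') end.

Lemma rising_front (M j : nat) : rising M (S j) = INR M * rising (S M) j.
Proof.
  induction j.
  - simpl. rewrite Nat.add_0_r. ring.
  - change (rising M (S (S j))) with (rising M (S j) * INR (M + S j)).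
    rewrite IHj. change (rising (S M) (S j)) with (rising (S M) j * INR (S M + j)).
    replace (S M + j)%nat with (M + S j)%nat by lia. ring.
Qed.

Lemma rising_diff (M j : nat) : rising (S M) (S j) - rising M (S j) = INR (S j) * rising (S M) j.
Proof.
  rewrite (rising_front M). change (rising (S M) (S j)) with (rising (S M) j * INR (S M + j)).
  rewrite plus_INR, !S_INR. ring.
Qed.

Lemma rising_ge_0 (M j : nat) : 0 <= rising M j.
Proof. induction j; simpl; [lra|]. apply Rmult_le_pos; [exact IHj|apply pos_INR]. Qed.

Fixpoint rsum (n : nat) (F : nat -> R) : R :=
  match n with O => 0 | S m => rsum m F + F m end.

Lemma Cmod_csum (n : nat) (F : nat -> C) : Cmod (csum n F) <= rsum n (fun i => Cmod (F i)).
Proof.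
  induction n; simpl; [rewrite Cmod_0; lra|].
  eapply Rle_trans; [apply Cmod_triangle|lra].
Qed.

Lemma rsum_le (n : nat) (F G : nat -> R) : (forall i, (i < n)%nat -> F i <= G i) -> rsum n F <= rsum n G.
Proof. induction n; intros H; simpl; [lra|]. apply Rplus_le_compat; [apply IHn; intros; apply H; lia|apply H; lia]. Qed.

Lemma rsum_scal (n : nat) (c : R) (F : nat -> R) : rsum n (fun i => c * F i) = c * rsum n F.
Proof. induction n; simpl; [ring|]. rewrite IHn. ring. Qed.

Lemma rsum_ge_0 (n : nat) (F : nat -> R) : (forall j, 0 <= F j) -> 0 <= rsum n F.
Proof. intros H. induction n; simpl; [lra|]. specialize (H n). lra. Qed.

Lemma rsum_term (n i : nat) (F : nat -> R) : (forall j, 0 <= F j) -> (i < n)%nat -> F i <= rsum n F.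
Proof.
  intros H. induction n; intros Hi; [lia|]. simpl. destruct (Nat.eq_dec i n) as [->|Hd].
  - assert (Hp := rsum_ge_0 n F H). lra.
  - specialize (IHn ltac:(lia)). specialize (H n). lra.
Qed.

Lemma csum_weighted_bound (m : nat) (rho : nat -> R) (c : nat -> C) (X : R) :
  (forall j, 0 <= rho j) -> (forall j, (j < m)%nat -> Cmod (c j) <= X) ->
  Cmod (csum m (fun j => rho j * c j)%C) <= rsum m rho * X.
Proof.
  intros Hr Hc. eapply Rle_trans; [apply Cmod_csum|]. rewrite Rmult_comm, <- rsum_scal.
  apply rsum_le. intros j Hj. specialize (Hr j). specialize (Hc j Hj).
  rewrite Cmod_mult, Cmod_R, Rabs_right, Rmult_comm by lra. apply Rmult_le_compat_r; lra.
Qed.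

(* A finite difference in [M] lowers the degree of a combination of rising factorials by one. *)
Lemma rising_independent (J M0 : nat) : exists K, 0 < K /\ forall (c : nat -> C) (B : R),
  (forall M, (M0 <= M <= M0 + J)%nat -> Cmod (csum (S J) (fun j => rising M j * c j)%C) <= B) ->
  forall j, (j <= J)%nat -> Cmod (c j) <= K * B.
Proof.
  revert M0. induction J as [|J IH]; intros M0.
  - exists 1. split; [lra|]. intros c B H j Hj. replace j with 0%nat by lia.
    specialize (H M0 ltac:(lia)). simpl in H.
    replace (0 + 1 * c 0%nat)%C with (c 0%nat) in H by ring. lra.
  - destruct (IH (S M0)) as [K [HK H]].
    set (R0 := rsum (S J) (fun j => rising M0 (S j))).
    assert (HR0 : 0 <= R0) by (apply rsum_ge_0; intros; apply rising_ge_0).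
    (* Differences of two consecutive combinations are at most [2 * B], which bounds [c 1, c 2, ...]
       by [2 * K * B]; then [c 0] is the combination at [M0] minus the rest. *)
    exists (1 + 2 * K * (R0 + 1)). split; [nra|].
    intros c B HB.
    assert (HB0 : 0 <= B).
    { eapply Rle_trans; [apply Cmod_ge_0|apply (HB M0); lia]. }
    assert (Hc : forall j, (j <= J)%nat -> Cmod (c (S j)) <= 2 * K * B).
    { intros j Hj.
      assert (H1 : Cmod (INR (S j) * c (S j))%C <= K * (2 * B)).
      { apply (H (fun j => INR (S j) * c (S j))%C (2 * B)); [|exact Hj].
        intros M HM. destruct M as [|M]; [lia|].
        assert (A1 := HB (S M) ltac:(lia)). assert (A2 := HB M ltac:(lia)).
        replace (csum (S J) (fun j => rising (S M) j * (INR (S j) * c (S j)))%C)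
          with (csum (S (S J)) (fun j => rising (S M) j * c j)%C - csum (S (S J)) (fun j => rising M j * c j)%C)%C.
        - eapply Rle_trans; [apply Cmod_triangle_minus|lra].
        - rewrite !(csum_S (S J)). simpl (rising _ 0).
          rewrite (csum_ext (S J) (fun j => rising (S M) j * (INR (S j) * c (S j)))%C
            (fun i => rising (S M) (S i) * c (S i) + (- (1)) * (rising M (S i) * c (S i)))%C).
          + rewrite csum_plus, csum_scal. ring.
          + intros i _. assert (E := rising_diff M i).
            replace (rising (S M) (S i)) with (rising M (S i) + INR (S i) * rising (S M) i) by lra.
            rewrite RtoC_plus, RtoC_mult. ring. }
      rewrite Cmod_mult, Cmod_R, Rabs_right in H1 by apply Rle_ge, pos_INR.
      assert (H2 : 1 <= INR (S j)) by (apply (le_INR 1); lia).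
      assert (H3 := Cmod_ge_0 (c (S j))). nra. }
    assert (HKB : 0 <= K * B) by (apply Rmult_le_pos; lra).
    intros [|j] Hj.
    + specialize (HB M0 ltac:(lia)). rewrite csum_S in HB. simpl (rising _ 0) in HB.
      assert (HR := csum_weighted_bound (S J) (fun j => rising M0 (S j)) (fun j => c (S j)) (2 * K * B)
        ltac:(intros; apply rising_ge_0) ltac:(intros; apply Hc; lia)). fold R0 in HR.
      set (X := csum (S J) (fun i => rising M0 (S i) * c (S i))%C) in *.
      replace (c 0%nat) with ((1 * c 0%nat + X) - X)%C by ring.
      eapply Rle_trans; [apply Cmod_triangle_minus|]. nra.
    + specialize (Hc j ltac:(lia)).
      assert (0 <= R0 * (K * B)) by (apply Rmult_le_pos; lra). nra.
Qed.

(** * Test functions *)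


Lemma kernel_lower (w z : C) : inD w -> inD z ->
  1 - Cmod z <= Cmod (1 - Cconj w * z) /\ 1 - Cmod w <= Cmod (1 - Cconj w * z).
Proof.
  intros Hw Hz. unfold inD in *.
  assert (H := Cmod_triangle_rev 1 (Cconj w * z)%C).
  rewrite Cmod_1, Cmod_mult, Cmod_conj in H.
  assert (H1 := Cmod_ge_0 w). assert (H2 := Cmod_ge_0 z). split; nra.
Qed.

Lemma kernel_neq_0 (w z : C) : inD w -> inD z -> (1 - Cconj w * z)%C <> RtoC 0.
Proof.
  intros Hw Hz. apply Cmod_gt_0. destruct (kernel_lower w z Hw Hz). unfold inD in *. lra.
Qed.

Lemma kernel_cd (w z : C) (M : nat) : inD w -> inD z ->
  cd (fun z => / (1 - Cconj w * z) ^ M)%C z (INR M * (Cconj w * / (1 - Cconj w * z) ^ S M))%C.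
Proof.
  intros Hw Hz. assert (H0 := kernel_neq_0 w z Hw Hz).
  assert (H1 : cd (fun z => 1 - Cconj w * z)%C z (0 - Cconj w * 1)%C).
  { apply (cd_minus (fun _ => RtoC 1)); [apply cd_const|]. apply (cd_scal (fun z => z)), cd_id. }
  assert (H2 := cd_comp (fun x => x ^ M)%C (fun z => 1 - Cconj w * z)%C z _ _ (cd_pow M _) H1).
  assert (H3 := cd_comp (fun x => / x)%C _ z _ _ (cd_inv _ (Cpow_nz _ M H0)) H2).
  simpl in H3. set (x := (1 - Cconj w * z)%C) in *.
  replace (INR M * (Cconj w * / x ^ S M))%C
    with (- / (x ^ M * x ^ M) * (INR M * x ^ pred M * (0 - Cconj w * 1)))%C; [exact H3|].
  destruct M as [|M]; [simpl; field; auto|].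
  simpl pred. rewrite !Cpow_S. field. split; auto. apply Cpow_nz; auto.
Qed.

(* [kappa] times the normalized kernel [d^(1-alpha) (delta / (1 - conj w z))^M],
   where [d = 1 - |w|] and [delta = 1 - |w|^2]. *)
Definition test_coef (kappa alpha : R) (M : nat) (w : C) : R :=
  kappa * (wt (1 - alpha) w * (1 - Cmod w ^ 2) ^ M).

Definition test (kappa alpha : R) (M : nat) (w z : C) : C :=
  (test_coef kappa alpha M w * / (1 - Cconj w * z) ^ M)%C.

Lemma test_cd_n (kappa alpha : R) (M : nat) (w : C) (j : nat) : inD w -> forall z, inD z ->
  cder_n j (test kappa alpha M w) z
  = (test_coef kappa alpha M w * (rising M j * (Cconj w ^ j * / (1 - Cconj w * z) ^ (M + j))))%C.
Proof.
  intros Hw. induction j as [|j IH]; intros z Hz.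
  - simpl. rewrite Nat.add_0_r. unfold test. ring.
  - rewrite cder_n_S. apply cd_cder.
    apply (cd_ext_D (fun z => test_coef kappa alpha M w * (rising M j * (Cconj w ^ j * / (1 - Cconj w * z) ^ (M + j))))%C);
      [intros y Hy; symmetry; apply IH, Hy|exact Hz|].
    assert (H := cd_scal _ (test_coef kappa alpha M w) _ _
      (cd_scal _ (rising M j) _ _ (cd_scal _ (Cconj w ^ j)%C _ _ (kernel_cd w z (M + j) Hw Hz)))).
    change (rising M (S j)) with (rising M j * INR (M + j)). rewrite RtoC_mult, (Cpow_S (Cconj w)).
    replace (M + S j)%nat with (S (M + j)) by lia.
    match goal with |- cd _ _ ?x => match type of H with cd _ _ ?y =>
      replace x with y by ring end end.
    exact H.
Qed.

Lemma test_analytic (kappa alpha : R) (M : nat) (w : C) : inD w -> analytic_D (test kappa alpha M w).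
Proof.
  intros Hw. apply (cd_analytic _ (fun z => test_coef kappa alpha M w * (INR M * (Cconj w * / (1 - Cconj w * z) ^ S M)))%C).
  intros z Hz. apply cd_scal, kernel_cd; auto.
Qed.

Lemma delta_bounds (w : C) : inD w -> 0 < 1 - Cmod w /\ 0 < 1 - Cmod w ^ 2 /\ 1 - Cmod w ^ 2 <= 2 * (1 - Cmod w).
Proof. intros Hw. unfold inD in Hw. assert (H := Cmod_ge_0 w). repeat split; nra. Qed.

Lemma test_coef_le (alpha : R) (M : nat) (w : C) : inD w ->
  0 <= test_coef 1 alpha M w <= 2 ^ M * wt (INR M + 1 - alpha) w.
Proof.
  intros Hw. destruct (delta_bounds w Hw) as (H1 & H2 & H3). unfold test_coef.
  assert (Hp := wt_pos (1 - alpha) w).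
  split.
  - rewrite Rmult_1_l. apply Rmult_le_pos; [lra|apply pow_le; lra].
  - replace (INR M + 1 - alpha) with ((1 - alpha) + INR M) by ring. rewrite wt_plus.
    unfold wt at 3. rewrite Rpower_pow by lra.
    replace (2 ^ M * (wt (1 - alpha) w * (1 - Cmod w) ^ M)) with (wt (1 - alpha) w * (2 * (1 - Cmod w)) ^ M)
      by (rewrite Rpow_mult_distr; ring).
    rewrite Rmult_1_l. apply Rmult_le_compat_l; [lra|]. apply pow_incr. lra.
Qed.

Lemma test_coef_kappa (kappa alpha : R) (M : nat) (w : C) :
  test_coef kappa alpha M w = kappa * test_coef 1 alpha M w.
Proof. unfold test_coef. ring. Qed.

Lemma wt_le_1 (s : R) (z : C) : 0 <= s -> inD z -> wt s z <= 1.
Proof.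
  intros Hs Hz. unfold wt. assert (H0 := Cmod_ge_0 z). unfold inD in Hz.
  apply Rle_trans with (Rpower 1 s).
  - apply Rle_Rpower_l; lra.
  - unfold Rpower. rewrite ln_1, Rmult_0_r, exp_0. lra.
Qed.

Lemma test_bloch (alpha : R) (M : nat) : 0 < alpha -> alpha <= INR M -> exists K, 0 < K /\
  forall kappa w, 0 <= kappa -> inD w ->
    in_bloch alpha (test kappa alpha M w) /\ bloch_norm alpha (test kappa alpha M w) <= kappa * K.
Proof.
  intros Ha HM.
  assert (H2M : 0 < 2 ^ M) by (apply pow_lt; lra).
  assert (HMp := pos_INR M).
  assert (HRp : 0 < Rpower 2 (Rabs alpha)) by apply exp_pos.
  assert (Hpos : 0 <= Rpower 2 (Rabs alpha) * (INR M * 2 ^ M)).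
  { apply Rmult_le_pos; [lra|]. apply Rmult_le_pos; lra. }
  exists (2 ^ M + Rpower 2 (Rabs alpha) * (INR M * 2 ^ M)). split; [lra|].
  intros kappa w Hk Hw.
  destruct (delta_bounds w Hw) as (D1 & D2 & D3).
  destruct (test_coef_le alpha M w Hw) as [T1 T2].
  destruct (in_bloch_wt alpha (test kappa alpha M w) (kappa * (INR M * 2 ^ M)) (test_analytic kappa alpha M w Hw)) as [B1 B2].
  - intros z Hz.
    assert (E : cder (test kappa alpha M w) z = (test_coef kappa alpha M w * (INR M * (Cconj w * / (1 - Cconj w * z) ^ S M)))%C)
      by (apply cd_cder, cd_scal, kernel_cd; auto).
    rewrite E, test_coef_kappa, !Cmod_mult, !Cmod_R, Cmod_inv, Cmod_pow, Cmod_conj by (apply Cpow_nz, kernel_neq_0; auto).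
    rewrite !Rabs_right by (apply Rle_ge; try lra; apply Rmult_le_pos; lra).
    destruct (kernel_lower w z Hw Hz) as [L1 L2].
    set (y := Cmod (1 - Cconj w * z)) in *.
    assert (Hy : 0 < y) by lra.
    assert (Hw1 : Cmod w <= 1) by (unfold inD in Hw; lra). assert (Hw0 := Cmod_ge_0 w).
    (* The power [M + 1] of the kernel is shared out: [alpha] goes to [1 - |z|], and the rest,
       nonnegative since [alpha <= INR M], goes to [1 - |w|], where it cancels the decay of
       [test_coef]. *)
    assert (Hyp : wt alpha z * wt (INR M + 1 - alpha) w <= y ^ S M).
    { rewrite <- (Rpower_pow (S M) y Hy), S_INR.
      replace (INR M + 1) with (alpha + (INR M + 1 - alpha)) at 2 by ring. rewrite Rpower_plus.
      unfold inD in Hz. unfold wt.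
      apply Rmult_le_compat; try (left; apply exp_pos); apply Rle_Rpower_l; lra. }
    assert (Hyp0 : 0 < y ^ S M) by (apply pow_lt, Hy).
    assert (Hwa := wt_pos alpha z).
    assert (Hfin : wt alpha z * (test_coef 1 alpha M w * / y ^ S M) <= 2 ^ M).
    { apply Rmult_le_reg_r with (y ^ S M); [exact Hyp0|].
      replace (wt alpha z * (test_coef 1 alpha M w * / y ^ S M) * y ^ S M) with (wt alpha z * test_coef 1 alpha M w)
        by (field; lra).
      apply Rle_trans with (wt alpha z * (2 ^ M * wt (INR M + 1 - alpha) w)).
      - apply Rmult_le_compat_l; lra.
      - replace (wt alpha z * (2 ^ M * wt (INR M + 1 - alpha) w)) with (2 ^ M * (wt alpha z * wt (INR M + 1 - alpha) w)) by ring.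
        apply Rmult_le_compat_l; lra. }
    replace (wt alpha z * (kappa * test_coef 1 alpha M w * (INR M * (Cmod w * / y ^ S M))))
      with (kappa * INR M * (Cmod w * (wt alpha z * (test_coef 1 alpha M w * / y ^ S M)))) by ring.
    replace (kappa * (INR M * 2 ^ M)) with (kappa * INR M * 2 ^ M) by ring.
    apply Rmult_le_compat_l; [apply Rmult_le_pos; lra|].
    rewrite <- (Rmult_1_l (2 ^ M)). apply Rmult_le_compat; auto.
    apply Rmult_le_pos; [lra|]. apply Rmult_le_pos; [lra|]. left. apply Rinv_0_lt_compat, Hyp0.
  - split; [exact B1|]. eapply Rle_trans; [exact B2|].
    assert (E : test kappa alpha M w 0%C = RtoC (kappa * test_coef 1 alpha M w)).
    { unfold test. rewrite test_coef_kappa. replace (1 - Cconj w * 0)%C with (RtoC 1) by ring.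
      rewrite Cpow_1_l. field. }
    rewrite E, Cmod_R, Rabs_right by (apply Rle_ge, Rmult_le_pos; lra).
    assert (H1 : test_coef 1 alpha M w <= 2 ^ M).
    { eapply Rle_trans; [exact T2|]. rewrite <- (Rmult_1_r (2 ^ M)) at 2.
      apply Rmult_le_compat_l; [lra|]. apply wt_le_1; [lra|exact Hw]. }
    assert (kappa * test_coef 1 alpha M w <= kappa * 2 ^ M) by (apply Rmult_le_compat_l; lra).
    lra.
Qed.

(** At fixed [z] the kernel is controlled by powers of [1 / (1 - |z|)], whereas [test_coef] decays
    like [1 - |w|] to the power [M + 1 - alpha], which is at least 1. *)
Lemma test_vanishes (kappa alpha : R) (M : nat) (z : C) (J : nat) : 0 <= kappa -> alpha <= INR M -> inD z ->
  forall eps, 0 < eps -> exists r, r < 1 /\ forall w j, r < Cmod w -> inD w -> (j <= J)%nat ->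
    Cmod (cder_n j (test kappa alpha M w) z) <= eps.
Proof.
  intros Hk HM Hz eps Heps.
  assert (H2M : 0 < 2 ^ M) by (apply pow_lt; lra).
  assert (Hd : 0 < 1 - Cmod z <= 1) by (unfold inD in Hz; generalize (Cmod_ge_0 z); lra).
  set (R0 := rsum (S J) (rising M)).
  assert (HRj : forall j, (j <= J)%nat -> rising M j <= R0)
    by (intros j Hj; apply rsum_term; [apply rising_ge_0|lia]).
  assert (HR0 : 0 <= R0) by apply rsum_ge_0, rising_ge_0.
  set (A := kappa * 2 ^ M * (R0 * (/ (1 - Cmod z)) ^ (M + J))).
  assert (Hi : 1 <= / (1 - Cmod z)) by (rewrite <- Rinv_1; apply Rinv_le_contravar; lra).
  assert (HA : 0 <= A).
  { unfold A. apply Rmult_le_pos; [apply Rmult_le_pos; lra|]. apply Rmult_le_pos; [lra|]. apply pow_le; lra. }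
  exists (1 - Rmin 1 (eps / (A + 1))).
  assert (He : 0 < eps / (A + 1)) by (apply Rdiv_lt_0_compat; lra).
  split; [assert (0 < Rmin 1 (eps / (A + 1))) by (apply Rmin_pos; lra); lra|].
  intros w j Hr Hw Hj.
  rewrite test_cd_n, test_coef_kappa by auto.
  destruct (test_coef_le alpha M w Hw) as [T1 T2].
  destruct (kernel_lower w z Hw Hz) as [L1 L2].
  rewrite !Cmod_mult, !Cmod_R, Cmod_inv, !Cmod_pow, Cmod_conj by (apply Cpow_nz, kernel_neq_0; auto).
  assert (Hrj := rising_ge_0 M j).
  rewrite !Rabs_right by (apply Rle_ge; try lra; apply Rmult_le_pos; lra).
  assert (Hw0 := Cmod_ge_0 w). assert (Hw1 : Cmod w < 1) by exact Hw.
  assert (P1 : test_coef 1 alpha M w <= 2 ^ M * (1 - Cmod w)).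
  { eapply Rle_trans; [exact T2|]. apply Rmult_le_compat_l; [lra|].
    replace (INR M + 1 - alpha) with (1 + (INR M - alpha)) by ring. rewrite wt_plus, wt_1 by exact Hw.
    assert (H := wt_le_1 (INR M - alpha) w ltac:(lra) Hw). assert (H' := wt_pos (INR M - alpha) w). nra. }
  assert (P2 : / Cmod (1 - Cconj w * z) ^ (M + j) <= (/ (1 - Cmod z)) ^ (M + J)).
  { rewrite <- pow_inv. apply Rle_trans with ((/ (1 - Cmod z)) ^ (M + j)).
    - apply pow_incr. split; [left; apply Rinv_0_lt_compat; lra|]. apply Rinv_le_contravar; lra.
    - apply Rle_pow; [exact Hi|lia]. }
  assert (P3 : 0 <= Cmod w ^ j <= 1).
  { split; [apply pow_le; lra|]. rewrite <- (pow1 j). apply pow_incr. lra. }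
  assert (P4 : 0 < / Cmod (1 - Cconj w * z) ^ (M + j)).
  { apply Rinv_0_lt_compat, pow_lt. lra. }
  assert (P5 : Cmod w ^ j * / Cmod (1 - Cconj w * z) ^ (M + j) <= (/ (1 - Cmod z)) ^ (M + J)).
  { rewrite <- (Rmult_1_l ((/ (1 - Cmod z)) ^ (M + J))). apply Rmult_le_compat; lra. }
  apply Rle_trans with (kappa * (2 ^ M * (1 - Cmod w)) * (R0 * (/ (1 - Cmod z)) ^ (M + J))).
  - apply Rmult_le_compat.
    + apply Rmult_le_pos; lra.
    + apply Rmult_le_pos; [lra|]. apply Rmult_le_pos; lra.
    + apply Rmult_le_compat_l; lra.
    + apply Rmult_le_compat; auto. apply Rmult_le_pos; lra.
  - replace (kappa * (2 ^ M * (1 - Cmod w)) * (R0 * (/ (1 - Cmod z)) ^ (M + J))) with (A * (1 - Cmod w)) by (unfold A; ring).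
    assert (Q : 1 - Cmod w <= eps / (A + 1)) by (assert (h := Rmin_r 1 (eps / (A + 1))); lra).
    apply Rle_trans with (A * (eps / (A + 1))); [apply Rmult_le_compat_l; lra|].
    apply Rmult_frac_le; lra.
Qed.

(** * Calculus of boundedness and decay near the circle *)

Lemma near_circle_le (u v w : C -> R) (B B' B'' r : R) : r < 1 ->
  (forall z, r < Cmod z -> inD z -> u z <= B -> v z <= B' -> w z <= B'') ->
  near_circle u B -> near_circle v B' -> near_circle w B''.
Proof.
  intros Hr H [r1 [Hr1 Hu]] [r2 [Hr2 Hv]]. exists (Rmax r (Rmax r1 r2)).
  split; [repeat apply Rmax_lub_lt; auto|]. intros z Hz HzD.
  assert (h1 := Rmax_l r (Rmax r1 r2)). assert (h2 := Rmax_r r (Rmax r1 r2)).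
  assert (h3 := Rmax_l r1 r2). assert (h4 := Rmax_r r1 r2).
  apply H; [lra|exact HzD|apply Hu|apply Hv]; auto; lra.
Qed.

Lemma small_le (b : bool) (u v : C -> R) (K r : R) : r < 1 -> 0 < K ->
  (forall z, r < Cmod z -> inD z -> v z <= K * u z) -> small b u -> small b v.
Proof.
  intros Hr HK H.
  assert (Hn : forall B, near_circle u B -> near_circle v (K * B)).
  { intros B HB. apply (near_circle_le u u v B B (K * B) r); auto.
    intros z Hz HzD Hu _. eapply Rle_trans; [apply H; auto|]. apply Rmult_le_compat_l; lra. }
  destruct b; simpl.
  - intros [B HB]. exists (K * B). auto.
  - intros Hu eps He. replace eps with (K * (eps / K)) by (field; lra).
    apply Hn, Hu. apply Rdiv_lt_0_compat; lra.
Qed.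

Lemma small_0 (b : bool) : small b (fun _ => 0).
Proof.
  assert (H : forall B, 0 <= B -> near_circle (fun _ => 0) B) by (intros B HB; exists 0; split; intros; lra).
  destruct b; simpl; [exists 0; apply H; lra|]. intros eps He. apply H. lra.
Qed.

Lemma small_plus (b : bool) (u v : C -> R) : small b u -> small b v -> small b (fun z => u z + v z).
Proof.
  assert (H : forall B B', near_circle u B -> near_circle v B' -> near_circle (fun z => u z + v z) (B + B')).
  { intros B B'. apply near_circle_le with (r := 0); [lra|]. intros; lra. }
  destruct b; simpl.
  - intros [B HB] [B' HB']. exists (B + B'). auto.
  - intros Hu Hv eps He. replace eps with (eps / 2 + eps / 2) by field. apply H; [apply Hu|apply Hv]; lra.
Qed.

Lemma small_rsum (b : bool) (n : nat) (u : nat -> C -> R) : (forall i, (i < n)%nat -> small b (u i)) ->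
  small b (fun z => rsum n (fun i => u i z)).
Proof.
  induction n; intros H; simpl; [apply small_0|].
  apply small_plus; [apply IHn; intros; apply H; lia|apply H; lia].
Qed.

Lemma small_cder (b : bool) (s : R) (f : C -> C) : analytic_D f ->
  small b (fun z => wt s z * Cmod (f z)) -> small b (fun z => wt (s + 1) z * Cmod (cder f z)).
Proof.
  intros Hf. destruct (cauchy_weighted s) as [K [HK H]].
  assert (Hn : forall B, near_circle (fun z => wt s z * Cmod (f z)) B ->
     near_circle (fun z => wt (s + 1) z * Cmod (cder f z)) (K * B)).
  (* A point [z] of the Cauchy disc satisfies [|z| >= (3 |w| - 1) / 2], which exceeds [r] exactly
     when [|w| > (2 r + 1) / 3]. *)
  { intros B [r [Hr Hu]]. exists ((2 * r + 1) / 3). split; [lra|].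
    intros w Hw HwD. apply H; auto. intros z Hz.
    destruct (wt_comparable s z w HwD Hz) as [HzD _]. apply Hu; auto.
    assert (H1 := Cmod_triangle_rev w z). rewrite Cmod_minus_sym in H1. lra. }
  destruct b; simpl.
  - intros [B HB]. exists (K * B). auto.
  - intros Hu eps He. replace eps with (K * (eps / K)) by (field; lra).
    apply Hn, Hu. apply Rdiv_lt_0_compat; lra.
Qed.

Lemma small_cder_n (b : bool) (s : R) (f : C -> C) (m : nat) : analytic_D f ->
  small b (fun z => wt s z * Cmod (f z)) -> small b (fun z => wt (s + INR m) z * Cmod (cder_n m f z)).
Proof.
  intros Hf Hs. induction m as [|m IH].
  - simpl. rewrite Rplus_0_r. exact Hs.
  - rewrite S_INR, <- Rplus_assoc. apply (small_cder b (s + INR m) (cder_n m f)); [|exact IH].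
    apply analytic_cder_n, Hf.
Qed.

(** * Necessity *)


Lemma cder_n_add (a b : nat) (f : C -> C) : cder_n a (cder_n b f) = cder_n (a + b) f.
Proof. induction a; [reflexivity|]. rewrite cder_n_S, IHa. reflexivity. Qed.

Section Necessity.

Variables (alpha beta : R) (n NN : nat) (g : nat -> C -> C) (N k : nat -> nat).
Hypothesis Halpha : 0 < alpha.
Hypothesis Hbeta : 0 < beta.
Hypothesis Hg : forall i, (i < n)%nat -> analytic_D (g i).
Hypothesis Ht : forall i, (i < n)%nat -> (0 < N i - k i)%nat /\ (N i - k i < N i)%nat.
Hypothesis HNN : forall i, (i < n)%nat -> (N i <= NN)%nat.
Hypothesis HNN0 : (0 < NN)%nat.

Definition Sop (f : C -> C) (z : C) : C := csum n (fun i => IgNk (N i) (k i) (g i) f z).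

(** Leibniz' expansion of the derivative of order [NN] of [Sop f]. At each point it is an explicit
    linear form in the derivatives of [f] there, so scaling and smallness are read off pointwise,
    without a linearity statement for the integral operators. *)
Definition Stop (f : C -> C) (z : C) : C :=
  csum n (fun i => csum (S (NN - N i)) (fun l =>
    INR (bin (NN - N i) l) * (cder_n (NN - (N i - k i) - l) f z * cder_n l (g i) z))%C).

Lemma Sop_analytic (f : C -> C) : analytic_D f -> analytic_D (Sop f).
Proof.
  intros Hf. apply (analytic_csum n (fun i => IgNk (N i) (k i) (g i) f)).
  intros i Hi. apply IgNk_analytic; auto.
Qed.

Lemma cder_n_Sop (f : C -> C) (z : C) : analytic_D f -> inD z -> cder_n NN (Sop f) z = Stop f z.
Proof.
  intros Hf Hz. unfold Sop, Stop.
  rewrite (cder_n_csum NN n (fun i => IgNk (N i) (k i) (g i) f)); [|intros i Hi; apply IgNk_analytic; auto|exact Hz].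
  apply csum_ext. intros i Hi. specialize (HNN i Hi). destruct (Ht i Hi) as [T1 T2].
  (* The first [N i] derivatives undo the integrations; Leibniz' rule handles the remaining
     [NN - N i]. *)
  replace NN with (NN - N i + N i)%nat at 1 by lia.
  rewrite <- cder_n_add.
  rewrite (cder_n_ext_D (NN - N i) (cder_n (N i) (IgNk (N i) (k i) (g i) f)) (fun w => cder_n (k i) f w * g i w)%C); auto.
  - rewrite leibniz by (auto; apply analytic_cder_n; auto).
    apply csum_ext. intros l Hl. rewrite cder_n_add.
    replace (NN - N i - l + k i)%nat with (NN - (N i - k i) - l)%nat by lia. reflexivity.
  - apply analytic_cder_n, IgNk_analytic; auto.
  - intros w Hw. apply IgNk_top; auto.
Qed.

Lemma Stop_scal (f h : C -> C) (c z : C) : (forall j, cder_n j f z = c * cder_n j h z)%C ->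
  (Stop f z = c * Stop h z)%C.
Proof.
  intros H. unfold Stop. rewrite <- csum_scal. apply csum_ext. intros i _.
  rewrite <- csum_scal. apply csum_ext. intros l _. rewrite H. ring.
Qed.

Lemma Stop_bound (z : C) : exists A, 0 <= A /\ forall f eps, 0 <= eps ->
  (forall j, (j <= NN)%nat -> Cmod (cder_n j f z) <= eps) -> Cmod (Stop f z) <= A * eps.
Proof.
  exists (rsum n (fun i => rsum (S (NN - N i)) (fun l => Rabs (INR (bin (NN - N i) l)) * Cmod (cder_n l (g i) z)))).
  split.
  - apply rsum_ge_0. intros i. apply rsum_ge_0. intros l. apply Rmult_le_pos; [apply Rabs_pos|apply Cmod_ge_0].
  - intros f eps He Hf. unfold Stop. eapply Rle_trans; [apply Cmod_csum|].
    rewrite Rmult_comm, <- rsum_scal. apply rsum_le. intros i _.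
    eapply Rle_trans; [apply Cmod_csum|]. rewrite <- rsum_scal. apply rsum_le. intros l _.
    rewrite !Cmod_mult, Cmod_R. specialize (Hf (NN - (N i - k i) - l)%nat ltac:(lia)).
    replace (eps * (Rabs (INR (bin (NN - N i) l)) * Cmod (cder_n l (g i) z)))
      with (Rabs (INR (bin (NN - N i) l)) * (eps * Cmod (cder_n l (g i) z))) by ring.
    apply Rmult_le_compat_l; [apply Rabs_pos|]. apply Rmult_le_compat_r; [apply Cmod_ge_0|exact Hf].
Qed.

(* The guard excludes [j > NN - t_i], where truncated subtraction would produce a spurious [g_i]. *)
Definition Hterm (j i : nat) (z : C) : C :=
  if le_dec j (NN - (N i - k i))
  then (INR (bin (NN - N i) (NN - (N i - k i) - j)) * cder_n (NN - (N i - k i) - j) (g i) z)%C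
  else RtoC 0.

Definition Hcoef (j : nat) (z : C) : C := csum n (fun i => Hterm j i z).

Lemma Stop_Hcoef (f : C -> C) (z : C) :
  Stop f z = csum (S NN) (fun j => cder_n j f z * Hcoef j z)%C.
Proof.
  unfold Stop, Hcoef.
  rewrite (csum_ext (S NN) _ (fun j => csum n (fun i => cder_n j f z * Hterm j i z)%C))
    by (intros; rewrite csum_scal; reflexivity).
  rewrite <- csum_swap. apply csum_ext. intros i Hi.
  specialize (HNN i Hi). destruct (Ht i Hi) as [T1 T2].
  rewrite (csum_reindex (NN - N i) (NN - (N i - k i)) (S NN)); try lia.
  - apply csum_ext. intros j Hj. unfold Hterm. destruct (le_dec j (NN - (N i - k i))) as [H|H]; [|ring].
    replace (NN - (N i - k i) - (NN - (N i - k i) - j))%nat with j by lia. ring.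
  - intros l Hl. rewrite bin_gt by exact Hl. simpl (INR 0). ring.
Qed.

(** What multiplies [rising M j] when the test function is evaluated at [z = w]: there the kernel is
    [1 / (1 - |w|^2)], so the normalization cancels the power [M]. Independence of [M] is what
    allows [rising_independent] to apply. *)
Definition tcoef (j : nat) (w : C) : C :=
  (wt (1 - alpha) w * ((Cconj w * / (1 - Cmod w ^ 2)%R) ^ j * Hcoef j w))%C.

Lemma Stop_test (M : nat) (w : C) : inD w ->
  Stop (test 1 alpha M w) w = csum (S NN) (fun j => rising M j * tcoef j w)%C.
Proof.
  intros Hw. rewrite Stop_Hcoef. apply csum_ext. intros j _.
  rewrite test_cd_n by auto. destruct (delta_bounds w Hw) as (_ & D2 & _).
  assert (E : (1 - Cconj w * w)%C = RtoC (1 - Cmod w ^ 2)).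
  { rewrite RtoC_minus, Cmod2_conj. ring. }
  rewrite E. unfold test_coef, tcoef. set (d := 1 - Cmod w ^ 2) in *.
  assert (Hd : RtoC d <> RtoC 0) by (intros E0; apply RtoC_inj in E0; lra).
  rewrite !RtoC_mult, RtoC_pow, Cpow_mult_l, Cpow_inv, Cpow_add_r by exact Hd.
  field. split; apply Cpow_nz, Hd.
Qed.

(** The factor [conj w ^ j] degenerates at 0, hence [|w| > 1/2]. Then [1 - |w|^2 <= 2 (1 - |w|) <= 4
    |w| (1 - |w|)], which yields the constant [4 ^ j]. *)
Lemma tcoef_Hcoef (j : nat) (w : C) : / 2 < Cmod w -> inD w ->
  wt (1 - alpha - INR j) w * Cmod (Hcoef j w) <= 4 ^ j * Cmod (tcoef j w).
Proof.
  intros Hw1 Hw. destruct (delta_bounds w Hw) as (D1 & D2 & D3).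
  unfold tcoef. set (d := 1 - Cmod w ^ 2) in *.
  assert (Hd : RtoC d <> RtoC 0) by (intros E0; apply RtoC_inj in E0; lra).
  rewrite !Cmod_mult, Cmod_pow, Cmod_mult, Cmod_conj, Cmod_inv, !Cmod_R by exact Hd.
  rewrite (Rabs_right (wt _ w)) by (left; apply wt_pos).
  rewrite (Rabs_right d) by lra.
  unfold Rminus at 1. rewrite wt_plus.
  assert (P : wt (- INR j) w <= 4 ^ j * (Cmod w * / d) ^ j).
  { unfold wt. rewrite Rpower_Ropp, Rpower_pow by lra. rewrite <- pow_inv, <- Rpow_mult_distr.
    apply pow_incr. split; [left; apply Rinv_0_lt_compat; lra|].
    apply Rmult_le_reg_r with d; [lra|].
    replace (4 * (Cmod w * / d) * d) with (4 * Cmod w) by (field; lra).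
    apply Rmult_le_reg_l with (1 - Cmod w); [lra|].
    rewrite <- Rmult_assoc, Rinv_r, Rmult_1_l by lra. nra. }
  assert (Q := wt_pos (1 - alpha) w). assert (Q' := Cmod_ge_0 (Hcoef j w)).
  replace (4 ^ j * (wt (1 - alpha) w * ((Cmod w * / d) ^ j * Cmod (Hcoef j w))))
    with (wt (1 - alpha) w * (4 ^ j * (Cmod w * / d) ^ j) * Cmod (Hcoef j w)) by ring.
  apply Rmult_le_compat_r; [exact Q'|]. apply Rmult_le_compat_l; lra.
Qed.

Definition test_growth (M : nat) (w : C) : R :=
  wt (beta + INR (NN - 1)) w * Cmod (Stop (test 1 alpha M w) w).

Lemma bounded_test_small (M : nat) : alpha <= INR M -> bounded_op alpha beta Sop ->
  small true (test_growth M).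
Proof.
  intros HM [HS [K0 HK0]].
  destruct (test_bloch alpha M Halpha HM) as [K1 [HK1 HT]].
  destruct (bloch_top beta NN HNN0) as [K [HK HB]].
  exists (K * (Rabs K0 * K1)), 0. split; [lra|]. intros w _ Hw.
  destruct (HT 1 w Rle_0_1 Hw) as [T1 T2].
  unfold test_growth. rewrite <- (cder_n_Sop _ _ (proj1 T1) Hw).
  eapply Rle_trans; [apply HB; auto|]. apply Rmult_le_compat_l; [lra|].
  eapply Rle_trans; [apply HK0, T1|].
  assert (T3 := bloch_norm_ge_0 _ _ T1).
  (* The constant in [bounded_op] has no prescribed sign. *)
  apply Rle_trans with (Rabs K0 * bloch_norm alpha (test 1 alpha M w)).
  - apply Rmult_le_compat_r; [exact T3|apply Rle_abs].
  - apply Rmult_le_compat_l; [apply Rabs_pos|lra].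
Qed.

(* The images of the test functions have only the limit [0], since their derivatives tend to [0] pointwise. *)
Lemma compact_test_small (M : nat) : alpha <= INR M -> compact_op alpha beta Sop ->
  small false (test_growth M).
Proof.
  intros HM [HS HC] eps Heps. apply NNPP. intros Hno.
  destruct (test_bloch alpha M Halpha HM) as [K1 [HK1 HT]].
  destruct (bloch_top beta NN HNN0) as [K [HK HB]].
  set (U := fun w => wt (beta + INR (NN - 1)) w * Cmod (Stop (test 1 alpha M w) w)).
  assert (Hw : forall m : nat, exists w, 1 - / INR (S m) < Cmod w /\ inD w /\ eps < test_growth M w).
  { intros m. apply NNPP. intros H. apply Hno. exists (1 - / INR (S m)).
    assert (0 < / INR (S m)) by (apply Rinv_0_lt_compat, lt_0_INR; lia). split; [lra|].
    intros z Hz HzD. apply Rnot_lt_le. intros H1. apply H. exists z. auto. }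
  destruct (fun_choice _ Hw) as [ww Hww].
  (* This factor brings all test functions into the unit ball. *)
  set (kappa := / K1).
  assert (Hk : 0 < kappa) by (apply Rinv_0_lt_compat; exact HK1).
  pose (fs := fun m => test kappa alpha M (ww m)).
  assert (Hfs : forall m, in_bloch alpha (fs m) /\ bloch_norm alpha (fs m) <= 1).
  { intros m. destruct (HT kappa (ww m) ltac:(lra) (proj1 (proj2 (Hww m)))) as [T1 T2].
    split; [exact T1|]. eapply Rle_trans; [exact T2|]. unfold kappa. rewrite Rinv_l; lra. }
  destruct (HC fs Hfs) as (phi & h & Hphi & Hh & Hlim).
  assert (Hsub : forall m, in_bloch beta (fsub (Sop (fs (phi m))) h)).
  { intros m. apply in_bloch_sub; [apply HS, Hfs|exact Hh]. }
  assert (Hdiff : forall m z, inD z ->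
    wt (beta + INR (NN - 1)) z * Cmod (Stop (fs (phi m)) z - cder_n NN h z) <= K * bloch_norm beta (fsub (Sop (fs (phi m))) h)).
  { intros m z Hz. rewrite <- (cder_n_Sop _ _ (proj1 (proj1 (Hfs (phi m)))) Hz).
    rewrite <- (cder_n_minus NN (Sop (fs (phi m))) h); [apply HB; [exact (Hsub m)|exact Hz]| |apply Hh|exact Hz].
    apply Sop_analytic, Hfs. }
  assert (Hh0 : forall z, inD z -> cder_n NN h z = 0%C).
  { intros z Hz. apply Cmod_small_0. intros e He.
    destruct (Stop_bound z) as [A [HA HAf]].
    assert (Hwp := wt_pos (beta + INR (NN - 1)) z). set (W := wt (beta + INR (NN - 1)) z) in *.
    destruct (is_lim_seq_0_elim _ Hlim (e / 2 * W / K)) as [m1 H1].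
    { apply Rdiv_lt_0_compat; [apply Rmult_lt_0_compat; lra|exact HK]. }
    destruct (test_vanishes kappa alpha M z NN ltac:(lra) HM Hz (e / 2 / (A + 1))) as [r [Hr Hv]].
    { apply Rdiv_lt_0_compat; lra. }
    destruct (archimed_cor1 (1 - r) ltac:(lra)) as [m2 [Hm2 Hm20]].
    set (m := (m1 + m2)%nat). specialize (H1 m ltac:(unfold m; lia)).
    assert (Hpm := incr_ge phi Hphi m).
    destruct (Hww (phi m)) as (W1 & W2 & _).
    assert (Hrw : r < Cmod (ww (phi m))).
    { assert (/ INR (S (phi m)) <= / INR m2); [|lra].
      apply Rinv_le_contravar; [apply lt_0_INR; lia|apply le_INR; unfold m in *; lia]. }
    assert (Hs : Cmod (Stop (fs (phi m)) z) <= e / 2).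
    { eapply Rle_trans; [apply HAf with (eps := e / 2 / (A + 1))|].
      - left. apply Rdiv_lt_0_compat; lra.
      - intros j Hj. apply Hv; auto.
      - apply Rmult_frac_le; lra. }
    assert (Hd := Hdiff m z Hz). fold W in Hd.
    assert (Hd2 : Cmod (Stop (fs (phi m)) z - cder_n NN h z) <= e / 2).
    { apply Rmult_le_reg_l with W; [exact Hwp|]. eapply Rle_trans; [exact Hd|].
      apply (Rmult_le_compat_l K) in H1; [|lra].
      replace (K * (e / 2 * W / K)) with (W * (e / 2)) in H1 by (field; lra). exact H1. }
    assert (H3 := Cmod_triangle_rev (cder_n NN h z) (Stop (fs (phi m)) z)).
    rewrite Cmod_minus_sym in H3. lra. }
  (* The limit has vanishing top derivative, so the weighted top derivative at [ww (phi m)] would be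
     at most [kappa * eps / 2], although the choice of [ww] keeps it above [kappa * eps]. *)
  destruct (is_lim_seq_0_elim _ Hlim (kappa * eps / (2 * K))) as [m H1].
  { apply Rdiv_lt_0_compat; [apply Rmult_lt_0_compat; lra|lra]. }
  specialize (H1 m (Nat.le_refl _)). destruct (Hww (phi m)) as (_ & W2 & W3).
  assert (Hd := Hdiff m (ww (phi m)) W2). rewrite (Hh0 _ W2) in Hd.
  replace (Stop (fs (phi m)) (ww (phi m)) - 0)%C with (Stop (fs (phi m)) (ww (phi m))) in Hd by ring.
  rewrite (Stop_scal (fs (phi m)) (test 1 alpha M (ww (phi m))) kappa) in Hd.
  2: { intros j. unfold fs. rewrite !test_cd_n by auto. rewrite test_coef_kappa, RtoC_mult. ring. }
  rewrite Cmod_mult, Cmod_R, Rabs_right in Hd by lra.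
  unfold test_growth in W3.
  apply (Rmult_le_compat_l K) in H1; [|lra].
  replace (K * (kappa * eps / (2 * K))) with (kappa * eps / 2) in H1 by (field; lra).
  apply (Rmult_lt_compat_l kappa) in W3; [|exact Hk].
  assert (0 < kappa * eps) by (apply Rmult_lt_0_compat; lra). lra.
Qed.

(** The [NN + 1] exponents from [M0] to [M0 + NN] determine the [NN + 1] numbers [tcoef j w], with a
    constant independent of [w]. The weights combine as [(beta + NN - 1) + (1 - alpha - j) = beta -
    alpha + NN - j]. *)
Lemma Hcoef_small (b : bool) (M0 : nat) :
  (forall M, (M0 <= M)%nat -> small b (test_growth M)) ->
  forall j, (j <= NN)%nat -> small b (fun w => wt (beta - alpha + INR (NN - j)) w * Cmod (Hcoef j w)).
Proof.
  intros HM j Hj.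
  destruct (rising_independent NN M0) as [K [HK Hind]].
  assert (H4 : 0 < 4 ^ j) by (apply pow_lt; lra).
  apply (small_le b (fun w => rsum (S NN) (fun q => test_growth (M0 + q) w))
    _ (4 ^ j * K) (/ 2)); [lra|apply Rmult_lt_0_compat; lra| |].
  - intros w Hw1 Hw. set (W := wt (beta + INR (NN - 1)) w).
    assert (HW : 0 < W) by apply wt_pos.
    set (B := rsum (S NN) (fun q => test_growth (M0 + q) w)).
    assert (Hc : Cmod (W * tcoef j w)%C <= K * B).
    { apply (Hind (fun j => W * tcoef j w)%C B); [|exact Hj].
      intros M HMr. rewrite (csum_ext (S NN) _ (fun j => W * (rising M j * tcoef j w))%C) by (intros; ring).
      rewrite csum_scal, <- Stop_test, Cmod_mult, Cmod_R, Rabs_right by (auto; lra).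
      replace M with (M0 + (M - M0))%nat by lia.
      apply (rsum_term (S NN) (M - M0) (fun q => test_growth (M0 + q) w)); [|lia].
      intros q. apply Rmult_le_pos; [left; apply wt_pos|apply Cmod_ge_0]. }
    rewrite Cmod_mult, Cmod_R, Rabs_right in Hc by lra.
    assert (Hd := tcoef_Hcoef j w Hw1 Hw).
    replace (beta - alpha + INR (NN - j)) with ((beta + INR (NN - 1)) + (1 - alpha - INR j)).
    2: { rewrite !minus_INR by lia. simpl (INR 1). ring. }
    rewrite wt_plus. fold W.
    apply Rle_trans with (W * (4 ^ j * Cmod (tcoef j w))).
    + rewrite Rmult_assoc. apply Rmult_le_compat_l; lra.
    + replace (W * (4 ^ j * Cmod (tcoef j w))) with (4 ^ j * (W * Cmod (tcoef j w))) by ring.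
      rewrite Rmult_assoc. apply Rmult_le_compat_l; lra.
  - apply (small_rsum b (S NN) (fun q w => test_growth (M0 + q) w)).
    intros q _. apply HM. lia.
Qed.

Hypothesis Hdist : forall i j, (i < n)%nat -> (j < n)%nat -> i <> j -> (N i - k i)%nat <> (N j - k j)%nat.

(* The coefficient of order [NN - t_i] is [g_i] plus derivatives of those [g_j] with [t_j < t_i]. *)
Lemma symbols_small (b : bool) :
  (forall j, (j <= NN)%nat -> small b (fun w => wt (beta - alpha + INR (NN - j)) w * Cmod (Hcoef j w))) ->
  forall i, (i < n)%nat -> small b (fun w => wt (beta - alpha + INR (N i - k i)) w * Cmod (g i w)).
Proof.
  intros HH.
  assert (H : forall t i, (i < n)%nat -> (N i - k i)%nat = t ->
    small b (fun w => wt (beta - alpha + INR (N i - k i)) w * Cmod (g i w))).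
  { intros t. induction t as [t IH] using lt_wf_ind. intros i Hi Hti.
    destruct (Ht i Hi) as [T1 T2]. assert (Hni := HNN i Hi).
    set (s := beta - alpha + INR (N i - k i)).
    pose (R1 := fun j => fun w => if Nat.eq_dec j i then RtoC 0 else Hterm (NN - (N i - k i)) j w).
    assert (E : forall w, g i w = (Hcoef (NN - (N i - k i)) w - csum n (fun j => R1 j w))%C).
    { intros w. unfold Hcoef. rewrite (csum_remove n i) by exact Hi.
      assert (E0 : Hterm (NN - (N i - k i)) i w = g i w).
      { unfold Hterm. destruct (le_dec (NN - (N i - k i)) (NN - (N i - k i))) as [_|Hx]; [|lia].
        rewrite Nat.sub_diag, bin_0. simpl. ring. }
      rewrite E0. unfold R1. ring. }
    apply (small_le b (fun w => wt s w * Cmod (Hcoef (NN - (N i - k i)) w)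
        + rsum n (fun j => wt s w * Cmod (R1 j w))) _ 1 0); [lra|lra| |].
    - intros w _ _. rewrite Rmult_1_l, rsum_scal, <- Rmult_plus_distr_l.
      apply Rmult_le_compat_l; [left; apply wt_pos|]. rewrite (E w).
      eapply Rle_trans; [apply Cmod_triangle_minus|]. apply Rplus_le_compat_l, Cmod_csum.
    - apply small_plus.
      + assert (HHi := HH (NN - (N i - k i))%nat ltac:(lia)).
        replace (NN - (NN - (N i - k i)))%nat with (N i - k i)%nat in HHi by lia. exact HHi.
      + apply (small_rsum b n (fun j w => wt s w * Cmod (R1 j w))). intros j Hj.
        unfold R1. destruct (Nat.eq_dec j i) as [->|Hji].
        { apply (small_le b (fun _ => 0) _ 1 0); [lra|lra| |apply small_0].
          intros w _ _. rewrite Cmod_0. lra. }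
        assert (Hnj := HNN j Hj). destruct (Ht j Hj) as [T1j T2j].
        (* The guard holds exactly when [t_j <= t_i]; as the numbers are distinct, the inequality is
           strict and the induction hypothesis covers [g j]. *)
        unfold Hterm. destruct (le_dec (NN - (N i - k i)) (NN - (N j - k j))) as [Hle|Hle].
        * assert (Hlt : (N j - k j < N i - k i)%nat).
          { specialize (Hdist j i Hj Hi Hji). lia. }
          assert (Hs := IH (N j - k j)%nat ltac:(lia) j Hj eq_refl).
          (* The order is [t_i - t_j], which raises the exponent of [g j] to that of [g i]. *)
          apply (small_cder_n b _ _ (NN - (N j - k j) - (NN - (N i - k i)))) in Hs; [|apply Hg, Hj].
          set (l := (NN - (N j - k j) - (NN - (N i - k i)))%nat) in *.
          set (c := INR (bin (NN - N j) l)).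
          assert (Hc : 0 <= c) by apply pos_INR.
          (* [small_le] asks for a positive constant, and the binomial coefficient [c] may be 0. *)
          apply (small_le b _ _ (c + 1) 0 Rlt_0_1 ltac:(lra)) with (2 := Hs).
          intros w _ _. rewrite Cmod_mult, Cmod_R, Rabs_right by lra.
          replace (beta - alpha + INR (N j - k j) + INR l) with s.
          2: { unfold s. rewrite Rplus_assoc, <- plus_INR. f_equal. f_equal. unfold l. lia. }
          assert (H0 : 0 <= wt s w * Cmod (cder_n l (g j) w))
            by (apply Rmult_le_pos; [left; apply wt_pos|apply Cmod_ge_0]).
          lra.
        * apply (small_le b (fun _ => 0) _ 1 0); [lra|lra| |apply small_0].
          intros w _ _. rewrite Cmod_0. lra. }
  intros i Hi. apply (H (N i - k i)%nat i Hi eq_refl).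
Qed.

End Necessity.

Lemma nat_bounded (n : nat) (N : nat -> nat) : exists B, (0 < B)%nat /\ forall i, (i < n)%nat -> (N i <= B)%nat.
Proof.
  induction n as [|n [B [HB H]]].
  - exists 1%nat. split; [lia|]. intros; lia.
  - exists (B + N n)%nat. split; [lia|]. intros i Hi.
    destruct (Nat.eq_dec i n) as [->|Hd]; [lia|]. specialize (H i ltac:(lia)). lia.
Qed.

Theorem theoremB (alpha beta : R) (n : nat) (g : nat -> C -> C) (N k : nat -> nat) :
  0 < alpha -> 0 < beta -> (0 < n)%nat ->
  (forall i, (i < n)%nat -> analytic_D (g i)) ->
  (forall i, (i < n)%nat -> (0 < N i - k i)%nat /\ (N i - k i < N i)%nat) ->
  (forall i j, (i < n)%nat -> (j < n)%nat -> i <> j -> (N i - k i)%nat <> (N j - k j)%nat) ->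
  let S := fun (f : C -> C) (z : C) => csum n (fun i => IgNk (N i) (k i) (g i) f z) in
  (bounded_op alpha beta S <->
     (forall i, (i < n)%nat -> bounded_op alpha beta (IgNk (N i) (k i) (g i)))) /\
  (compact_op alpha beta S <->
     (forall i, (i < n)%nat -> compact_op alpha beta (IgNk (N i) (k i) (g i)))).
Proof.
  intros Ha Hb Hn Hg Ht Hdist S.
  destruct (nat_bounded n N) as [NN [HNN0 HNN]].
  (* From [M0] on, the test functions are bounded in B^alpha uniformly in [w]. *)
  destruct (INR_unbounded alpha) as [M0 HM0].
  assert (HM : forall M, (M0 <= M)%nat -> alpha <= INR M).
  { intros M HM. apply le_INR in HM. lra. }
  split; split.
  - intros HS i Hi. apply bounded_sufficient; auto.
    apply (symbols_small alpha beta n NN g N k); auto.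
    apply (Hcoef_small alpha beta n NN g N k) with (M0 := M0); auto.
    intros M HMM. apply bounded_test_small; auto.
  - intros HT. exact (bounded_op_csum alpha beta n (fun i => IgNk (N i) (k i) (g i)) HT).
  - intros HS i Hi. apply compact_sufficient; auto.
    apply (symbols_small alpha beta n NN g N k); auto.
    apply (Hcoef_small alpha beta n NN g N k) with (M0 := M0); auto.
    intros M HMM. apply compact_test_small; auto.
  - intros HT. exact (compact_op_csum alpha beta n (fun i => IgNk (N i) (k i) (g i)) HT).
Qed.
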